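(* Let $n\ge1$ and let $\sigma$ be a positive Radon measure on $\mathbb{S}^n$. Suppose there exist constants $p\ge1$, $1\le q<\infty$, $r>1+(n-1)\delta_s$ with $r\ge2$, $a_i\in[0,1]$ for $1\le i\le k$, and $C>0$ such that $$\|u\|_{L^q(\sigma)}\le C\sum_{i=1}^k|u|_{W^{1,r}(\mathbb{S}^n)}^{a_i}\,\|u\|_{L^p(\nu_n)}^{1-a_i}\quad\text{for all }u\in W^{1,r}(\mathbb{S}^n).$$ Then there exist $0<\underline{\delta}\le\overline{\delta}\le\infty$ with $\overline{\delta}\ge1$ and $C_\sigma>0$ such that, for all dyadic simplexes $S\subseteq\mathbb{S}^n$, $$\sigma(S)\le C_\sigma\,\nu_n(S)^{1/\overline{\delta}}\ \text{ if } 0<\mathrm{diam}(S)\le 1,\qquad \sigma(S)\le C_\sigma\,\nu_n(S)^{1/\underline{\delta}}\ \text{ if } \mathrm{diam}(S)>1 .$$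
   Context: Conventions: $1/\infty=0$, $\delta_s=\frac{1}{2/d_s-1}$ with $d_s=\frac{2\log 3}{\log 5}$ (so $3^{1/\delta_s}=5/3$). Sierpinski spaces. Let $p_1=(0,0)$, $p_2=(1,0)$, $p_3=(1/2,\sqrt3/2)$, $\mathrm V_{0,0}=\{p_1,p_2,p_3\}$, $\mathbf F_i(x)=\frac12(x+p_i)$ on $\mathbb R^2$, $\mathrm V_{0,m}=\bigcup_{i=1}^3\mathbf F_i(\mathrm V_{0,m-1})$. $\mathbb S_0$ is the closure of $\bigcup_m\mathrm V_{0,m}$ and $\mathbb S=\bigcup_{m\ge0}\mathbf F_1^{-m}[\mathbb S_0\cup(-\mathbb S_0)]$. Write $\mathbb S=\bigcup_{i\in\mathbb Z}\mathbb S_i$ where the $\mathbb S_i$ are the non-overlapping unit cells, $\mathbb S_i=\tau_i(\mathbb S_0)$ with $\tau_i(x)=\pm x+c_i$ ($\mathbb S_i$ is a translate of $\mathbb S_0$ or of $-\mathbb S_0$; $\tau_0=\mathrm{id}$). $\mathrm W_*$ is the set of infinite sequences $\omega=\omega_1\omega_2\dots$ in $\{1,2,3\}$, and $\mathbf F_{[\omega]_m}=\mathbf F_{\omega_1}\circ\cdots\circ\mathbf F_{\omega_m}$. $\nu$ is the Borel measure on $\mathbb S$ with $\nu(\tau_i\mathbf F_{[\omega]_m}(\mathbb S_0))=3^{-m}$ for all $i,m,\omega$, and $\nu_n=\nu\times\cdots\times\nu$ on $\mathbb S^n$. For $i\in\mathbb Z^n$ put $\mathbb S^n_i=\mathbb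 S_{i_1}\times\cdots\times\mathbb S_{i_n}$, and let $\mathbf F_{(1,\dots,1)}$ act as $\mathbf F_1$ on each coordinate. Dyadic simplexes in $\mathbb S^n$ are the sets $\mathbf F_{(1,\dots,1)}^{-m}(\mathbb S^n_i)$, $m\in\mathbb Z$, $i\in\mathbb Z^n$; $\mathrm{diam}$ is taken in the metric $\max_k|x_k-y_k|$, so that this set has diameter $2^m$ (and $\nu_n$-measure $3^{mn}$). Energy. For continuous $u$ on $\mathbb S_0$, $\mathcal E_0(u,u)=\lim_{m}\mathcal E_0^{(m)}(u,u)$ (a nondecreasing limit), where $\mathcal E_0^{(m)}(u,u)=\sum\frac12(\frac53)^m|u(x)-u(y)|^2$ over unordered pairs $\{x,y\}\subseteq \mathrm V_{0,m}$ with $|x-y|=2^{-m}$; $\mathcal F(\mathbb S_0)=\{u\in C(\mathbb S_0):\mathcal E_0(u,u)<\infty\}$, and $\mathcal E_0(\cdot,\cdot)$ is extended by polarisation. For $u\in\mathcal F(\mathbb S_0)$ the energy measure $\mu_{\langle u\rangle}$ on $\mathbb S_0$ is defined by $\int\phi\,d\mu_{\langle u\rangle}=\mathcal E_0(\phi u,u)-\frac12\mathcal E_0(\phi,u^2)$ for $\phi\in\mathcal F(\mathbb S_0)$, and $\mu_{\langle u,w\rangle}=\frac14(\mu_{\langle u+w\rangle}-\mu_{\langle u-w\rangle})$. $\mathcal F(\mathbb S)$ is the set of continuous $u\in L^2(\mathbb S;\nu)$ with $\mathcal E(u,u)=\sum_{i\in\mathbb Z}\mathcal E_0(u\circ\tau_i,u\circ\tau_i)<\infty$.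 Kusuoka measure. Let $\mathbf Y_1=\frac15\begin{pmatrix}2&-1&-1\\-1&1&0\\-1&0&1\end{pmatrix}$, $\mathbf Y_2=\frac15\begin{pmatrix}1&-1&0\\-1&2&-1\\0&-1&1\end{pmatrix}$, $\mathbf Y_3=\frac15\begin{pmatrix}1&0&-1\\0&1&-1\\-1&-1&2\end{pmatrix}$, and $\mathbf Y_{[\omega]_m}=\mathbf Y_{\omega_m}\cdots\mathbf Y_{\omega_1}$. The Kusuoka measure $\mu$ is the Borel measure on $\mathbb S$ with $\mu(\tau_i\mathbf F_{[\omega]_m}(\mathbb S_0))=\frac12(\frac53)^m\,\mathrm{trace}(\mathbf Y_{[\omega]_m}^{\mathrm t}\mathbf Y_{[\omega]_m})$ for $m\ge1$, and $\mu(\mathbb S_i)=1$. One has $\mu_{\langle u\rangle}\ll\mu$ on $\mathbb S_0$ for all $u\in\mathcal F(\mathbb S_0)$. Gradient. Let $h_1$ be the harmonic function in $\mathbb S_0$ with $h_1|_{\mathrm V_{0,0}}=1_{\{p_1\}}$ (the minimizer of $\mathcal E_0(w,w)$ over $w\in\mathcal F(\mathbb S_0)$ with these boundary values). Put $\nabla h_1=-\sqrt{d\mu_{\langle h_1\rangle}/d\mu}$, which is $<0$ $\mu$-a.e., and for $u\in\mathcal F(\mathbb S_0)$, $\nabla u=(\nabla h_1)^{-1}\,d\mu_{\langle u,h_1\rangle}/d\mu$. Then $|\nabla u|^2=d\mu_{\langle u\rangle}/d\mu$. For $u\in\mathcal F(\mathbb S)$, $\nabla u=\nabla(u\circ\tau_i)\circ\tau_i^{-1}$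 on $\mathbb S_i$. Sobolev space. For $x\in\mathbb S^n$ let $\widehat{x_i}$ be $x$ with the $i$-th coordinate omitted, and write $\mu\times\nu_{n-1}$ for the product measure with $\mu$ in the $i$-th coordinate and $\nu$ in the others. For $u\in C(\mathbb S^n)$ with $u(\cdot,\widehat{x_i})\in\mathcal F(\mathbb S)$ for all $1\le i\le n$ and all $\widehat{x_i}$, put $$|u|_{W^{1,r}(\mathbb S^n)}=\Big(\sum_{i=1}^n\int_{\mathbb S^n}|\nabla_i u(x_i,\widehat{x_i})|^r(\mu\times\nu_{n-1})(dx_i,d\widehat{x_i})\Big)^{1/r},$$ $\nabla_i$ being $\nabla$ in the variable $x_i$, and $\|u\|_{W^{1,r}}=(\|u\|^r_{L^r(\nu_n)}+|u|^r_{W^{1,r}})^{1/r}$. $W^{1,r}(\mathbb S^n)$ is the completion in this norm of the set of such $u$ with finite norm (the seminorm extends by continuity). Since $r>1+(n-1)\delta_s$ and $r\ge2$, its elements have continuous representatives, which are used in $\|u\|_{L^q(\sigma)}$. *)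

(* Defs.v *)
From HB Require Import structures.
From mathcomp Require Import all_boot all_order all_algebra.
From mathcomp Require Import all_classical all_reals all_analysis.

Set Implicit Arguments.
Unset Strict Implicit.
Unset Printing Implicit Defensive.

Import Order.TTheory GRing.Theory Num.Theory.
Import numFieldTopology.Exports numFieldNormedType.Exports.

Local Open Scope classical_set_scope.
Local Open Scope ring_scope.

(* Conventions.
   - A point of the plane is a row vector 'rV[R]_2, and a point of (R^2)^n is
     an n x 2 matrix, the k-th coordinate x_k being the k-th row.
   - The indices 1, 2, 3 are the elements 0, 1, 2 of 'I_3, and a word
     omega_1 omega_2 ... is a function nat -> 'I_3 indexed from 0.
   - A function (resp. Borel measure) on a closed set D such as S_0, S or S^n
     is a function on the ambient space, of which only the values on D matter
     (resp. a Borel measure on the ambient space giving mass 0 to the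
     complement of D). *)

Notation borel T := (g_sigma_algebraType (@open T)).

Section SierpinskiSpaces.
Context {R : realType}.
Implicit Types (x y : 'rV[R]_2) (m k : nat) (w : nat -> 'I_3) (i : int).

Definition enorm x : R := Num.sqrt (\sum_(j < 2) x ord0 j ^+ 2).

Definition corner (j : 'I_3) : 'rV[R]_2 :=
  \row_(l < 2)
    nth (0 : R)
      (nth [::] [:: [:: 0; 0]; [:: 1; 0]; [:: 2^-1; Num.sqrt 3 / 2]] j) l.

Definition Fmap (j : 'I_3) x : 'rV[R]_2 := 2^-1 *: (x + corner j).

Fixpoint V0 m : set 'rV[R]_2 :=
  if m is m'.+1 then \bigcup_j (Fmap j @` V0 m') else range corner.

Definition S0 : set 'rV[R]_2 := closure (\bigcup_m V0 m).

Definition gasket : set 'rV[R]_2 :=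
  \bigcup_m (iter m (Fmap ord0) @^-1` (S0 `|` (-%R @` S0))).

(* The unit cells in 2^m S_0 are the sets x + c with x in S_0 and
   c = sum_(j < m) 2^j p_(d_j) for digits d_j in {1, 2, 3}.  As p_1 = 0, the
   translations c are enumerated without repetition by the natural number k
   whose base 3 digits are the d_j (shifted to {0, 1, 2}); the cells in
   - 2^m S_0 are the opposites of these.  The nonnegative integers index the
     former cells and the negative ones the latter. *)
Definition cell_offset k : 'rV[R]_2 :=
  \sum_(j < k) 2 ^+ j *: corner (inord ((k %/ 3 ^ j) %% 3)%N).

Definition tau i x : 'rV[R]_2 :=
  match i with Posz k => x + cell_offset k | Negz k => - x - cell_offset k end.

Definition tau_inv i x : 'rV[R]_2 :=
  match i with Posz k => x - cell_offset k | Negz k => - x - cell_offset k end.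

Definition cell i : set 'rV[R]_2 := tau i @` S0.

Fixpoint Fword w m : 'rV[R]_2 -> 'rV[R]_2 :=
  if m is m'.+1 then Fword w m' \o Fmap (w m') else id.

Definition is_hausdorff (nu : {measure set (borel 'rV[R]_2) -> \bar R}) :=
  nu (~` gasket) = 0%E /\
  forall i w m, nu (tau i @` (Fword w m @` S0)) = ((3 ^+ m)^-1)%:E.

Definition Ymx (j : 'I_3) : 'M[R]_3 :=
  5^-1 *: \matrix_(k < 3, l < 3)
    (if k == l then (if k == j then 2 else 1)
     else if (k == j) || (l == j) then -1 else 0).

Fixpoint Yword w m : 'M[R]_3 :=
  if m is m'.+1 then Ymx (w m') *m Yword w m' else 1%:M.

Definition is_kusuoka (mu : {measure set (borel 'rV[R]_2) -> \bar R}) :=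
  [/\ mu (~` gasket) = 0%E,
      forall i, mu (cell i) = 1%E &
      forall i w m, (1 <= m)%N -> mu (tau i @` (Fword w m @` S0)) =
        (2^-1 * (5 / 3) ^+ m * \tr ((Yword w m)^T *m Yword w m))%:E].

Definition d_s : R := 2 * ln 3 / ln 5.

Definition delta_s : R := (2 / d_s - 1)^-1.

End SierpinskiSpaces.

Section Gradient.
Context {R : realType}.
Implicit Types (u v w phi : 'rV[R]_2 -> R).

(* The sum runs over ordered pairs, so that every unordered pair is counted
   twice, which turns the factor 1/2 into 1/4. *)
Definition energy_m (m : nat) u : R :=
  \sum_(e \in [set e : 'rV[R]_2 * 'rV[R]_2 |
                 [/\ V0 m e.1, V0 m e.2 & enorm (e.1 - e.2) = 2 ^- m]])
    4^-1 * (5 / 3) ^+ m * (u e.1 - u e.2) ^+ 2.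

Definition energy u : \bar R := limn (fun m => (energy_m m u)%:E).

Definition FS0 : set ('rV[R]_2 -> R) :=
  [set u | {within S0, continuous u} /\ (energy u < +oo)%E].

Definition energy2 u v : R :=
  (fine (energy (u \+ v)) - fine (energy (u \- v))) / 4.

Definition is_energy_measure u
    (m : {finite_measure set (borel 'rV[R]_2) -> \bar R}) :=
  m (~` S0) = 0%E /\
  forall phi, FS0 phi -> (\int[m]_(x in S0) (phi x)%:E =
    (energy2 (phi \* u) u - energy2 phi (u \* u) / 2)%:E)%E.

Definition energy_measure u : {finite_measure set (borel 'rV[R]_2) -> \bar R} :=
  if pselect (exists m, is_energy_measure u m) is left h then sval (cid h)
  else mzero.

Definition energy_measure2 u v : {charge set (borel 'rV[R]_2) -> \bar R} :=
  cscale 4^-1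
    (cadd (charge_of_finite_measure (energy_measure (u \+ v)))
          (copp (charge_of_finite_measure (energy_measure (u \- v))))).

Definition is_harmonic1 h :=
  [/\ FS0 h, forall j, h (corner j) = (j == ord0)%:R &
      forall w, FS0 w -> (forall j, w (corner j) = (j == ord0)%:R) ->
        (energy h <= energy w)%E].

Definition harmonic1 : 'rV[R]_2 -> R := xget (cst 0) is_harmonic1.

Local Open Scope charge_scope.

Definition grad_h1 (mu : {sigma_finite_measure set (borel 'rV[R]_2) -> \bar R})
    : 'rV[R]_2 -> R := fun x =>
  - Num.sqrt (fine
      (('d (charge_of_finite_measure (energy_measure harmonic1)) '/d mu) x)).

Definition grad0 (mu : {sigma_finite_measure set (borel 'rV[R]_2) -> \bar R}) u
    : 'rV[R]_2 -> R := fun x =>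
  (grad_h1 mu x)^-1 * fine (('d (energy_measure2 u harmonic1) '/d mu) x).

(* Distinct cells meet only in vertices, which form a mu-null set, so that the
   choice of a cell containing x is immaterial. *)
Definition grad (mu : {sigma_finite_measure set (borel 'rV[R]_2) -> \bar R}) u
    : 'rV[R]_2 -> R := fun x =>
  let i := xget (0 : int) [set i | cell i x] in
  grad0 mu (u \o tau i) (tau_inv i x).

Definition FS (nu : {measure set (borel 'rV[R]_2) -> \bar R})
    : set ('rV[R]_2 -> R) :=
  [set u | [/\ {within gasket, continuous u},
     ('N[nu]_(2%:E)[EFin \o (u \_ gasket)] < +oo)%E &
     (\esum_(i in [set: int]) energy (u \o tau i) < +oo)%E]].

End Gradient.

Section Powers.
Context {R : realType}.

Definition gasket_pow (n : nat) : set 'M[R]_(n, 2) :=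
  [set x | forall k, gasket (row k x)].

(* The family m_1, ..., m_n is meant to consist of sigma-finite measures; their
   product is then characterised by its values on measurable boxes. *)
Definition is_product_measure (n : nat)
    (m : 'I_n -> {measure set (borel 'rV[R]_2) -> \bar R})
    (M : {measure set (borel 'M[R]_(n, 2)) -> \bar R}) :=
  forall A : 'I_n -> set (borel 'rV[R]_2), (forall k, measurable (A k)) ->
    (M [set x | forall k, A k (row k x)] = \prod_(k < n) m k (A k))%E.

Definition is_radon_on (n : nat) (D : set 'M[R]_(n, 2))
    (sigma : {measure set (borel 'M[R]_(n, 2)) -> \bar R}) :=
  [/\ sigma (~` D) = 0%E,
      forall K : set 'M[R]_(n, 2), compact K -> (sigma K < +oo)%E &
      forall A : set (borel 'M[R]_(n, 2)), measurable A ->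
        sigma A = ereal_sup [set sigma K |
          K in [set K : set 'M[R]_(n, 2) | compact K /\ K `<=` A]]].

Definition cell_pow (n : nat) (i : 'I_n -> int) : set 'M[R]_(n, 2) :=
  [set x | forall k, cell (i k) (row k x)].

(* F_(1,...,1) is the homothety x |-> x / 2, since p_1 = 0. *)
Definition Fdiag (n : nat) (m : int) (x : 'M[R]_(n, 2)) : 'M[R]_(n, 2) :=
  (2^-1 : R) ^ m *: x.

Definition dyadic_simplex (n : nat) : set (set 'M[R]_(n, 2)) :=
  [set A | exists (m : int) (i : 'I_n -> int), A = Fdiag (- m) @` cell_pow i].

Definition dist_pow (n : nat) (x y : 'M[R]_(n, 2)) : R :=
  \big[Num.max/0]_(k < n) enorm (row k x - row k y).

Definition diam (n : nat) (A : set 'M[R]_(n, 2)) : \bar R :=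
  ereal_sup [set (dist_pow z.1 z.2)%:E | z in A `*` A].

(* The point with i-th coordinate t and other coordinates y. *)
Definition insert_coord (n : nat) (i : 'I_n) (t : 'rV[R]_2)
    (y : 'M[R]_(n.-1, 2)) : 'M[R]_(n, 2) :=
  \matrix_(j, l) if unlift i j is Some j' then y j' l else t ord0 l.

End Powers.
Arguments gasket_pow {R} n.
Arguments dyadic_simplex {R n}.

Section Sobolev.
Context {R : realType}.
Variables (nu mu : {sigma_finite_measure set (borel 'rV[R]_2) -> \bar R}).
Variable nus : forall k, {measure set (borel 'M[R]_(k, 2)) -> \bar R}.
Variables (n : nat) (r : R).
Implicit Types u v : 'M[R]_(n, 2) -> R.

Definition LnormS (M : {measure set (borel 'M[R]_(n, 2)) -> \bar R})
    (p : \bar R) u : \bar R := 'N[M]_p[EFin \o (u \_ (gasket_pow n))]%E.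

(* The gradient of a section of u is defined only almost everywhere, and the
   versions chosen for different values of the other coordinates y need not
   fit together into a jointly measurable function.  The integral with
   respect to mu x nu_(n-1) is therefore written as an iterated integral,
   which does not depend on the versions. *)
Definition W_seminorm u : \bar R :=
  ((\sum_(i < n) \int[nus n.-1]_(y in gasket_pow n.-1) \int[mu]_(t in gasket)
      (`|grad mu (fun s => u (insert_coord i s y)) t| `^ r)%:E) `^ r^-1)%E.

Definition W_norm u : \bar R :=
  ((LnormS (nus n) r%:E u `^ r + W_seminorm u `^ r) `^ r^-1)%E.

Definition W_core : set ('M[R]_(n, 2) -> R) :=
  [set u | [/\ {within gasket_pow n, continuous u},
     forall (i : 'I_n) y, gasket_pow n.-1 y ->
       FS nu (fun s => u (insert_coord i s y)) &
     (W_norm u < +oo)%E]].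

(* An element of the completion of W_core is given by a Cauchy sequence; its
   continuous representative is the continuous function on S^n which is the
   limit of the sequence in L^r(nu_n). *)
Record sobolev := Sobolev {
  W_seq : nat -> 'M[R]_(n, 2) -> R ;
  W_seq_core : forall j, W_core (W_seq j) ;
  W_seq_cauchy : forall e : R, 0 < e -> exists N : nat,
    forall j k, (N <= j)%N -> (N <= k)%N ->
      (W_norm (W_seq j \- W_seq k)%R < e%:E)%E ;
  W_rep : 'M[R]_(n, 2) -> R ;
  W_rep_continuous : {within gasket_pow n, continuous W_rep} ;
  W_rep_limit :
    (fun j => LnormS (nus n) r%:E (W_seq j \- W_rep)) @ \oo --> 0%E }.

Definition sobolev_seminorm (u : sobolev) : \bar R :=
  limn (fun j => W_seminorm (W_seq u j)).

Definition sobolev_Lnorm (M : {measure set (borel 'M[R]_(n, 2)) -> \bar R})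
    (p : \bar R) (u : sobolev) : \bar R := LnormS M p (W_rep u).

End Sobolev.

(* Main.v *)
(* The inequality is tested on the product of n copies of the piecewise harmonic
   bump of a unit cell, which is 1 on the cell and supported in the at most 18
   cells touching it.  The gradient of a harmonic function on a cell is bounded
   mu-almost everywhere by its boundary values: its energy measure is dominated
   by the Kusuoka measure, and the Cauchy-Schwarz inequality for energy measures
   bounds the density defining the gradient.  Both norms on the right-hand side
   are therefore bounded independently of the cell, and sigma is uniformly
   bounded on the unit cells of S^n.  So the two estimates hold with upper
   dimension infinity and lower dimension 1: a simplex of diameter 2^m > 1 is a
   union of 3^(mn) unit cells overlapping in a nu_n-null set, and a smaller one
   lies in a unit cell.

   The discrete energies of the definitions also count the pairs of lattice
   points at distance 2^-m that face each other across a hole.  Along any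
   function of finite energy their contribution converges to a fixed multiple of
   the energy of the genuine edges, so they only change the energy by a factor. *)

(* Energy measures are not known to exist: [energy_measure] is 0 when no measure satisfies the
   defining identity. If $h_1$ has none, every gradient vanishes. If it has one, the symmetries of
   the triangle carry it to the other two basis functions, and a quadratic identity between
   increments makes the measure of any harmonic function a signed combination of these three.

   Inequalities between energy measures are proved on the discrete side. The defining functional is
   a limit of sums over edges of $(u(x)-u(y))^2$ weighted by the mean of the test function at the
   two ends. What holds on every edge therefore passes to the functionals, then through piecewise
   harmonic cutoffs and the regularity of Borel measures to the measures, and finally to their
   densities. The Cauchy-Schwarz inequality is not linear in the measures; it is replaced by a
   family of linear inequalities with a parameter t, taken rational so that countably many null sets
   suffice. *)
Require Import Defs.
From mathcomp Require Import all_boot all_order all_algebra.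
From mathcomp Require Import all_classical all_reals all_analysis.
From mathcomp Require Import measurable_realfun ess_sup_inf perm.
From mathcomp Require Import ring lra zify.
Import Order.TTheory GRing.Theory Num.Theory.
Import numFieldTopology.Exports numFieldNormedType.Exports.
Local Open Scope classical_set_scope.
Local Open Scope ring_scope.

Set Implicit Arguments.
Unset Strict Implicit.
Unset Printing Implicit Defensive.

(** * Barycentric coordinates *)

Lemma sum3 (V : nmodType) (F : 'I_3 -> V) :
  \sum_j F j = F ord0 + F (inord 1) + F (inord 2).
Proof.
rewrite !big_ord_recl big_ord0 addr0 addrA.
congr (_ + F _ + F _); apply/val_inj; rewrite /= inordK//.
Qed.

Section Barycentric.
Context {R : realType}.
Implicit Types (x y : 'rV[R]_2) (i j l : 'I_3) (m : nat).

Let s3 : R := Num.sqrt 3.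

Lemma sqrt3_gt0 : 0 < s3. Proof. by rewrite sqrtr_gt0. Qed.

Lemma sqrt3_sq : s3 * s3 = 3.
Proof. by rewrite -expr2 sqr_sqrtr. Qed.

Let s3_neq0 : s3 != 0. Proof. by rewrite gt_eqF// sqrt3_gt0. Qed.

(** In these affine coordinates the corners become the unit vectors and [Fmap j] averages with the
    j-th one. Lattice points of level m become integer vectors divided by 2^m, and the square root
    of 3 leaves the combinatorics. *)
Definition bc j x : R :=
  let b := 2 / s3 * x ord0 (lift ord0 ord0) in
  let a := x ord0 ord0 - b / 2 in
  nth 0 [:: 1 - a - b; a; b] j.

Lemma bc_corner i j : bc i (corner j) = (i == j)%:R.
Proof.
case: i => [[|[|[|?]]] ?] //; case: j => [[|[|[|?]]] ?] //;
  by rewrite /bc /= !mxE /= -?/s3; field.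
Qed.

Lemma bc_Fmap i j x : bc i (Fmap j x) = 2^-1 * (bc i x + (i == j)%:R).
Proof.
case: i => [[|[|[|?]]] ?] //; case: j => [[|[|[|?]]] ?] //;
  by rewrite /bc /= !mxE /= -?/s3; field.
Qed.

Lemma sum_bc x : \sum_j bc j x = 1.
Proof. by rewrite sum3 /bc /= !inordK//=; ring. Qed.

Lemma bc_aff j (a b : R) x y :
  a + b = 1 -> bc j (a *: x + b *: y) = a * bc j x + b * bc j y.
Proof.
move=> ab; have -> : b = 1 - a by lra.
by case: j => [[|[|[|?]]] ?] //; rewrite /bc /= !mxE /=; field.
Qed.

Lemma bc_ext x y : (forall j, bc j x = bc j y) -> x = y.
Proof.
move=> h; have := h (@Ordinal 3 1 isT); have := h (@Ordinal 3 2 isT).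
rewrite /bc /= => h2.
have n2 : 2 / s3 != 0.
  by apply: mulf_neq0; rewrite ?invr_neq0 ?pnatr_eq0.
have {h2} e2 : x ord0 (lift ord0 ord0) = y ord0 (lift ord0 ord0).
  exact: (mulfI n2).
rewrite e2 => /addIr e1.
apply/rowP => -[[|[|k]] kl] //.
  by rewrite (_ : Ordinal kl = ord0)//; apply/val_inj.
by rewrite (_ : Ordinal kl = lift ord0 ord0)//; apply/val_inj.
Qed.

Lemma bc_continuous j : continuous (bc j).
Proof.
have c0 := @coord_continuous R 1 2 ord0 ord0.
have c1 := @coord_continuous R 1 2 ord0 (lift ord0 ord0).
have cl (a b c : R) : continuous (fun x : 'rV[R]_2 =>
    a * x ord0 ord0 + b * x ord0 (lift ord0 ord0) + c).
  move=> x; apply: (@cvgD _ _ _ (nbhs x)); last exact: cvg_cst.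
  by apply: (@cvgD _ _ _ (nbhs x)); apply: (@cvgMl_tmp _ _ (nbhs x));
    [exact: c0|exact: c1].
move=> x; rewrite /bc; case: j => [[|[|[|?]]] ?] //=.
- rewrite (_ : (fun _ => _) = fun x : 'rV[R]_2 =>
      -1 * x ord0 ord0 + (2 / s3 / 2 - 2 / s3) * x ord0 (lift ord0 ord0) + 1).
    exact: cl.
  by apply/funext => y; field.
- rewrite (_ : (fun _ => _) = fun x : 'rV[R]_2 =>
      1 * x ord0 ord0 + (- (2 / s3 / 2)) * x ord0 (lift ord0 ord0) + 0).
    exact: cl.
  by apply/funext => y; field.
- rewrite (_ : (fun _ => _) = fun x : 'rV[R]_2 =>
      0 * x ord0 ord0 + 2 / s3 * x ord0 (lift ord0 ord0) + 0).
    exact: cl.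
  by apply/funext => y; field.
Qed.

(* For vectors d of total mass 0 the plane norm is |sum_j d_j p_j|^2
   = (sum_j d_j^2) / 2, the triangle being equilateral of side 1. *)
Lemma enorm_sqr x y :
  enorm (x - y) ^+ 2 = 2^-1 * \sum_j (bc j x - bc j y) ^+ 2.
Proof.
rewrite /enorm sqr_sqrtr; last by apply: sumr_ge0 => j _; exact: sqr_ge0.
rewrite sum3 /bc /= !inordK//= !big_ord_recl big_ord0 /= !mxE addr0.
set x0 := x _ _; set x1 := x _ _; set y0 := y _ _; set y1 := y _ _.
have -> : 2 / s3 * x1 = 2 / 3 * s3 * x1.
  by rewrite -[3]sqrt3_sq; field.
have -> : 2 / s3 * y1 = 2 / 3 * s3 * y1.
  by rewrite -[3]sqrt3_sq; field.
transitivity ((x0 - y0)^+2 + (s3 * s3) / 3 * (x1 - y1)^+2).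
  by rewrite sqrt3_sq; field.
by field.
Qed.

Lemma enorm_ge0 x : 0 <= enorm x. Proof. exact: sqrtr_ge0. Qed.

Definition Gmap j x : 'rV[R]_2 := 2 *: x - corner j.

Lemma FmapK j : cancel (@Fmap R j) (Gmap j).
Proof.
by move=> x; rewrite /Gmap /Fmap scalerA divff// scale1r addrK.
Qed.

Lemma GmapK j : cancel (Gmap j) (@Fmap R j).
Proof.
by move=> x; rewrite /Gmap /Fmap subrK scalerA mulVf// scale1r.
Qed.

Lemma Fmap_inj j : injective (@Fmap R j).
Proof. exact: can_inj (FmapK j). Qed.

Lemma Fmap_continuous j : continuous (@Fmap R j).
Proof.
move=> x; apply: (@cvgZl_tmp _ _ _ (nbhs x)).
by apply: (@cvgD _ _ _ (nbhs x)); [exact: cvg_id|exact: cvg_cst].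
Qed.

Lemma Gmap_continuous j : continuous (Gmap j).
Proof.
move=> x; apply: (@cvgB _ _ _ (nbhs x)); last exact: cvg_cst.
by apply: (@cvgZl_tmp _ _ _ (nbhs x)); exact: cvg_id.
Qed.

Lemma Fmap_corner j : Fmap j (corner j) = corner j :> 'rV[R]_2.
Proof.
have h : 2^-1 + 2^-1 = 1 :> R by field.
by rewrite /Fmap scalerDr -scalerDl h scale1r.
Qed.

(** This common point is the junction of the subcells i and j; the identity is what compatibility
    conditions for gluing refer to. *)
Lemma Fmap_cornerC i j : Fmap i (corner j) = Fmap j (corner i) :> 'rV[R]_2.
Proof. by rewrite /Fmap addrC. Qed.

End Barycentric.

(** * The unit cell: self-similarity and compactness *)

Section Gasket.
Context {R : realType}.
Implicit Types (x y : 'rV[R]_2) (i j l : 'I_3) (m : nat).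

Lemma preimage_closed (S T : topologicalType) (f : S -> T) (C : set T) :
  continuous f -> closed C -> closed (f @^-1` C).
Proof. by move=> /continuous_closedP; exact. Qed.

Lemma V0S m x : V0 m.+1 x <-> exists j y, V0 m y /\ x = Fmap j y.
Proof.
split=> [[j _ [y Vy <-]]|[j [y [Vy ->]]]]; first by exists j, y.
by exists j => //; exists y.
Qed.

Lemma V0_Fmap m j x : V0 m x -> V0 m.+1 (Fmap j x).
Proof. by move=> Vx; apply/V0S; exists j, x. Qed.

Lemma V0_corner m j : V0 m (corner j : 'rV[R]_2).
Proof.
elim: m => [|m ih]; first by exists j.
by rewrite -Fmap_corner; exact: V0_Fmap.
Qed.

Lemma V0_S0 m x : V0 m x -> S0 x.
Proof. by move=> Vx; apply: subset_closure; exists m. Qed.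

Lemma S0_corner j : S0 (corner j : 'rV[R]_2).
Proof. exact/V0_S0/(V0_corner 0). Qed.

Lemma closed_S0 : closed (@S0 R). Proof. exact: closed_closure. Qed.

Lemma S0_sub (C : set 'rV[R]_2) :
  closed C -> (forall m x, V0 m x -> C x) -> S0 `<=` C.
Proof.
move=> cC VC; rewrite /S0 closureE; apply: smallest_sub => //.
by move=> x [m _ Vx]; exact: VC Vx.
Qed.

Lemma S0_Fmap j x : S0 x -> S0 (Fmap j x).
Proof.
apply: (@S0_sub (Fmap j @^-1` S0)).
  by apply: preimage_closed closed_S0; exact: Fmap_continuous.
by move=> m y Vy; apply: (@V0_S0 m.+1); exact: V0_Fmap.
Qed.

Lemma closed_FmapS0 j : closed [set x : 'rV[R]_2 | S0 (Gmap j x)].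
Proof.
by apply: preimage_closed closed_S0; exact: Gmap_continuous.
Qed.

(** The three sets on the right are closed and together contain every lattice point, hence also the
    closure. *)
Lemma S0_cover x : S0 x -> exists j y, S0 y /\ x = Fmap j y.
Proof.
move=> Sx.
have [||j] := @S0_sub (\bigcup_(j in [set: 'I_3]) [set x : 'rV[R]_2 | S0 (Gmap j x)])
   _ _ x Sx.
- apply: closed_bigcup; first exact: finite_finset.
  by move=> j _; exact: closed_FmapS0.
- case=> [|m] y; first by move=> [j _ <-]; exists j; rewrite //= -{1}Fmap_corner FmapK;
    exact: S0_corner.
  by move=> /V0S[j [z [Vz ->]]]; exists j; rewrite //= FmapK; exact: V0_S0 Vz.
- by move=> _ Sj; exists j, (Gmap j x); rewrite GmapK.
Qed.

Definition triangle : set 'rV[R]_2 := [set x | forall j, 0 <= bc j x].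

Lemma triangle_Fmap j x : triangle x -> triangle (Fmap j x).
Proof.
move=> tx i; rewrite bc_Fmap mulr_ge0// addr_ge0//.
Qed.

Lemma S0_triangle : S0 `<=` triangle.
Proof.
apply: S0_sub.
  rewrite (_ : triangle = \bigcap_j (bc j @^-1` [set t | 0 <= t])); last first.
    by apply/seteqP; split=> [x tx j _|x tx j]; [exact: tx|exact: tx].
  apply: closed_bigI => j _.
  exact: (preimage_closed (@bc_continuous R j) (@closed_ge R 0)).
elim=> [|m ih] x; first by move=> [j _ <-] i; rewrite bc_corner.
by move=> /V0S[j [y [/ih ty ->]]]; exact: triangle_Fmap.
Qed.

Lemma bc_le1 j x : triangle x -> bc j x <= 1.
Proof.
move=> tx; rewrite -(sum_bc x) (bigD1 j)//= lerDl.
by apply: sumr_ge0 => i _; exact: tx.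
Qed.

Lemma bc2_le1 i j x : triangle x -> i != j -> bc i x + bc j x <= 1.
Proof.
move=> tx ij; rewrite -(sum_bc x) (bigD1 i)//= (bigD1 j) 1?eq_sym//= addrA lerDl.
by apply: sumr_ge0 => k _; exact: tx.
Qed.

Lemma bc_Fmap_ge j x : triangle x -> 2^-1 <= bc j (Fmap j x).
Proof. by move=> tx; rewrite bc_Fmap eqxx /=; have := tx j; lra. Qed.

(** The coordinates are nonnegative with sum 1, so two of them can reach 1/2 only if both equal 1/2
    and the third vanishes. Hence two subcells meet in a single point. *)
Lemma junctionP i j x : triangle x -> i != j -> 2^-1 <= bc i x ->
  2^-1 <= bc j x -> x = Fmap i (corner j).
Proof.
move=> tx ij hi hj; have hij := bc2_le1 tx ij.
have ei : bc i x = 2^-1 by lra.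
have ej : bc j x = 2^-1 by lra.
apply: bc_ext => l; rewrite bc_Fmap bc_corner.
have [->|li] := eqVneq l i; first by rewrite (negbTE ij) /=; lra.
have [->|lj] := eqVneq l j; first by rewrite /=; lra.
have := sum_bc x; rewrite (bigD1 i)//= (bigD1 j) 1?eq_sym//= (bigD1 l) ?li//=.
have : 0 <= \sum_(k < 3 | [&& k != i, k != j & k != l]) bc k x.
  by apply: sumr_ge0 => k _; exact: tx.
have := tx l.
under eq_bigl do rewrite -andbA.
by lra.
Qed.

(** Membership in the subcell j is read off one coordinate: if x comes from another subcell, it can
    only be the junction with j. *)
Lemma S0_Gmap j x : S0 x -> 2^-1 <= bc j x -> S0 (Gmap j x).
Proof.
move=> /S0_cover [i [y [Sy ->]]]; have ty := S0_triangle Sy.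
have [<-|ij] := eqVneq i j; first by rewrite FmapK.
move=> h; have -> : Fmap i y = Fmap j (corner i).
  by rewrite Fmap_cornerC; apply: junctionP => //;
    [exact: triangle_Fmap|exact: bc_Fmap_ge].
by rewrite FmapK; exact: S0_corner.
Qed.

Lemma compact_S0 : compact (@S0 R).
Proof.
apply: (subclosed_compact closed_S0
  (@rV_compact R 2 (fun=> [set` `[0 : R, 1]]) (fun=> @segment_compact R 0 1))).
move=> x /S0_triangle tx i /=; rewrite in_itv /=.
pose s3 : R := Num.sqrt 3.
have s30 : 0 < s3 by exact: sqrt3_gt0.
have s3s : s3 * s3 = 3 by exact: sqrt3_sq.
have := tx (@Ordinal 3 0 isT); have := tx (@Ordinal 3 1 isT).
have := tx (@Ordinal 3 2 isT); rewrite /bc /= -/s3.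
have -> : x ord0 i = x ord0 i by [].
set x0 := x ord0 ord0; set x1 := x ord0 (lift ord0 ord0).
have -> : 2 / s3 * x1 = 2 / 3 * (s3 * x1).
  by rewrite -[3]s3s; field; rewrite gt_eqF.
move=> h2 h1 h0.
have h3 : 0 <= s3 * x1 by lra.
have x10 : 0 <= x1 by rewrite pmulr_rge0 in h3.
case: i => [[|[|k]] kl] //.
  rewrite (_ : Ordinal kl = ord0) -/x0; last exact/val_inj.
  by apply/andP; split; lra.
rewrite (_ : Ordinal kl = lift ord0 ord0) -/x1; last exact/val_inj.
by apply/andP; split; nra.
Qed.

End Gasket.

(** * Lattice edges and holes *)

Section Lattice.
Context {R : realType}.
Implicit Types (x y : 'rV[R]_2) (i j l : 'I_3) (m : nat) (e : 'rV[R]_2 * 'rV[R]_2).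

Lemma ord3_cases i j l k : i != j -> j != l -> i != l -> [|| k == i, k == j | k == l].
Proof. by move: i j l k; do 4!(case=> [[|[|[|//]]] ?]). Qed.

Lemma sum3_distinct (V : nmodType) (F : 'I_3 -> V) i j l :
  i != j -> j != l -> i != l -> \sum_k F k = F i + F j + F l.
Proof.
move=> ij jl il; rewrite (bigD1 i)//= (bigD1 j)/=; last by rewrite eq_sym ij.
rewrite (bigD1 l)/=; last by rewrite eq_sym il eq_sym jl.
rewrite big1 ?addr0 ?addrA// => k; rewrite -!andbA => /and3P[ki kj kl].
by have := ord3_cases k ij jl il; rewrite (negbTE ki) (negbTE kj) (negbTE kl).
Qed.

Lemma ord3_third i j : i != j -> exists l, (j != l) && (i != l).
Proof.
move=> ij; suff /existsP[l hl] : [exists l, (j != l) && (i != l)] by exists l.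
apply/existsP; move: ij; case: i => [[|[|[|//]]] ?]; case: j => [[|[|[|//]]] ?] // _.
all: solve [exists ord0; done | exists (@Ordinal 3 1 isT); done
  | exists (@Ordinal 3 2 isT); done].
Qed.

Definition Fiter j m : 'rV[R]_2 -> 'rV[R]_2 := iter m (Fmap j).

Lemma bc_Fiter i j m x :
  bc i (Fiter j m x) = 2 ^- m * bc i x + (1 - 2 ^- m) * (i == j)%:R.
Proof.
elim: m => [|m ih]; first by rewrite expr0 invr1 mul1r subrr mul0r addr0.
rewrite /= bc_Fmap ih exprS invfM; set u := 2 ^- m; by field.
Qed.

Lemma V0_Fiter j m n x : V0 n x -> V0 (m + n) (Fiter j m x).
Proof.
by move=> Vx; elim: m => [//|m ih]; rewrite addSn; exact: V0_Fmap.
Qed.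

Lemma V0_lattice m x : V0 m x -> exists N : 'I_3 -> nat,
  forall k, bc k x = (N k)%:R / 2 ^+ m.
Proof.
elim: m x => [x [j _ <-]|m ih x /V0S[j [y [/ih[N hN] ->]]]].
  by exists (fun k => (k == j) : nat) => k; rewrite bc_corner expr0 divr1.
exists (fun k => N k + (k == j) * 2 ^ m)%N => k.
rewrite bc_Fmap hN natrD natrM natrX exprS invfM.
by field; rewrite expf_neq0.
Qed.

Definition FF j e := (Fmap j e.1, Fmap j e.2).

Definition edge m : set ('rV[R]_2 * 'rV[R]_2) :=
  [set e | [/\ V0 m e.1, V0 m e.2 & enorm (e.1 - e.2) = 2 ^- m]].

(** After scaling by 2^m the coordinates of lattice points are integers, so the classification of
    edges becomes a question about integer vectors with squared differences adding up to 2. *)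
Lemma edge_normP x y m : enorm (x - y) = 2 ^- m <->
  \sum_j ((bc j x - bc j y) * 2 ^+ m) ^+ 2 = 2.
Proof.
have p0 : (2 : R) ^+ m != 0 by rewrite expf_neq0.
have -> : \sum_j ((bc j x - bc j y) * 2 ^+ m) ^+ 2 =
    2 * (2 ^+ m * enorm (x - y)) ^+ 2.
  rewrite exprMn enorm_sqr !mulr_sumr; apply: eq_bigr => j _.
  by rewrite exprMn; field.
split=> [->|]; first by rewrite divff// expr1n mulr1.
move=> h; have {}h : (2 ^+ m * enorm (x - y)) ^+ 2 = 1 by lra.
have : 2 ^+ m * enorm (x - y) = 1.
  apply/eqP; rewrite -(@eqrXn2 _ 2)// ?expr1n ?h//.
  by rewrite mulr_ge0 ?enorm_ge0 ?exprn_ge0.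
by move=> {}h; apply: (mulfI p0); rewrite h divff.
Qed.

Lemma enorm_Fmap j x y : enorm (Fmap j x - Fmap j y) = 2^-1 * enorm (x - y).
Proof.
apply/eqP; rewrite -(@eqrXn2 _ 2)// ?mulr_ge0 ?enorm_ge0//.
rewrite exprMn !enorm_sqr [X in _ == X]mulrCA [X in _ == _ * X]mulr_sumr.
apply/eqP; congr (_ * _); apply: eq_bigr => k _; rewrite !bc_Fmap.
by field.
Qed.

Lemma edge_FF m j e : edge m e -> edge m.+1 (FF j e).
Proof.
move=> [V1 V2 h]; split; [exact: V0_Fmap|exact: V0_Fmap|].
by rewrite enorm_Fmap h exprS invfM.
Qed.

(* The two lattice points adjacent to the vertex F_i p_j = F_j p_i across the
   central hole of the gasket. *)
Definition hole_pair m (t : 'I_3 * 'I_3 * 'I_3) : 'rV[R]_2 * 'rV[R]_2 :=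
  let: (i, j, l) := t in
  (Fmap i (Fiter j m (corner l)), Fmap j (Fiter i m (corner l))).

Definition distinct3 (t : 'I_3 * 'I_3 * 'I_3) :=
  let: (i, j, l) := t in [&& i != j, j != l & i != l].

Lemma edge_hole_pair m t : distinct3 t -> edge m.+1 (hole_pair m t).
Proof.
case: t => -[i j] l /and3P[ij jl il].
have V k k' : V0 m.+1 (Fmap k (Fiter k' m (corner l : 'rV[R]_2))).
  by apply: V0_Fmap; rewrite -[X in V0 X]addn0; apply: V0_Fiter; exact: V0_corner.
split; [exact: V|exact: V|]; apply/edge_normP => /=.
rewrite (sum3_distinct _ ij jl il) !bc_Fmap !bc_Fiter !bc_corner.
rewrite !eqxx [j == i]eq_sym [l == i]eq_sym [l == j]eq_sym.
rewrite (negbTE ij) (negbTE jl) (negbTE il) /=.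
rewrite [2 ^+ m.+1]exprS; set u := 2 ^+ m; field; rewrite /u expf_neq0//.
Qed.

Lemma edge0P e : edge 0 e <-> exists i j, i != j /\ e = (corner i, corner j).
Proof.
split=> [[[i _ h1] [j _ h2] h]|[i [j [ij ->]]]].
  exists i, j; split; last by rewrite h1 h2; case: e {h h1 h2}.
  apply/eqP => ij; move: h; rewrite -h1 -h2 ij subrr /enorm big1 ?sqrtr0.
    by rewrite expr0 invr1 => /eqP; rewrite eq_sym oner_eq0.
  by move=> k _; rewrite mxE expr0n.
have [l /andP[jl il]] := ord3_third ij.
split; [by exists i|by exists j|]; apply/edge_normP => /=.
rewrite (sum3_distinct _ ij jl il) !bc_corner.
rewrite !eqxx [j == i]eq_sym [l == i]eq_sym [l == j]eq_sym.
by rewrite (negbTE ij) (negbTE jl) (negbTE il) /=; ring.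
Qed.

Lemma int_sqr_sum2 (a b c : int) : a ^+ 2 + b ^+ 2 + c ^+ 2 = 2 -> -1 <= a <= 1.
Proof.
move=> h; have := sqr_ge0 b; have := sqr_ge0 c.
rewrite !expr2 in h *; nia.
Qed.

(** Here K stands for 2^m, half of the total mass at level m.+1: the first point lies in the subcell
    i and the second in the subcell j. Either one of them is the junction of the two subcells, or
    each is one step away from it and they face each other across the central hole. *)
Lemma hole_lattice (K a b c a' b' c' : nat) : (0 < K)%N ->
  (a + b + c = 2 * K)%N -> (a' + b' + c' = 2 * K)%N ->
  (K <= a)%N -> (K <= b')%N ->
  (a%:Z - a'%:Z) ^+ 2 + (b%:Z - b'%:Z) ^+ 2 + (c%:Z - c'%:Z) ^+ 2 = 2 ->
  [\/ (a' = K /\ b' = K)%N, (a = K /\ b = K)%N |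
      [/\ a = K, b = K.-1, c = 1%N & [/\ a' = K.-1, b' = K & c' = 1%N]]].
Proof.
move=> K0 h h' ha hb hs.
have h1 := int_sqr_sum2 hs.
have h2 : -1 <= b%:Z - b'%:Z <= 1.
  by apply: (@int_sqr_sum2 _ (a%:Z - a'%:Z) (c%:Z - c'%:Z)); rewrite -hs; ring.
have d : c%:Z - c'%:Z = - (a%:Z - a'%:Z) - (b%:Z - b'%:Z) by lia.
have d0 : (a%:Z - a'%:Z != 0) || (b%:Z - b'%:Z != 0).
  rewrite -negb_and; apply/negP => /andP[/eqP e1 /eqP e2].
  by move: hs; rewrite d e1 e2.
move=> {hs}; have [e1|e1] := eqVneq a' K.
  by apply: Or31; lia.
have [e2|e2] := eqVneq b K; first by apply: Or32; lia.
by apply: Or33; split; [| | |split]; lia.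
Qed.

(** The recursion behind all edge sums: a new edge lies in a subcell or crosses the central hole. *)
Lemma edgeSP m e : edge m.+1 e -> (exists j e', edge m e' /\ e = FF j e') \/
  ((0 < m)%N /\ exists2 t, distinct3 t & e = hole_pair m t).
Proof.
case: e => x y [Vx0 Vy0 h].
have Vx : V0 m.+1 x := Vx0; have Vy : V0 m.+1 y := Vy0.
move: {Vx0 Vy0} h; rewrite [(x, y).1]/= [(x, y).2]/= => h.
have /V0S[i [x' [Vx' ex]]] := Vx; have /V0S[j [y' [Vy' ey]]] := Vy.
have same k x'' y'' : V0 m x'' -> V0 m y'' -> x = Fmap k x'' -> y = Fmap k y'' ->
    exists j e', edge m e' /\ (x, y) = FF j e'.
  move=> V1 V2 e1 e2; exists k, (x'', y''); split; last by rewrite /FF e1 e2.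
  split=> //=; move: h; rewrite e1 e2 enorm_Fmap exprS invfM.
  by apply: mulfI; rewrite invr_neq0.
have [eij|ij] := eqVneq i j.
  by left; apply: (same i x' y') => //; rewrite eij.
have [l /andP[jl il]] := ord3_third ij.
have [N hN] := V0_lattice Vx; have [M hM] := V0_lattice Vy.
have tx := S0_triangle (V0_S0 Vx); have ty := S0_triangle (V0_S0 Vy).
pose K := (2 ^ m)%N.
have K0 : (0 < K)%N by rewrite expn_gt0.
have p0 : (2 : R) ^+ m.+1 != 0 by rewrite expf_neq0.
have Kr : K%:R = 2^-1 * 2 ^+ m.+1 :> R by rewrite natrX exprS; field.
have sumN (z : 'rV[R]_2) (Q : 'I_3 -> nat) :
    (forall k, bc k z = (Q k)%:R / 2 ^+ m.+1) -> (Q i + Q j + Q l = 2 * K)%N.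
  move=> hQ; have := sum_bc z; rewrite (sum3_distinct _ ij jl il) !hQ -!mulrDl.
  move=> /(congr1 ( *%R^~ (2 ^+ m.+1))); rewrite mulfVK// mul1r -!natrD.
  by rewrite -natrX => /eqP; rewrite eqr_nat => /eqP ->; rewrite /K expnS.
have geK k (z : 'rV[R]_2) (Q : 'I_3 -> nat) :
    (forall k, bc k z = (Q k)%:R / 2 ^+ m.+1) -> 2^-1 <= bc k z -> (K <= Q k)%N.
  move=> hQ; rewrite hQ ler_pdivlMr ?exprn_gt0// -Kr.
  by rewrite ler_nat.
have hx : (K <= N i)%N.
  apply: (geK i x N hN).
  by rewrite ex; apply/bc_Fmap_ge/S0_triangle; exact: V0_S0 Vx'.
have hy : (K <= M j)%N.
  apply: (geK j y M hM).
  by rewrite ey; apply/bc_Fmap_ge/S0_triangle; exact: V0_S0 Vy'.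
have hs : (((N i)%:Z - (M i)%:Z) ^+ 2 + ((N j)%:Z - (M j)%:Z) ^+ 2 +
    ((N l)%:Z - (M l)%:Z) ^+ 2 = 2)%R.
  move/edge_normP: h; rewrite (sum3_distinct _ ij jl il) !hN !hM -!mulrBl !mulfVK//.
  by move=> h; apply/eqP; rewrite -(eqr_int R) !rmorphD /= !rmorphXn /= !rmorphB /= h.
have half (z : 'rV[R]_2) (Q : 'I_3 -> nat) k :
    (forall k, bc k z = (Q k)%:R / 2 ^+ m.+1) -> Q k = K -> bc k z = 2^-1.
  by move=> hQ e; rewrite hQ e Kr mulfK.
have [[e1 e2]|[e1 e2]|[e1 e2 e3 [e4 e5 e6]]] :=
  hole_lattice K0 (sumN x N hN) (sumN y M hM) hx hy hs.
- left; apply: (same i x' (corner j)) => //; first exact: V0_corner.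
  by apply: junctionP => //; rewrite (half y M) ?hM.
- left; apply: (same j (corner i) y') => //; first exact: V0_corner.
  rewrite Fmap_cornerC; by apply: junctionP => //; rewrite (half x N) ?hN.
(* For m = 0 the two points are midpoints of sides, F_l p_i and F_l p_j, and their edge belongs to
   the third subcell l. *)
case: (posnP m) => m0.
  left; have K1 : K = 1%N by rewrite /K m0.
  have jun (z : 'rV[R]_2) (Q : 'I_3 -> nat) k : (forall k, bc k z = (Q k)%:R / 2 ^+ m.+1) ->
    triangle z -> l != k -> Q k = K -> Q l = 1%N -> z = Fmap l (corner k).
    move=> hQ tz lk q1 q2; apply: junctionP => //.
      by rewrite (half z Q l hQ) ?K1.
    by rewrite (half z Q k hQ).
  apply: (same l (corner i) (corner j)); try exact: V0_corner.
    by apply: (jun x N) => //; rewrite eq_sym.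
  by apply: (jun y M) => //; rewrite eq_sym.
right; split=> //; exists (i, j, l); first by rewrite /= ij jl il.
have Km : K.-1%:R = (2^-1 - 2 ^- m.+1) * 2 ^+ m.+1 :> R.
  by rewrite mulrBl mulVf// -Kr -subn1 natrB.
have aux k k' (z : 'rV[R]_2) (Q : 'I_3 -> nat) :
   (forall k, bc k z = (Q k)%:R / 2 ^+ m.+1) -> k != k' -> k' != l -> k != l ->
   Q k = K -> Q k' = K.-1 -> Q l = 1%N ->
   z = Fmap k (Fiter k' m (corner l)).
  move=> hQ kk' k'l kl q1 q2 q3; apply: bc_ext => n.
  have := ord3_cases n kk' k'l kl.
  rewrite hQ bc_Fmap bc_Fiter bc_corner => /or3P[] /eqP ->.
  - by rewrite q1 Kr mulfK// eqxx (negbTE kk') (negbTE kl) /=; lra.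
  - rewrite q2 Km mulfK// [k' == k]eq_sym (negbTE kk') (negbTE k'l) eqxx /=.
    rewrite exprS invfM; set u := 2 ^- m; by field.
  - rewrite q3 [l == k]eq_sym (negbTE kl) [l == k']eq_sym (negbTE k'l) eqxx /=.
    rewrite exprS invfM; set u := 2 ^- m; by field.
congr (_, _); first exact: (aux i j x N).
by apply: (aux j i y M) => //; rewrite eq_sym.
Qed.

End Lattice.

(** * Discrete energies as sums over lists of edges *)

Section EdgeSums.
Context {R : realType}.
Local Notation P := ('rV[R]_2).
Implicit Types (x y : P) (i j l : 'I_3) (m : nat) (e : P * P) (g : P -> P -> R).

Definition edges0 : seq (P * P) :=
  [seq (corner t.1, corner t.2) | t : 'I_3 * 'I_3 <- [seq t <- enum {: 'I_3 * 'I_3} | t.1 != t.2]].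

(** At m = 0 the facing pairs are edges of the third subcell and would be listed twice, hence the
    empty list. *)
Definition hole_edges m : seq (P * P) :=
  if (0 < m)%N then [seq hole_pair m t | t <- [seq t <- enum {: 'I_3 * 'I_3 * 'I_3} | distinct3 t]]
  else [::].

(* With [b] the pairs contained in a common cell are listed, with [c] those
   facing each other across a hole. *)
Fixpoint etree (b c : bool) m : seq (P * P) :=
  if m is m'.+1 then
    [seq FF j e | j <- enum 'I_3, e <- etree b c m'] ++ (if c then hole_edges m' else [::])
  else if b then edges0 else [::].

(** The summand is an arbitrary function of the two ends, so that the same sums serve for energies
    and for energies weighted by a test function. The edges are ordered pairs, as in [energy_m]. *)
Definition wsum b c m g : R :=
  4^-1 * (5 / 3) ^+ m * \sum_(e <- etree b c m) g e.1 e.2.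

Definition pullback (f : P -> P) g : P -> P -> R := fun x y => g (f x) (f y).

Definition holesum m g : R :=
  if (0 < m)%N then 4^-1 * (5 / 3) ^+ m.+1 *
    \sum_(t | distinct3 t) g (hole_pair m t).1 (hole_pair m t).2
  else 0.

Lemma wsumS b c m g : wsum b c m.+1 g =
  5 / 3 * (\sum_j wsum b c m (pullback (Fmap j) g)) + (if c then holesum m g else 0).
Proof.
rewrite /wsum /= big_cat /= mulrDr big_allpairs_dep /=; congr (_ + _).
  rewrite big_enum /= mulr_sumr [RHS]mulr_sumr; apply: eq_bigr => j _.
  rewrite /pullback; set S := \sum_(_ <- _) _.
  by rewrite exprS; ring.
rewrite /holesum /hole_edges; case: c; last by rewrite big_nil mulr0.
case: ifP => _; last by rewrite big_nil mulr0.
by rewrite big_map big_filter big_enum_cond.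
Qed.

Lemma wsum0 c g : wsum true c 0 g =
  4^-1 * \sum_i \sum_(j | i != j) g (corner i) (corner j).
Proof.
rewrite /wsum /= expr0 mulr1 big_map big_filter big_enum_cond /=.
by rewrite pair_big_dep.
Qed.

Lemma wsum00 c g : wsum false c 0 g = 0.
Proof. by rewrite /wsum /= big_nil mulr0. Qed.

Lemma wsum_split m g : wsum true true m g = wsum true false m g + wsum false true m g.
Proof.
elim: m g => [|m ih] g; first by rewrite wsum00 addr0.
rewrite !wsumS addr0 addrA -mulrDr -big_split /=.
by congr (_ * _ + _); apply: eq_bigr => j _; exact: ih.
Qed.

Lemma mem_edges0 e : e \in edges0 <-> edge 0 e.
Proof.
split=> [/mapP[[i j]]|/edge0P[i [j [ij ->]]]].
  by rewrite mem_filter /= => /andP[ij _] ->; apply/edge0P; exists i, j.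
by apply/mapP; exists (i, j) => //; rewrite mem_filter /= ij mem_enum.
Qed.

Lemma mem_hole_edges m e : e \in hole_edges m <->
  ((0 < m)%N /\ exists2 t, distinct3 t & e = hole_pair m t).
Proof.
rewrite /hole_edges; case: ifP => _; last by split=> [//|[]].
split=> [/mapP[t]|[_ [t dt ->]]].
  by rewrite mem_filter => /andP[dt _] ->; split=> //; exists t.
by apply/mapP; exists t => //; rewrite mem_filter dt mem_enum.
Qed.

Lemma mem_etree m e : e \in etree true true m <-> edge m e.
Proof.
elim: m e => [|m ih] e; first exact: mem_edges0.
rewrite /= mem_cat; split.
  move=> /orP[/allpairsP[[j e'] /= [_ /ih he' ->]]|/mem_hole_edges[_ [t dt ->]]].
    exact: edge_FF.
  exact: edge_hole_pair.
move=> /edgeSP[[j [e' [he' ->]]]|h]; apply/orP.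
  by left; apply/allpairsP; exists (j, e'); split=> //=; [rewrite mem_enum|exact/ih].
by right; apply/mem_hole_edges.
Qed.

Lemma edge_neq m e : edge m e -> e.1 <> e.2.
Proof.
move=> [_ _ h] e12; move: h; rewrite e12 subrr /enorm big1 ?sqrtr0.
  by move/eqP; rewrite eq_sym invr_eq0 expf_eq0 pnatr_eq0 andbF.
by move=> k _; rewrite mxE expr0n.
Qed.

Lemma FF_inj m j j' e e' : edge m e -> edge m e' -> FF j e = FF j' e' ->
  j = j' /\ e = e'.
Proof.
move=> he he' [h1 h2].
have [jj|jj] := eqVneq j j'.
  split=> //; move: h1 h2; rewrite -jj => /Fmap_inj h1 /Fmap_inj h2.
  by case: e e' h1 h2 {he he'} => [? ?] [? ?] /= -> ->.
exfalso; case: (he) => V1 V2 _; case: (he') => V1' V2' _.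
have T x : V0 m x -> triangle x by move/V0_S0/S0_triangle.
have J x x' : V0 m x -> V0 m x' -> Fmap j x = Fmap j' x' -> x = corner j'.
  move=> Vx Vx' hx; apply: (@Fmap_inj R j); apply: junctionP => //.
  - exact/triangle_Fmap/T.
  - exact/bc_Fmap_ge/T.
  - by rewrite hx; exact/bc_Fmap_ge/T.
by apply: (edge_neq he); rewrite (J _ _ V1 V1' h1) (J _ _ V2 V2' h2).
Qed.

Lemma bc_hole_pair m (i j l : 'I_3) : i != j -> j != l -> i != l ->
  [/\ bc i (Fmap i (Fiter j m (corner l))) = 2^-1 :> R,
   bc j (Fmap i (Fiter j m (corner l))) = 2^-1 * (1 - 2 ^- m) :> R &
   bc l (Fmap i (Fiter j m (corner l))) = 2^-1 * 2 ^- m :> R].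
Proof.
move=> ij jl il; rewrite !bc_Fmap !bc_Fiter !bc_corner !eqxx.
rewrite [j == i]eq_sym [l == i]eq_sym [l == j]eq_sym.
rewrite (negbTE ij) (negbTE jl) (negbTE il) /=.
by split; ring.
Qed.

Lemma hole_pair_bc_lt m t k : (0 < m)%N -> distinct3 t ->
  (2^-1 <= bc k (hole_pair m t).1 :> R -> k = t.1.1) /\
  (2^-1 <= bc k (hole_pair m t).2 :> R -> k = t.1.2).
Proof.
move=> m0; case: t => -[i j] l /and3P[ij jl il] /=.
have u0 : (2 : R) ^- m < 1.
  by rewrite invf_lt1 ?exprn_gt0// exprn_egt1 ?ltr1n// -lt0n.
have u1 : (0 : R) < 2 ^- m by rewrite invr_gt0 exprn_gt0.
have [a1 a2 a3] := bc_hole_pair m ij jl il.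
have ji : j != i by rewrite eq_sym.
have [b1 b2 b3] := bc_hole_pair m ji il jl.
have u2 : (2 : R) ^- m <= 2^-1.
  by case: m m0 {a1 a2 a3 b1 b2 b3 u0 u1} => // m _; rewrite exprS invfM ler_piMr//
    invf_le1 ?exprn_gt0// exprn_ege1// ler1n.
split=> h; have := ord3_cases k ij jl il => /or3P[] /eqP e //; exfalso;
  move: h; rewrite e ?a2 ?a3 ?b2 ?b3 ; lra.
Qed.

(** Needed to turn the finitely supported sum of [energy_m] into a sum over the list. An edge lying
    in two subcells would have both ends at their junction, and for m > 0 each end of a hole pair
    lies in one subcell only, a different one for each end. *)
Lemma uniq_etree m : uniq (etree true true m).
Proof.
elim: m => [|m ih].
  rewrite /= map_inj_in_uniq; first by rewrite filter_uniq// enum_uniq.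
  move=> [i j] [i' j'] _ _ [h1 h2].
  have inj k k' : corner k = corner k' :> P -> k = k'.
    move=> h; apply/eqP; rewrite -[_ == _]negbK; apply/negP => kk.
    by have := @bc_corner R k k'; rewrite -h bc_corner eqxx (negbTE kk) => /eqP;
      rewrite oner_eq0.
  by rewrite (inj _ _ h1) (inj _ _ h2).
rewrite /= cat_uniq; apply/and3P; split.
- apply: allpairs_uniq => //; first exact: enum_uniq.
  move=> [j e] [j' e'] /allpairsP[[a b] /= [_ hb [_ ->]]].
  move=> /allpairsP[[a' b'] /= [_ hb' [_ ->]]] h.
  by have [-> ->] := FF_inj (proj1 (mem_etree _ _) hb) (proj1 (mem_etree _ _) hb') h.
- apply/hasPn => e /mem_hole_edges[m0 [t dt ->]]; apply/negP => /allpairsP[[j e'] /=].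
  move=> [_ /mem_etree[V1 V2 _] h].
  have [h1 h2] := hole_pair_bc_lt j m0 dt.
  have T x : V0 m x -> triangle x by move/V0_S0/S0_triangle.
  have e1 : j = t.1.1 by apply: h1; rewrite h; exact/bc_Fmap_ge/T.
  have e2 : j = t.1.2 by apply: h2; rewrite h; exact/bc_Fmap_ge/T.
  move: dt; case: t {h h1 h2} e1 e2 => -[a b] c /= e1 e2 /and3P[+ _ _].
  by rewrite -e1 -e2 eqxx.
- rewrite /hole_edges; case: ifP => // m0.
  rewrite map_inj_in_uniq; first by rewrite filter_uniq// enum_uniq.
  move=> t t'; rewrite !mem_filter => /andP[dt _] /andP[dt' _] h.
  have T k k' l : triangle (Fmap k (Fiter k' m (corner l : P))).
    apply: triangle_Fmap; apply: S0_triangle; apply: (@V0_S0 _ m).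
    by rewrite -[X in V0 X]addn0; apply: V0_Fiter; exact: V0_corner.
  have F k k' l : 2^-1 <= bc k (Fmap k (Fiter k' m (corner l : P))).
    apply: bc_Fmap_ge; apply: S0_triangle; apply: (@V0_S0 _ m).
    by rewrite -[X in V0 X]addn0; apply: V0_Fiter; exact: V0_corner.
  have [h1 _] := hole_pair_bc_lt t'.1.1 m0 dt.
  have [_ h2] := hole_pair_bc_lt t'.1.2 m0 dt.
  case: t t' h1 h2 dt dt' h => -[i j] l [[i' j'] l'] /= h1 h2 dt dt' [e1 e2].
  have ei : i' = i by apply: h1; rewrite e1; exact: F.
  have ej : j' = j by apply: h2; rewrite e2; exact: F.
  move: dt dt'; rewrite ei ej => /and3P[ij jl il] /and3P[_ jl' il'].
  by have := ord3_cases l' ij jl il; rewrite [l' == i]eq_sym [l' == j]eq_sym (negbTE jl')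
   (negbTE il') /= => /eqP ->.
Qed.

Definition sqd (u : P -> R) : P -> P -> R := fun x y => (u x - u y) ^+ 2.

Lemma energy_mE m u : energy_m m u = wsum true true m (sqd u).
Proof.
rewrite /energy_m /wsum -mulr_fsumr; congr (_ * _).
rewrite [RHS]fsbig_seq; last exact: uniq_etree.
apply: eq_fsbigl.
by apply/seteqP; split=> e; [move=> h; apply/mem_etree; exact: h|move=> /mem_etree].
Qed.

Lemma etree_V0 b c m e : e \in etree b c m -> V0 m e.1 /\ V0 m e.2.
Proof.
elim: m e => [|m ih] e /=; first by case: b => // /mem_edges0[].
rewrite mem_cat => /orP[/allpairsP[[j e'] /= [_ /ih[h1 h2] ->]]|].
  by split; exact: V0_Fmap.
case: c {ih} => //= h.
have [_ [t dt ->]] := proj1 (mem_hole_edges m e) h.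
case: (@edge_hole_pair R m t dt) => V1 V2 _; split; [exact: V1|exact: V2].
Qed.

Lemma ler_wsum b c m g g' : (forall x y, V0 m x -> V0 m y -> g x y <= g' x y) ->
  wsum b c m g <= wsum b c m g'.
Proof.
move=> h; rewrite /wsum ler_wpM2l ?mulr_ge0 ?exprn_ge0 ?divr_ge0//.
rewrite big_seq [leRHS]big_seq; apply: ler_sum => e /etree_V0[V1 V2].
exact: h.
Qed.

Lemma eq_wsum b c m g g' : (forall x y, V0 m x -> V0 m y -> g x y = g' x y) ->
  wsum b c m g = wsum b c m g'.
Proof.
by move=> h; apply/eqP; rewrite eq_le !ler_wsum// => x y Vx Vy; rewrite h.
Qed.

Lemma wsumD b c m g g' :
  wsum b c m (fun x y => g x y + g' x y) = wsum b c m g + wsum b c m g'.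
Proof. by rewrite /wsum big_split mulrDr. Qed.

Lemma wsumZ b c m (k : R) g : wsum b c m (fun x y => k * g x y) = k * wsum b c m g.
Proof. by rewrite /wsum -mulr_sumr mulrCA. Qed.

Lemma wsum_ge0 b c m g : (forall x y, V0 m x -> V0 m y -> 0 <= g x y) -> 0 <= wsum b c m g.
Proof.
move=> h; have -> : 0 = wsum b c m (fun x y => 0 * g x y) by rewrite wsumZ mul0r.
by apply: ler_wsum => x y Vx Vy; rewrite mul0r h.
Qed.

End EdgeSums.

(** * Harmonic functions *)

Lemma within_continuousP (R : realType) (V : normedModType R) (A : set V) (f : V -> R) :
  {within A, continuous f} <->
  forall x, A x -> forall e, 0 < e -> exists2 d, 0 < d &
    forall y, A y -> `|x - y| < d -> `|f x - f y| < e.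
Proof.
split=> [/subspace_continuousP cf x Ax e e0|h].
  have /cvgrPdist_lt/(_ e e0) := cf x Ax.
  rewrite /within /= => /nbhs_ballP[d /= d0 hd]; exists d => // y Ay xy.
  by apply: hd => //; rewrite -ball_normE.
apply/subspace_continuousP => x Ax; apply/cvgrPdist_lt => e e0.
have [d d0 hd] := h x Ax e e0.
rewrite /within /=; apply/nbhs_ballP; exists d => //= y; rewrite -ball_normE /= => xy Ay.
exact: hd.
Qed.

Section Harmonic.
Context {R : realType}.
Local Notation P := ('rV[R]_2).
Implicit Types (x y : P) (i j l : 'I_3) (m : nat) (b c : 'I_3 -> R).

(** The harmonic extension rule of the gasket: the midpoint between p_j and p_k gets (2 b_j + 2 b_k
    + b_l) / 5, and the result lists the values at the corners of the subcell j. *)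
Definition extension_mx j b : 'I_3 -> R :=
  fun k => if k == j then b j else (b j + b k + \sum_l b l) / 5.

Lemma extension_mxC b i j : extension_mx i b j = extension_mx j b i.
Proof. by rewrite /extension_mx eq_sym; case: eqVneq => [->|]//; rewrite [b i + _]addrC. Qed.

Lemma extension_mxD j b c (s t : R) : extension_mx j (fun k => s * b k + t * c k) =
  fun k => s * extension_mx j b k + t * extension_mx j c k.
Proof.
apply/funext => k; rewrite /extension_mx big_split /= -!mulr_sumr.
by case: ifP => _ //; field.
Qed.

Lemma extension_mx_range j b (lo hi : R) : (forall k, lo <= b k <= hi) ->
  forall k, lo <= extension_mx j b k <= hi.
Proof.
move=> h k; rewrite /extension_mx; case: ifP => _ //; rewrite sum3.
have := h j; have := h k; have := h ord0; have := h (inord 1); have := h (inord 2).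
by move=> /andP[? ?] /andP[? ?] /andP[? ?] /andP[? ?] /andP[? ?]; apply/andP; split; lra.
Qed.

(** The oscillation shrinks by 3/5 at each subdivision; every geometric rate 3/5 below has its
    origin here or in the eigenvalue 3/5 at a corner. *)
Lemma extension_mx_osc j b (d : R) : (forall k l, b k - b l <= d) ->
  forall k l, extension_mx j b k - extension_mx j b l <= 3 / 5 * d.
Proof.
move=> h k l; have d0 : 0 <= d by have := h j j; rewrite subrr.
have [<-|kl] := eqVneq k l; first by rewrite subrr; lra.
rewrite /extension_mx; have [kj|kj] := eqVneq k j; have [lj|lj] := eqVneq l j.
- by rewrite kj lj eqxx in kl.
- have [n /andP[ln jn]] := ord3_third kl; rewrite kj in kl jn *.
  rewrite (sum3_distinct b kl ln jn).
  by have := h j l; have := h j n; lra.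
- have [n /andP[ln jn]] := ord3_third kl; rewrite lj in kl ln *.
  rewrite (sum3_distinct b kl ln jn).
  by have := h k j; have := h n j; lra.
- by have := h k l; lra.
Qed.

(** At a junction two indices qualify, and the choice is immaterial when f i (p_l) = f l (p_i).
    Outside the three half triangles the value 0 is a mere default. *)
Definition glue (f : 'I_3 -> P -> R) : P -> R := fun x =>
  if [pick j | 2^-1 <= bc j x] is Some j then f j (Gmap j x) else 0.

Lemma glue_Fmap f j y : (forall i l, f i (corner l) = f l (corner i)) ->
  triangle y -> glue f (Fmap j y) = f j y.
Proof.
move=> hf ty; rewrite /glue; case: pickP => [i hi|/(_ j)]; last first.
  by rewrite bc_Fmap_ge.
have [->|ij] := eqVneq i j; first by rewrite FmapK.
have e : Fmap j y = Fmap i (corner j).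
  by apply: junctionP => //; [exact: triangle_Fmap|exact: bc_Fmap_ge].
rewrite e FmapK hf; congr (f j _); apply: (@Fmap_inj _ j).
by rewrite e Fmap_cornerC.
Qed.

Lemma norm_Gmap j x y : `|Gmap j x - Gmap j y| = 2 * `|x - y|.
Proof.
rewrite /Gmap opprB addrA subrK -scalerBr normrZ ger0_norm//.
Qed.

(** The three subcells are closed and cover S0, and on each of them the glued function is f j
    composed with a similarity. *)
Lemma glue_continuous f : (forall i l, f i (corner l) = f l (corner i)) ->
  (forall j, {within @S0 R, continuous (f j)}) -> {within @S0 R, continuous (glue f)}.
Proof.
move=> hf cf; pose A j : set P := [set x | S0 (Gmap j x)].
have e1 j z : A j z -> glue f z = f j (Gmap j z).
  by move=> Az; rewrite -{1}(GmapK j z) glue_Fmap//; exact: S0_triangle.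
have cA j : {within A j, continuous (glue f)}.
  apply/within_continuousP => x Ax e e0.
  have /within_continuousP/(_ _ Ax e e0)[d d0 hd] := cf j.
  exists (d / 2); first by rewrite divr_gt0.
  move=> y Ay xy; rewrite (e1 j x Ax) (e1 j y Ay).
  by apply: hd => //; rewrite norm_Gmap; lra.
have -> : @S0 R = A ord0 `|` A (inord 1) `|` A (inord 2).
  apply/seteqP; split=> x.
    move=> /S0_cover[j [y [Sy ->]]].
    have h : A j (Fmap j y) by rewrite /A /= FmapK.
    case: j h => [[|[|[|//]]] hj] h.
    - by left; left; rewrite (_ : ord0 = Ordinal hj)//; exact/val_inj.
    - by left; right; rewrite (_ : inord 1 = Ordinal hj)//; apply/val_inj; rewrite /= inordK.
    - by right; rewrite (_ : inord 2 = Ordinal hj)//; apply/val_inj; rewrite /= inordK.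
  have back j : A j x -> S0 x by move=> /(@S0_Fmap _ j (Gmap j x)); rewrite GmapK.
  by move=> [[]|]; exact: back.
have clA j : closed (A j) by exact: closed_FmapS0.
apply: withinU_continuous; [by apply: closedU; exact: clA|exact: clA| |exact: cA].
by apply: withinU_continuous; [exact: clA|exact: clA|exact: cA|exact: cA].
Qed.

(** Harmonic values at the vertices of level m, affine interpolation inside the cells of that
    level. *)
Fixpoint harm_approx m b : P -> R :=
  if m is m'.+1 then glue (fun j => harm_approx m' (extension_mx j b))
  else fun x => \sum_j b j * bc j x.

Lemma harm_approx_corner m b j : harm_approx m b (corner j) = b j.
Proof.
elim: m b j => [|m ih] b j /=.
  rewrite (bigD1 j)//= bc_corner eqxx mulr1 big1 ?addr0// => i ij.
  by rewrite bc_corner (negbTE ij) mulr0.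
rewrite -Fmap_corner glue_Fmap.
- by rewrite ih /extension_mx eqxx.
- by move=> i l; rewrite !ih extension_mxC.
- exact/S0_triangle/S0_corner.
Qed.

Lemma harm_approxS m b j y : triangle y ->
  harm_approx m.+1 b (Fmap j y) = harm_approx m (extension_mx j b) y.
Proof.
move=> ty; rewrite /= glue_Fmap// => i l.
by rewrite !harm_approx_corner extension_mxC.
Qed.

Lemma sum_bc_range b (lo hi : R) x : triangle x -> (forall k, lo <= b k <= hi) ->
  lo <= \sum_j b j * bc j x <= hi.
Proof.
move=> tx h; rewrite -[lo]mulr1 -[hi]mulr1 -(sum_bc x) !mulr_sumr.
by apply/andP; split; apply: ler_sum => j _; rewrite ler_wpM2r ?tx//;
  case/andP: (h j).
Qed.

Lemma harm_approx_range m b (lo hi : R) x : S0 x -> (forall k, lo <= b k <= hi) ->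
  lo <= harm_approx m b x <= hi.
Proof.
elim: m b x => [|m ih] b x Sx h; first by apply: sum_bc_range => //; exact: S0_triangle.
move: Sx => /S0_cover[j [y [Sy ->]]]; rewrite harm_approxS; last exact: S0_triangle.
by apply: ih => //; exact: extension_mx_range.
Qed.

(** At level 0 both approximations stay between the least boundary value and that value plus d. Each
    passage to a subcell contracts d by 3/5. *)
Lemma harm_approx_step m b (d : R) x : S0 x -> (forall k l, b k - b l <= d) ->
  `|harm_approx m.+1 b x - harm_approx m b x| <= (3 / 5) ^+ m * d.
Proof.
elim: m b d x => [|m ih] b d x Sx h.
  rewrite expr0 mul1r.
  have [k0 hk0] : exists k, forall l, b k <= b l.
    by have [k _ hk] := @arg_minP _ _ _ ord0 xpredT b isT; exists k => l; exact: hk.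
  have hb k : b k0 <= b k <= b k0 + d by rewrite hk0/=; have := h k k0; lra.
  have := harm_approx_range 1 Sx hb; have := harm_approx_range 0 Sx hb.
  by move=> /andP[? ?] /andP[? ?]; rewrite ler_norml; apply/andP; split; lra.
move: Sx => /S0_cover[j [y [Sy ->]]]; have ty := S0_triangle Sy.
rewrite (harm_approxS m.+1)// (harm_approxS m)//.
rewrite exprSr -mulrA; apply: ih => //.
exact: extension_mx_osc.
Qed.

Lemma harm_approxD m b c (s t : R) x : harm_approx m (fun k => s * b k + t * c k) x =
  s * harm_approx m b x + t * harm_approx m c x.
Proof.
elim: m b c x => [|m ih] b c x /=.
  by rewrite !mulr_sumr -big_split /=; apply: eq_bigr => j _; ring.
rewrite /glue; case: pickP => [j _|_]; last by rewrite !mulr0 addr0.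
by rewrite extension_mxD ih.
Qed.

Lemma harm_approx_continuous m b : {within @S0 R, continuous (harm_approx m b)}.
Proof.
elim: m b => [|m ih] b; last first.
  apply: (@glue_continuous (fun j => harm_approx m (extension_mx j b))) => [i l|j];
    last exact: ih.
  by rewrite !harm_approx_corner extension_mxC.
apply: continuous_subspaceT => x /=.
have h : continuous (fun x => b ord0 * bc ord0 x + b (inord 1) * bc (inord 1) x
   + b (inord 2) * bc (inord 2) x).
  move=> z; apply: (@cvgD _ _ _ (nbhs z)); last first.
    by apply: (@cvgMl_tmp _ _ (nbhs z)); exact: bc_continuous.
  by apply: (@cvgD _ _ _ (nbhs z)); apply: (@cvgMl_tmp _ _ (nbhs z)); exact: bc_continuous.
rewrite (_ : (fun x0 => \sum_(j < 3) b j * bc j x0) = (fun x0 => b ord0 * bc ord0 x0 +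
  b (inord 1) * bc (inord 1) x0 + b (inord 2) * bc (inord 2) x0)); first exact: h.
by apply/funext => z; rewrite sum3.
Qed.

Definition harm b x : R := limn (fun m => harm_approx m b x).

Definition osc b : R := \sum_k \sum_l `|b k - b l|.

Lemma le_osc b k l : b k - b l <= osc b.
Proof.
apply: (le_trans (ler_norm _)); rewrite /osc (bigD1 k)//= (bigD1 l)//= -addrA lerDl.
by rewrite addr_ge0//; apply: sumr_ge0 => i _ //; apply: sumr_ge0.
Qed.

Lemma osc_ge0 b : 0 <= osc b. Proof. by have := le_osc b ord0 ord0; rewrite subrr. Qed.

Lemma geom_cvg0 (q C : R) : `|q| < 1 -> (fun m => q ^+ m * C) @ \oo --> 0.
Proof.
move=> q1; rewrite -[X in _ --> X](mul0r C); apply: cvgMr_tmp; exact: cvg_expr.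
Qed.

Lemma harm_cvg b x : S0 x -> (fun m => harm_approx m b x) @ \oo --> harm b x.
Proof.
(* The factor 5/2 is 1 / (1 - 3/5): adding the tail of the geometric series of step bounds makes the
   sequence nonincreasing. *)
move=> Sx; pose E := 5 / 2 * osc b.
pose a m := harm_approx m b x + (3 / 5) ^+ m * E.
have ca : cvgn a.
  apply: nonincreasing_is_cvgn.
    apply/nonincreasing_seqP => m.
    have := harm_approx_step m Sx (le_osc b); rewrite ler_norml => /andP[_].
    by rewrite /a /E exprS; set u := (_ ^+ m : R); set w := osc b; lra.
  pose B := \sum_k `|b k|.
  have hB k : - B <= b k <= B.
    rewrite -ler_norml /B (bigD1 k)//= lerDl; exact: sumr_ge0.
  exists (- B) => _ [m _ <-]; rewrite /a; have /andP[h _] := harm_approx_range m Sx hB.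
  rewrite (le_trans h)// lerDl mulr_ge0 ?exprn_ge0 ?mulr_ge0 ?osc_ge0//; lra.
have cE : (fun m => (3 / 5) ^+ m * E) @ \oo --> 0.
  by apply: geom_cvg0; rewrite ger0_norm; lra.
suff : cvgn (fun m => harm_approx m b x) by [].
rewrite (_ : (fun m => _) = a \- (fun m => (3 / 5) ^+ m * E)).
  by apply: is_cvgB => //; apply/cvg_ex; exists 0.
by apply/funext => m; rewrite /a /= addrK.
Qed.

Lemma harm_dist m b x : S0 x ->
  `|harm b x - harm_approx m b x| <= (3 / 5) ^+ m * (5 / 2 * osc b).
Proof.
move=> Sx; set E := 5 / 2 * osc b.
have step k : `|harm_approx (m + k) b x - harm_approx m b x| <=
    ((3 / 5) ^+ m - (3 / 5) ^+ (m + k)) * E.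
  elim: k => [|k ih]; first by rewrite addn0 !subrr normr0 mul0r.
  rewrite addnS; set p := harm_approx _.+1 _ _; set q := harm_approx (m + k) b x in ih *.
  have := harm_approx_step (m + k) Sx (le_osc b).
  move: ih; rewrite -/p -/q !ler_norml exprS /E; set u := (3 / 5) ^+ (m + k).
  set v := _ ^+ m; set w := harm_approx _ _ _; set o := osc b.
  by move=> /andP[? ?] /andP[? ?]; apply/andP; split; lra.
have E0 : 0 <= E by rewrite mulr_ge0 ?osc_ge0.
have c : (fun k => `|harm_approx (k + m) b x - harm_approx m b x|) @ \oo -->
    `|harm b x - harm_approx m b x|.
  apply: cvg_norm; apply: cvgB; last exact: cvg_cst.
  by have := @harm_cvg b x Sx; rewrite -(cvg_shiftn m).
apply: (cvgr_to_le c); apply: nearW => k; rewrite addnC.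
apply: (le_trans (step k)); rewrite ler_wpM2r// gerBl exprn_ge0//; lra.
Qed.

Lemma harm_corner b j : harm b (corner j) = b j.
Proof.
rewrite /harm (_ : (fun m => _) = fun=> b j) ?lim_cst//.
by apply/funext => m; exact: harm_approx_corner.
Qed.

Lemma harm_Fmap b j y : S0 y -> harm b (Fmap j y) = harm (extension_mx j b) y.
Proof.
move=> Sy; apply/cvg_lim => //; rewrite -(cvg_shiftn 1) /=.
rewrite (_ : (fun m => _) = fun m => harm_approx m (extension_mx j b) y).
  exact: harm_cvg.
by apply/funext => m; rewrite addn1; apply: harm_approxS; exact: S0_triangle.
Qed.

Lemma harm_range b (lo hi : R) x : S0 x -> (forall k, lo <= b k <= hi) ->
  lo <= harm b x <= hi.
Proof.
move=> Sx h; apply/andP; split.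
  by apply: (cvgr_to_ge (@harm_cvg b x Sx)); apply: nearW => m; case/andP: (harm_approx_range m Sx h).
by apply: (cvgr_to_le (@harm_cvg b x Sx)); apply: nearW => m; case/andP: (harm_approx_range m Sx h).
Qed.

Lemma harmD b c (s t : R) x : S0 x -> harm (fun k => s * b k + t * c k) x =
  s * harm b x + t * harm c x.
Proof.
move=> Sx; apply/cvg_lim => //.
rewrite (_ : (fun m => _) = (fun m => s * harm_approx m b x + t * harm_approx m c x)).
  by apply: cvgD; apply: cvgMl_tmp; exact: harm_cvg.
by apply/funext => m; exact: harm_approxD.
Qed.

Lemma harm_continuous b : {within @S0 R, continuous (harm b)}.
Proof.
apply/within_continuousP => x Sx e e0.
have : (fun m => (3 / 5) ^+ m * (5 / 2 * osc b)) @ \oo --> 0.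
  by apply: geom_cvg0; rewrite ger0_norm; lra.
move=> /cvgrPdist_lt/(_ (e / 3)); rewrite divr_gt0// => /(_ isT)[m _ /(_ m (leqnn m))].
rewrite sub0r normrN => hm.
have {hm} hm : (3 / 5) ^+ m * (5 / 2 * osc b) < e / 3 by apply: le_lt_trans hm; exact: ler_norm.
have e3 : 0 < e / 3 by rewrite divr_gt0.
have /within_continuousP/(_ x Sx _ e3)[d d0 hd] := @harm_approx_continuous m b.
exists d => // y Sy xy; have := hd y Sy xy.
have := harm_dist m b Sx; have := harm_dist m b Sy; move: hm.
set C := _ * (_ * _); rewrite !ler_norml !ltr_norml.
by move=> ? /andP[? ?] /andP[? ?] /andP[? ?]; apply/andP; split; lra.
Qed.

(** The harmonic spline of level m: harmonic in every cell of level m, with the values of g at the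
    vertices. *)
Fixpoint pharm m (g : P -> R) : P -> R :=
  if m is m'.+1 then glue (fun j => pharm m' (g \o Fmap j)) else harm (g \o corner).

Lemma pharm_corner m g j : pharm m g (corner j) = g (corner j).
Proof.
elim: m g j => [|m ih] g j /=; first exact: harm_corner.
rewrite -{1}Fmap_corner glue_Fmap.
- by rewrite ih /= Fmap_corner.
- by move=> i l; rewrite !ih /= Fmap_cornerC.
- exact/S0_triangle/S0_corner.
Qed.

Lemma pharm_Fmap m g j y : S0 y -> pharm m.+1 g (Fmap j y) = pharm m (g \o Fmap j) y.
Proof.
move=> Sy; rewrite /= glue_Fmap//; last exact: S0_triangle.
by move=> i l; rewrite !pharm_corner /= Fmap_cornerC.
Qed.

Lemma pharm_continuous m g : {within @S0 R, continuous (pharm m g)}.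
Proof.
elim: m g => [|m ih] g; first exact: harm_continuous.
apply: (@glue_continuous (fun j => pharm m (g \o Fmap j))) => [i l|j]; last exact: ih.
by rewrite !pharm_corner /= Fmap_cornerC.
Qed.

Lemma pharm_range m g (lo hi : R) x : S0 x -> (forall v, V0 m v -> lo <= g v <= hi) ->
  lo <= pharm m g x <= hi.
Proof.
elim: m g x => [|m ih] g x Sx h.
  by apply: harm_range => // k; apply: h; exists k.
move: Sx => /S0_cover[j [y [Sy ->]]]; rewrite pharm_Fmap//.
by apply: ih => // v Vv; apply: h; exact: V0_Fmap.
Qed.

End Harmonic.

(** * Discrete energies *)

Section Energy.
Context {R : realType}.
Local Notation P := ('rV[R]_2).
Implicit Types (x y : P) (i j l : 'I_3) (m k : nat) (a b c : 'I_3 -> R) (u v : P -> R).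

Definition cell_energy m u : R := wsum true false m (sqd u).
Definition hole_energy m u : R := wsum false true m (sqd u).

Definition energy0 a b : R :=
  4^-1 * \sum_i \sum_(j | i != j) (a i - a j) * (b i - b j).

Lemma energy0E a b : energy0 a b = 2^-1 * ((a ord0 - a (inord 1)) * (b ord0 - b (inord 1)) +
  (a ord0 - a (inord 2)) * (b ord0 - b (inord 2)) +
  (a (inord 1) - a (inord 2)) * (b (inord 1) - b (inord 2))).
Proof.
have n01 : (ord0 : 'I_3) != inord 1 by rewrite -val_eqE /= inordK.
have n02 : (ord0 : 'I_3) != inord 2 by rewrite -val_eqE /= inordK.
have n12 : (inord 1 : 'I_3) != inord 2 by rewrite -val_eqE /= !inordK.
have e F i : \sum_(j | i != j) F j = \sum_(j < 3) (if i != j then F j else 0 : R).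
  by rewrite big_mkcond.
rewrite /energy0 sum3 !e !sum3 !eqxx n01 n02 n12 ![inord _ == ord0]eq_sym.
rewrite (negbTE n01) (negbTE n02) [inord 2 == inord 1]eq_sym (negbTE n12) /=.
by field.
Qed.

Lemma cell_energy0 u : cell_energy 0 u = energy0 (u \o corner) (u \o corner).
Proof. by rewrite /cell_energy wsum0. Qed.

Lemma energy0_ge0 a : 0 <= energy0 a a.
Proof.
rewrite energy0E -!expr2 mulr_ge0//.
by rewrite !addr_ge0// sqr_ge0.
Qed.

(** Read c i j as the value at F_i p_j of an arbitrary function on level 1. Its level 1 energy
    product with a harmonic extension involves only the values at the three outer corners, the
    values at the midpoints cancel: this is harmonicity, and it fixes the renormalisation factor
    5/3. *)
Lemma energy0_decomp a (c : 'I_3 -> 'I_3 -> R) : (forall i j, c i j = c j i) ->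
  5 / 3 * (\sum_j energy0 (c j) (extension_mx j a)) = energy0 (fun j => c j j) a.
Proof.
move=> cC; rewrite sum3 !energy0E /extension_mx.
have n01 : (ord0 : 'I_3) != inord 1 by rewrite -val_eqE /= inordK.
have n02 : (ord0 : 'I_3) != inord 2 by rewrite -val_eqE /= inordK.
have n12 : (inord 1 : 'I_3) != inord 2 by rewrite -val_eqE /= !inordK.
rewrite !eqxx (negbTE n01) (negbTE n02) (negbTE n12) ![inord _ == ord0]eq_sym.
rewrite (negbTE n01) (negbTE n02) [inord 2 == inord 1]eq_sym (negbTE n12) !sum3.
rewrite (cC (inord 1) ord0) (cC (inord 2) ord0) (cC (inord 2) (inord 1)).
set a0 := a ord0; set a1 := a (inord 1); set a2 := a (inord 2).
set c01 := c ord0 (inord 1); set c02 := c ord0 (inord 2); set c12 := c (inord 1) (inord 2).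
set c00 := c ord0 ord0; set c11 := c (inord 1) (inord 1); set c22 := c (inord 2) (inord 2).
by field.
Qed.

Lemma energy0_extension a : 5 / 3 * (\sum_j energy0 (extension_mx j a) (extension_mx j a)) =
  energy0 a a.
Proof.
rewrite (energy0_decomp a (c := fun j => extension_mx j a)); last first.
  by move=> i j; exact: extension_mxC.
by congr energy0; apply/funext => j; rewrite /extension_mx eqxx.
Qed.

Lemma cell_energyS m u :
  cell_energy m.+1 u = 5 / 3 * \sum_j cell_energy m (u \o Fmap j).
Proof. by rewrite /cell_energy wsumS addr0. Qed.

Lemma eq_cell_energy m u v : (forall x, V0 m x -> u x = v x) ->
  cell_energy m u = cell_energy m v.
Proof. by move=> h; apply: eq_wsum => x y Vx Vy; rewrite /sqd !h. Qed.

(** The cross term depends on u through its boundary values only. Monotonicity of the energies,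
    minimality of harmonic functions and uniqueness of the minimiser all come from this identity. *)
Lemma cell_energy_sub_harm m u a : cell_energy m (fun x => u x - harm a x) =
  cell_energy m u - 2 * energy0 (u \o corner) a + energy0 a a.
Proof.
elim: m u a => [|m ih] u a.
  rewrite !cell_energy0 !energy0E /= !harm_corner; ring.
rewrite !cell_energyS.
have -> : \sum_j cell_energy m ((fun x => u x - harm a x) \o Fmap j) =
    \sum_j (cell_energy m (u \o Fmap j) - 2 * energy0 (u \o Fmap j \o corner) (extension_mx j a)
      + energy0 (extension_mx j a) (extension_mx j a)).
  apply: eq_bigr => j _; rewrite -ih; apply: eq_cell_energy => x /V0_S0 Sx /=.
  by rewrite harm_Fmap.
rewrite !big_split /= !mulrDr energy0_extension; congr (_ + _ + _).
rewrite sumrN mulrN; congr (- _); rewrite -mulr_sumr mulrCA; congr (_ * _).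
rewrite (energy0_decomp a (c := fun j => u \o Fmap j \o corner)).
  by congr energy0; apply/funext => j /=; rewrite Fmap_corner.
by move=> i j /=; rewrite Fmap_cornerC.
Qed.

Lemma cell_energy_ge0 m u : 0 <= cell_energy m u.
Proof. by apply: wsum_ge0 => x y _ _; exact: sqr_ge0. Qed.

Lemma cell_energy_harm m a : cell_energy m (harm a) = energy0 a a.
Proof.
have := cell_energy_sub_harm m (harm a) a.
rewrite (_ : harm a \o corner = a); last by apply/funext => j; exact: harm_corner.
rewrite (_ : cell_energy m (fun _ => _) = 0); first by lra.
rewrite /cell_energy (@eq_wsum _ _ _ _ _ (fun x y => 0 * 0)) ?wsumZ ?mul0r//.
by move=> x y _ _; rewrite /sqd !subrr expr0n.
Qed.

Lemma energy0_le m u : energy0 (u \o corner) (u \o corner) <= cell_energy m u.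
Proof.
have := cell_energy_sub_harm m u (u \o corner).
have := cell_energy_ge0 m (fun x => u x - harm (u \o corner) x); lra.
Qed.

Lemma cell_energy_nondecreasing u : nondecreasing_seq (cell_energy^~ u).
Proof.
apply/nondecreasing_seqP => m; elim: m u => [|m ih] u.
  by rewrite cell_energy0; exact: energy0_le.
rewrite [leLHS]cell_energyS cell_energyS ler_wpM2l//.
by apply: ler_sum => j _; exact: ih.
Qed.

(** Pythagoras for splines: the error of the spline of level k is exactly the energy not yet seen at
    that level. *)
Lemma cell_energy_sub_pharm k m u : cell_energy (k + m) (fun x => u x - pharm k u x) =
  cell_energy (k + m) u - cell_energy k u.
Proof.
elim: k u => [|k ih] u.
  by rewrite add0n cell_energy0 /= cell_energy_sub_harm; ring.
rewrite addSn !cell_energyS -mulrBr -sumrB; congr (_ * _); apply: eq_bigr => j _.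
rewrite -ih; apply: eq_cell_energy => x /V0_S0 Sx /=.
by rewrite -[glue _ _]/(pharm k.+1 u _) pharm_Fmap.
Qed.

Lemma cell_energy_pharm k m u : cell_energy (k + m) (pharm k u) = cell_energy k u.
Proof.
elim: k u => [|k ih] u; first by rewrite add0n cell_energy_harm cell_energy0.
rewrite addSn !cell_energyS; congr (_ * _); apply: eq_bigr => j _.
by rewrite -ih; apply: eq_cell_energy => x /V0_S0 Sx /=;
  rewrite -[glue _ _]/(pharm k.+1 u _) pharm_Fmap.
Qed.

Lemma hole_energyS m u : hole_energy m.+1 u =
  5 / 3 * (\sum_j hole_energy m (u \o Fmap j)) + holesum m (sqd u).
Proof. by rewrite /hole_energy wsumS. Qed.

Lemma eq_hole_energy m u v : (forall x, V0 m x -> u x = v x) ->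
  hole_energy m u = hole_energy m v.
Proof. by move=> h; apply: eq_wsum => x y Vx Vy; rewrite /sqd !h. Qed.

Lemma hole_energy_ge0 m u : 0 <= hole_energy m u.
Proof. by apply: wsum_ge0 => x y _ _; exact: sqr_ge0. Qed.

Lemma S0_Fiter j m x : S0 x -> S0 (Fiter j m x).
Proof. by move=> Sx; elim: m => [//|m ih]; exact: S0_Fmap. Qed.

(** Approaching a corner, the differences to the corner value evolve with eigenvalue 3/5 on the
    symmetric and 1/5 on the antisymmetric part. [decay_sum] and [decay_diff] are the resulting
    weights of the near and the far boundary value. *)
Definition decay_sum m : R := ((3 / 5) ^+ m + (1 / 5) ^+ m) / 2.
Definition decay_diff m : R := ((3 / 5) ^+ m - (1 / 5) ^+ m) / 2.

Lemma harm_Fiter b m i j l : i != j -> j != l -> i != l ->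
  harm b (Fiter j m (corner l)) =
  b j + decay_sum m * (b l - b j) + decay_diff m * (b i - b j).
Proof.
rewrite /decay_sum /decay_diff.
elim: m b => [|m ih] b ij jl il; first by rewrite harm_corner !expr0; field.
rewrite /= harm_Fmap; last by apply: S0_Fiter; exact: S0_corner.
have lj : (l == j) = false by rewrite eq_sym (negbTE jl).
rewrite ih// /extension_mx eqxx lj (negbTE ij) (sum3_distinct b ij jl il) !exprS.
set p := _ ^+ m; set q := _ ^+ m; by field.
Qed.

Definition hole_ratio m : R := decay_sum m / 5 + decay_diff m.

(** The reflection exchanging i and j swaps the two ends, so the jump is antisymmetric and linear in
    b: the value b_l drops out. *)
Lemma harm_hole_pair b m t : distinct3 t ->
  harm b (hole_pair m t).1 - harm b (hole_pair m t).2 =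
  (b t.1.1 - b t.1.2) * hole_ratio m.
Proof.
case: t => -[i j] l /and3P[ij jl il] /=.
have S (k : 'I_3) : S0 (Fiter k m (corner l) : P) by apply: S0_Fiter; exact: S0_corner.
have ji : j != i by rewrite eq_sym.
have [li lj] : l != i /\ l != j by rewrite ![l == _]eq_sym.
rewrite !harm_Fmap// (harm_Fiter _ _ ij jl il) (harm_Fiter _ _ ji il jl).
rewrite /extension_mx !eqxx (negbTE ij) (negbTE ji) (negbTE li) (negbTE lj).
rewrite (sum3_distinct b ij jl il) /hole_ratio; by field.
Qed.

Lemma hole_ratio_range m : 0 <= hole_ratio m <= (3 / 5) ^+ m.+1.
Proof.
rewrite /hole_ratio /decay_sum /decay_diff.
have h : (1 / 5) ^+ m <= (3 / 5) ^+ m :> R by rewrite lerXn2r ?nnegrE//; lra.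
have h0 : 0 <= (1 / 5) ^+ m :> R by rewrite exprn_ge0.
rewrite exprS; set p := (3 / 5) ^+ m in h *; set q := _ ^+ m in h h0 *.
by apply/andP; split; lra.
Qed.

Lemma sum_distinct3 (F : 'I_3 -> 'I_3 -> R) :
  \sum_(t | distinct3 t) F t.1.1 t.1.2 = \sum_i \sum_(j | i != j) F i j.
Proof.
rewrite pair_big_dep /=.
rewrite (eq_bigl (fun t : 'I_3 * 'I_3 * 'I_3 => (t.1.1 != t.1.2) &&
   ((t.1.2 != t.2) && (t.1.1 != t.2)))); last by case=> -[].
rewrite -(pair_big_dep (fun ij : 'I_3 * 'I_3 => ij.1 != ij.2)
   (fun ij l => (ij.2 != l) && (ij.1 != l)) (fun ij _ => F ij.1 ij.2)) /=.
apply: eq_bigr => -[i j] /= ij; have [l /andP[jl il]] := ord3_third ij.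
rewrite (big_pred1 l)// => n; apply/andP/eqP => [[jn i_n]|->]//.
by have := ord3_cases n ij jl il;
  rewrite [n == i]eq_sym [n == j]eq_sym (negbTE jn) (negbTE i_n) => /eqP.
Qed.

Definition hole_coeff m : R := if (0 < m)%N then (5 / 3) ^+ m.+1 * hole_ratio m ^+ 2 else 0.

Lemma holesum_harm m b : holesum m (sqd (harm b)) = hole_coeff m * energy0 b b.
Proof.
rewrite /holesum /hole_coeff; case: ifP => _; last by rewrite mul0r.
rewrite /energy0.
have -> : \sum_(t | distinct3 t) sqd (harm b) (hole_pair m t).1 (hole_pair m t).2 =
   \sum_(t | distinct3 t) hole_ratio m ^+ 2 * (b t.1.1 - b t.1.2) ^+ 2.
  by apply: eq_bigr => t dt; rewrite /sqd harm_hole_pair// exprMn mulrC.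
rewrite -mulr_sumr (sum_distinct3 (fun i j => (b i - b j) ^+ 2)).
under eq_bigr do under eq_bigr do rewrite expr2.
by set s := \sum_i _; ring.
Qed.

Definition hole_const m : R := \sum_(k < m) hole_coeff k.

(** For harmonic functions the proportion between hole and cell energy is exact at every level,
    since each subcell carries again a harmonic function. Its limit is the fixed multiple for all
    functions of finite energy. *)
Lemma hole_energy_harm m b : hole_energy m (harm b) = hole_const m * energy0 b b.
Proof.
elim: m b => [|m ih] b; first by rewrite /hole_energy wsum00 /hole_const big_ord0 mul0r.
have -> : hole_const m.+1 = hole_const m + hole_coeff m by rewrite /hole_const big_ord_recr.
rewrite hole_energyS holesum_harm [RHS]mulrDl; congr (_ + _).
rewrite -(energy0_extension b) [RHS]mulrCA; congr (_ * _).
rewrite mulr_sumr; apply: eq_bigr => j _.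
rewrite -ih; apply: eq_hole_energy => x /V0_S0 Sx /=.
by rewrite harm_Fmap.
Qed.

(** The jump is at most (3/5)^(m+1), and its square beats the weight (5/3)^(m+1), leaving a summable
    geometric bound. *)
Lemma hole_coeff_range m : 0 <= hole_coeff m <= (3 / 5) ^+ m.
Proof.
rewrite /hole_coeff; case: ifP => _; last by rewrite lexx exprn_ge0.
have /andP[h0 h1] := hole_ratio_range m.
have p0 : 0 <= (5 / 3 : R) ^+ m.+1 by rewrite exprn_ge0.
rewrite mulr_ge0 ?sqr_ge0//=.
have : hole_ratio m ^+ 2 <= ((3 / 5) ^+ m.+1) ^+ 2 by rewrite lerXn2r ?nnegrE ?exprn_ge0.
move=> /(ler_wpM2l p0) /le_trans; apply; rewrite expr2 mulrA -exprMn.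
rewrite (_ : 5 / 3 * (3 / 5) = 1 :> R); last by field.
rewrite expr1n mul1r exprS; have : 0 <= (3 / 5 : R) ^+ m by rewrite exprn_ge0.
lra.
Qed.

Definition hole_limit : R := limn hole_const.

Lemma hole_const_cvg : hole_const @ \oo --> hole_limit.
Proof.
apply: nondecreasing_is_cvgn.
  apply/nondecreasing_seqP => m; rewrite /hole_const big_ord_recr /= lerDl.
  by case/andP: (hole_coeff_range m).
exists (5 / 2) => _ [m _ <-].
suff : hole_const m <= 5 / 2 * (1 - (3 / 5) ^+ m).
  by have : 0 <= (3 / 5 : R) ^+ m by [rewrite exprn_ge0]; lra.
elim: m => [|m ih]; first by rewrite /hole_const big_ord0 expr0 subrr mulr0.
rewrite /hole_const big_ord_recr /= -/(hole_const m) exprS.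
have /andP[_] := hole_coeff_range m; lra.
Qed.

Lemma hole_limit_ge0 : 0 <= hole_limit.
Proof.
apply: (cvgr_to_ge hole_const_cvg); apply: nearW => m.
by apply: sumr_ge0 => k _; case/andP: (hole_coeff_range k).
Qed.

Definition corner_energy m u : R :=
  4^-1 * (5 / 3) ^+ m * \sum_j \sum_(l | j != l) (u (Fiter j m (corner l)) - u (corner j)) ^+ 2.

(* Hole edges at a junction are controlled by the cell edges at the adjacent
   corners of the two subcells, which the corner terms keep track of. *)
Lemma hole_corner_energy_le m u :
  hole_energy m u + 4 * corner_energy m u <= 4 * cell_energy m u.
Proof.
elim: m u => [|m ih] u.
  rewrite /hole_energy wsum00 add0r cell_energy0 ler_wpM2l// /corner_energy /energy0.
  rewrite expr0 mulr1 ler_wpM2l//; apply: ler_sum => i _; apply: ler_sum => j _ /=.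
  by rewrite expr2; lra.
rewrite hole_energyS cell_energyS.
suff hs : holesum m (sqd u) + 4 * corner_energy m.+1 u <=
    4 * (5 / 3 * \sum_j corner_energy m (u \o Fmap j)).
  have : 5 / 3 * (\sum_j (hole_energy m (u \o Fmap j) + 4 * corner_energy m (u \o Fmap j))) <=
     5 / 3 * (\sum_j (4 * cell_energy m (u \o Fmap j))).
    by rewrite ler_wpM2l//; apply: ler_sum => j _; exact: ih.
  have e f : \sum_j 4 * f (u \o Fmap j) = 4 * \sum_j f (u \o Fmap j) :> R.
    by rewrite mulr_sumr.
  by rewrite big_split /= !e; lra.
pose D i j l := (u (Fmap i (Fiter j m (corner l))) - u (Fmap i (corner j))) ^+ 2.
pose K : R := 4^-1 * (5 / 3) ^+ m.+1.
have K0 : 0 <= K by rewrite mulr_ge0 ?exprn_ge0.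
have -> : 5 / 3 * \sum_j corner_energy m (u \o Fmap j) =
    K * \sum_i \sum_j \sum_(l | j != l) D i j l.
  rewrite mulr_sumr [RHS]mulr_sumr; apply: eq_bigr => i _.
  by rewrite /corner_energy /K exprS /D /=; set S := \sum_j _; ring.
have eD i j : \sum_(l | j != l) D i j l =
   (if i == j then \sum_(l | i != l) D i i l
    else D i j i + \sum_(l | (j != l) && (i != l)) D i j l).
  case: eqVneq => [->//|ij]; rewrite (bigD1 i) 1?eq_sym//=; congr (_ + _).
  by apply: eq_bigl => l; rewrite [l == i]eq_sym.
(* The terms with equal indices sit at outer corners and form the corner energy of the next level.
   At the junction of i and j only the edges towards the third corner are kept, which border the
   central hole. *)
have hD : \sum_i \sum_(l | i != l) D i i l + \sum_i \sum_(j | i != j)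
     \sum_(l | (j != l) && (i != l)) D i j l <= \sum_i \sum_j \sum_(l | j != l) D i j l.
  rewrite -big_split /=; apply: ler_sum => i _.
  rewrite [leRHS](bigD1 i)//= lerD2l; rewrite (eq_bigl (fun j => j != i)); last first.
    by move=> j; rewrite eq_sym.
  apply: ler_sum => j ji; rewrite eD eq_sym (negbTE ji) lerDr; exact: sqr_ge0.
have -> : corner_energy m.+1 u = K * \sum_i \sum_(l | i != l) D i i l.
  rewrite /corner_energy -/K; congr (_ * _); apply: eq_bigr => i _; apply: eq_bigr => l _.
  by rewrite /D Fmap_corner.
have hh : holesum m (sqd u) <= 4 * (K * \sum_i \sum_(j | i != j)
     \sum_(l | (j != l) && (i != l)) D i j l).
  set S := \sum_i \sum_(j | _) _.
  have S0 : 0 <= S.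
    by apply: sumr_ge0 => i _; apply: sumr_ge0 => j _; apply: sumr_ge0 => l _; exact: sqr_ge0.
  rewrite /holesum; case: ifP => _; last by rewrite mulr_ge0// mulr_ge0.
  rewrite -/K mulrCA ler_wpM2l//.
  have eS : S = \sum_(t | distinct3 t) D t.1.1 t.1.2 t.2.
    rewrite /S pair_big_dep /= pair_big_dep /=.
    by apply: eq_big => [[[i j] l]|[[i j] l]].
  have eS' : S = \sum_(t | distinct3 t) D t.1.2 t.1.1 t.2.
    rewrite eS (reindex_inj (h := fun t : 'I_3 * 'I_3 * 'I_3 => (t.1.2, t.1.1, t.2))) /=.
      apply: eq_bigl => -[[i j] l] /=.
      by rewrite eq_sym [(i != l) && _]andbC.
    by move=> [[i j] l] [[i' j'] l'] /= [-> -> ->].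
  (* With w the value at the junction, (p - q)^2 is at most 2 (p - w)^2 + 2 (q - w)^2; the sum S is
     used twice, once for each end of the hole pair. *)
  have -> : 4 * S = \sum_(t | distinct3 t) (2 * D t.1.1 t.1.2 t.2 + 2 * D t.1.2 t.1.1 t.2).
    by rewrite big_split /= -!mulr_sumr -eS -eS'; ring.
  apply: ler_sum => -[[i j] l] _ /=; rewrite /sqd /D (Fmap_cornerC j i).
  set p := u _; set q := u _; set w := u _.
  by have := sqr_ge0 (p + q - 2 * w); rewrite !expr2; nra.
have := ler_wpM2l K0 hD; rewrite mulrDr; lra.
Qed.

Lemma hole_energy_le m u : hole_energy m u <= 4 * cell_energy m u.
Proof.
have := hole_corner_energy_le m u.
suff : 0 <= corner_energy m u by lra.
rewrite /corner_energy !mulr_ge0 ?exprn_ge0//.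
by apply: sumr_ge0 => j _; apply: sumr_ge0 => l _; exact: sqr_ge0.
Qed.

End Energy.

(** * Convergence of the discrete energies *)

Section EnergyLimit.
Context {R : realType}.
Local Notation P := ('rV[R]_2).
Implicit Types (x y : P) (i j l : 'I_3) (m k : nat) (a b c : 'I_3 -> R) (u v g : P -> R).

Lemma decay_range m :
  0 <= (decay_diff m : R) <= decay_sum m /\ (decay_sum m : R) <= (3 / 5) ^+ m.
Proof.
rewrite /decay_diff /decay_sum.
have h : (1 / 5) ^+ m <= (3 / 5) ^+ m :> R by rewrite lerXn2r ?nnegrE//; lra.
have h0 : 0 <= (1 / 5) ^+ m :> R by rewrite exprn_ge0.
by split; [apply/andP; split|]; lra.
Qed.

Lemma pharm_corner_decay k g j l : exists2 K, 0 <= K &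
  forall m, `|pharm k g (Fiter j (k + m) (corner l)) - g (corner j)| <= (3 / 5) ^+ m * K.
Proof.
elim: k g => [|k ih] g; last first.
  have [K K0 hK] := ih (g \o Fmap j); exists K => // m.
  rewrite (_ : Fiter j (k.+1 + m) (corner l) = Fmap j (Fiter j (k + m) (corner l)))//.
  rewrite pharm_Fmap.
    by have := hK m; rewrite /= Fmap_corner.
  by apply: S0_Fiter; exact: S0_corner.
exists (2 * osc (g \o corner)); first by rewrite mulr_ge0 ?osc_ge0.
move=> m; rewrite add0n /=.
have [<-|jl] := eqVneq j l.
  have -> : Fiter j m (corner j) = corner j :> P.
    by elim: m => [//|m ih]; rewrite /= ih Fmap_corner.
  by rewrite harm_corner /= subrr normr0 !mulr_ge0 ?exprn_ge0 ?osc_ge0.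
have [i /andP[li ji]] := ord3_third jl.
have [ij il] : i != j /\ i != l by rewrite ![i == _]eq_sym.
have [/andP[d0 d1] d2] := decay_range m.
rewrite (harm_Fiter _ _ ij jl il).
set A := decay_sum m * _; set B := decay_diff m * _.
have -> : (g \o corner) j + A + B - g (corner j) = A + B by rewrite /=; ring.
rewrite /A /B {A B}.
have o (k1 k2 : 'I_3) : `|(g \o corner) k1 - (g \o corner) k2| <= osc (g \o corner).
  by rewrite ler_norml; have := le_osc (g \o corner) k1 k2;
    have := le_osc (g \o corner) k2 k1; move=> ? ?; apply/andP; split; lra.
apply: (le_trans (ler_normD _ _)); rewrite (normrM (decay_sum m)) (normrM (decay_diff m)).
rewrite (ger0_norm d0) (ger0_norm (le_trans d0 d1)).
rewrite (_ : _ * (2 * _) = (3 / 5) ^+ m * osc (g \o corner) + (3 / 5) ^+ m * osc (g \o corner)).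
  apply: lerD; apply: ler_pM => //; try exact: o; try exact: le_trans d1 d2; try lra.
by ring.
Qed.

Lemma holesum_ge0 m u : 0 <= holesum m (sqd u).
Proof.
rewrite /holesum; case: ifP => // _; rewrite !mulr_ge0 ?exprn_ge0//.
by apply: sumr_ge0 => t _; exact: sqr_ge0.
Qed.

(** Both ends of a pair across the central hole tend to the junction, where the spline is continuous
    at rate (3/5)^m; squared, this beats the weight (5/3)^m. *)
Lemma holesum_pharm_cvg k u :
  (fun m => holesum (k + m) (sqd (pharm k.+1 u))) @ \oo --> 0.
Proof.
have [K K0 hK] : exists2 K, 0 <= K & forall i j l m,
   `|pharm k.+1 u (Fmap i (Fiter j (k + m) (corner l))) - u (Fmap i (corner j))| <=
   (3 / 5) ^+ m * K.
  have h (t : 'I_3 * 'I_3 * 'I_3) : exists K, 0 <= K /\ forall m,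
     `|pharm k.+1 u (Fmap t.1.1 (Fiter t.1.2 (k + m) (corner t.2))) -
       u (Fmap t.1.1 (corner t.1.2))| <= (3 / 5) ^+ m * K.
    have [K K0 hK] := pharm_corner_decay k (u \o Fmap t.1.1) t.1.2 t.2.
    exists K; split=> // m; rewrite pharm_Fmap; first exact: hK.
    by apply: S0_Fiter; exact: S0_corner.
  have [Kt hKt] := choice h; exists (\sum_t Kt t).
    by apply: sumr_ge0 => t _; case: (hKt t).
  move=> i j l m; have [_ /(_ m) /= h1] := hKt (i, j, l).
  apply: (le_trans h1); rewrite ler_wpM2l ?exprn_ge0//.
  rewrite (bigD1 (i, j, l))//= lerDl; apply: sumr_ge0 => t _; by case: (hKt t).
pose N : R := \sum_(t : 'I_3 * 'I_3 * 'I_3 | distinct3 t) 1.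
pose C : R := 4^-1 * (5 / 3) ^+ k.+1 * (N * (2 * K) ^+ 2).
have up m : holesum (k + m) (sqd (pharm k.+1 u)) <= (3 / 5) ^+ m * C.
  have C0 : 0 <= (3 / 5) ^+ m * C.
    rewrite /C; repeat (apply: mulr_ge0 => //); rewrite ?exprn_ge0 ?mulr_ge0//.
    by apply: sumr_ge0.
  rewrite /holesum; case: ifP => // _.
  rewrite (_ : _ * C = 4^-1 * (5 / 3) ^+ (k + m).+1 * (N * (2 * ((3 / 5) ^+ m * K)) ^+ 2)); last first.
    rewrite /C -addSn exprD; set p := (5 / 3) ^+ k.+1.
    have e : (5 / 3) ^+ m * (3 / 5) ^+ m = 1 :> R.
      by rewrite -exprMn (_ : 5 / 3 * (3 / 5) = 1) ?expr1n//; field.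
    set q := (5 / 3) ^+ m in e *; set w := (3 / 5) ^+ m in e *.
    transitivity (4^-1 * p * (q * w) * (N * (2 * K) ^+ 2) * w); last by ring.
    by rewrite e; ring.
  rewrite ler_wpM2l ?mulr_ge0 ?exprn_ge0// mulr_suml; apply: ler_sum => -[[i j] l] _.
  rewrite mul1r /sqd [(hole_pair _ _).1]/= [(hole_pair _ _).2]/=.
  have := hK i j l m; have := hK j i l m; rewrite (Fmap_cornerC j i) !ler_norml.
  set p := pharm _ _ _; set q := pharm _ _ _; set w := u _; set z := _ * K.
  move=> /andP[? ?] /andP[? ?].
  by rewrite -ler_sqrt ?sqr_ge0// !sqrtr_sqr ler_norml ger0_norm; [apply/andP; split; lra|lra].
have c0 : (fun m => (3 / 5) ^+ m * C) @ \oo --> 0.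
  by apply: geom_cvg0; rewrite ger0_norm; lra.
apply: (squeeze_cvgr _ (cvg_cst 0) c0); apply: nearW => m.
by rewrite up holesum_ge0.
Qed.

Lemma hole_energy_pharm_cvg k u :
  (fun m => hole_energy (k + m) (pharm k u)) @ \oo --> hole_limit * cell_energy k u.
Proof.
elim: k u => [|k ih] u.
  rewrite cell_energy0 (_ : (fun m => _) =
     fun m => hole_const m * energy0 (u \o corner) (u \o corner)).
    by apply: cvgMr_tmp; exact: hole_const_cvg.
  by apply/funext => m; rewrite add0n hole_energy_harm.
rewrite (_ : (fun m => _) = (fun m => 5 / 3 * (\sum_j hole_energy (k + m) (pharm k (u \o Fmap j))) +
   holesum (k + m) (sqd (pharm k.+1 u)))); last first.
  apply/funext => m; rewrite addSn hole_energyS; congr (_ * _ + _).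
  apply: eq_bigr => j _; apply: eq_hole_energy => x /V0_S0 Sx.
  by rewrite /comp pharm_Fmap.
rewrite -[X in _ --> X]addr0; apply: cvgD; last exact: holesum_pharm_cvg.
rewrite cell_energyS mulrCA; apply: cvgMl_tmp.
under eq_fun do rewrite sum3.
rewrite sum3 !mulrDr.
by apply: cvgD; [apply: cvgD|]; exact: ih.
Qed.

Definition bounded_energy u := exists M, forall m, cell_energy m u <= M.

Definition limit_energy u : R := limn (cell_energy^~ u).

Lemma cell_energy_cvg u : bounded_energy u -> cell_energy^~ u @ \oo --> limit_energy u.
Proof.
move=> [M hM]; apply: nondecreasing_is_cvgn; first exact: cell_energy_nondecreasing.
by exists M => _ [m _ <-].
Qed.

Lemma cell_energy_le_limit u m : bounded_energy u -> cell_energy m u <= limit_energy u.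
Proof.
move=> hu; apply: nondecreasing_cvgn_le; first exact: cell_energy_nondecreasing.
exact: cell_energy_cvg.
Qed.

(** On each edge, (A + B)^2 is at most (1 + e) A^2 + (1 + 1/e) B^2. The coefficient close to 1 is
    what lets the limit for splines pass to u. *)
Lemma hole_energy_perturb m u v (e : R) : 0 < e ->
  hole_energy m u <= (1 + e) * hole_energy m v +
    (1 + e^-1) * hole_energy m (fun x => u x - v x).
Proof.
move=> e0; rewrite /hole_energy -!wsumZ -wsumD; apply: ler_wsum => x y _ _.
rewrite /sqd; set p := u x; set q := u y; set r := v x; set s := v y.
have -> : p - q = (r - s) + ((p - r) - (q - s)) by ring.
set A := r - s; set B := _ - _.
have : 0 <= e^-1 * (e * A - B) ^+ 2 by rewrite mulr_ge0 ?sqr_ge0// invr_ge0 ltW.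
have -> : e^-1 * (e * A - B) ^+ 2 = e * A ^+ 2 + e^-1 * B ^+ 2 - 2 * A * B.
  by field; rewrite gt_eqF.
by rewrite !expr2; lra.
Qed.

Lemma hole_energy_subC m u v :
  hole_energy m (fun x => u x - v x) = hole_energy m (fun x => v x - u x).
Proof. by apply: eq_wsum => x y _ _; rewrite /sqd; ring. Qed.

(** The limit is known for splines, the splines approach u in cell energy, and hole energy is at
    most four times cell energy. So u may be replaced by a spline of high level, up to small errors
    in both directions. *)
Lemma hole_energy_cvg u : bounded_energy u ->
  hole_energy^~ u @ \oo --> hole_limit * limit_energy u.
Proof.
move=> hu; set E := limit_energy u.
have E0 : 0 <= E by apply: le_trans (cell_energy_ge0 0 u) (cell_energy_le_limit 0 hu).
have c0 : 0 <= @hole_limit R := hole_limit_ge0.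
apply/cvgrPdist_lt => e e0.
(* Chosen so that eta times a hole energy, which is at most 4 E, stays below e / 4; the summand 1
   covers E = 0. *)
pose eta := e / (16 * (E + 1)).
have eta0 : 0 < eta by rewrite divr_gt0// mulr_gt0//; lra.
have etaE : 4 * eta * E < e / 4.
  have h : eta * (E + 1) = e / 16.
    by rewrite /eta invfM mulrA mulfVK// gt_eqF//; lra.
  by lra.
(* The total coefficient of the missing energy E - cell_energy k u: the first summand comes from the
   perturbation, the second from the limit value. *)
pose C := (1 + eta^-1) * 4 + hole_limit.
have C0 : 0 < C.
  rewrite ltr_wpDr// mulr_gt0// addr_gt0// invr_gt0//.
have /cvgrPdist_lt/(_ (e / 4 / C)) := cell_energy_cvg hu.
rewrite divr_gt0 ?divr_gt0// => /(_ isT)[k _ /(_ k (leqnn k))].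
rewrite -/E ger0_norm ?subr_ge0 ?cell_energy_le_limit// ltr_pdivlMr// => hk.
have hk' : C * (E - cell_energy k u) < e / 4 by rewrite mulrC.
have d0 : 0 <= E - cell_energy k u by rewrite subr_ge0 cell_energy_le_limit.
have /cvgrPdist_lt/(_ (e / 4)) := @hole_energy_pharm_cvg k u.
rewrite divr_gt0// => /(_ isT)[m0 _ hm0].
exists (k + m0)%N => // N /= hN.
have -> : N = (k + (N - k))%N by rewrite subnKC//; apply: leq_trans hN; exact: leq_addr.
set m := (N - k)%N.
have hm : (m0 <= m)%N by rewrite /m leq_subRL ?(leq_trans _ hN)// leq_addr.
have := hm0 m hm; set Qv := hole_energy _ _; set Qu := hole_energy _ _.
set L := hole_limit * cell_energy k u => hL.
have hQv : Qv <= 4 * E.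
  apply: (le_trans (hole_energy_le _ _)); rewrite ler_wpM2l// cell_energy_pharm.
  exact: cell_energy_le_limit.
have hQu : Qu <= 4 * E.
  apply: (le_trans (hole_energy_le _ _)); rewrite ler_wpM2l//.
  exact: cell_energy_le_limit.
pose D := hole_energy (k + m) (fun x => u x - pharm k u x).
have hD : D <= 4 * (E - cell_energy k u).
  apply: (le_trans (hole_energy_le _ _)); rewrite ler_wpM2l// cell_energy_sub_pharm.
  by rewrite lerD2r cell_energy_le_limit.
have h1 : Qu <= (1 + eta) * Qv + (1 + eta^-1) * D by exact: hole_energy_perturb.
have h2 : Qv <= (1 + eta) * Qu + (1 + eta^-1) * D.
  by rewrite /D hole_energy_subC; exact: hole_energy_perturb.
have h3 : (1 + eta^-1) * D <= (1 + eta^-1) * (4 * (E - cell_energy k u)).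
  by rewrite ler_wpM2l// addr_ge0// invr_ge0 ltW.
have h4 : eta * Qv <= eta * (4 * E) by rewrite ler_wpM2l// ltW.
have h5 : eta * Qu <= eta * (4 * E) by rewrite ler_wpM2l// ltW.
have h6 : 0 <= hole_limit * (E - cell_energy k u) by rewrite mulr_ge0.
have h7 : 0 <= (1 + eta^-1) * (4 * (E - cell_energy k u)).
  by rewrite mulr_ge0 ?mulr_ge0// addr_ge0// invr_ge0 ltW.
rewrite /C /L in hk' hL *; move: hL; rewrite !ltr_norml => /andP[? ?].
set S := (1 + eta^-1) * (4 * _) in h3 h7; set S' := hole_limit * (E - _) in h6.
have e1 : S + S' < e / 4 by rewrite /S /S'; lra.
have e2 : hole_limit * E = hole_limit * cell_energy k u + S' by rewrite /S'; ring.
rewrite e2.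
by apply/andP; split; lra.
Qed.

Lemma energy_m_split m u : energy_m m u = cell_energy m u + hole_energy m u.
Proof. by rewrite energy_mE wsum_split. Qed.

Lemma energy_m_cvg u : bounded_energy u ->
  energy_m^~ u @ \oo --> (1 + hole_limit) * limit_energy u.
Proof.
move=> hu; rewrite (_ : energy_m^~ u = fun m => cell_energy m u + hole_energy m u); last first.
  by apply/funext => m; exact: energy_m_split.
by rewrite mulrDl mul1r; apply: cvgD; [exact: cell_energy_cvg|exact: hole_energy_cvg].
Qed.

Lemma energyE u : bounded_energy u -> energy u = ((1 + hole_limit) * limit_energy u)%:E.
Proof.
move=> hu; apply/cvg_lim => //; apply: cvg_EFin; first exact: nearW.
exact: energy_m_cvg.
Qed.

(** Unbounded cell energies, being monotone, drive the discrete energies to infinity, so that [limn]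
    is then a true limit. *)
Lemma energy_lty u : (energy u < +oo)%E <-> bounded_energy u.
Proof.
split=> [|/energyE ->]; last exact: ltry.
apply: contraPP => nb; suff -> : energy u = +oo%E by rewrite ltxx.
apply/cvg_lim => //; apply/cvgeryP/cvgryPge => A.
have [m hm] : exists m, A < cell_energy m u.
  apply: contrapT => /forallNP h; apply: nb; exists A => m.
  by rewrite leNgt; apply/negP; exact: h.
exists m => // n /= mn; rewrite energy_m_split.
have := cell_energy_nondecreasing u mn; have := hole_energy_ge0 n u; lra.
Qed.

Lemma FS0P u : FS0 u <-> {within @S0 R, continuous u} /\ bounded_energy u.
Proof. by split=> -[h1 /energy_lty h2]; split. Qed.

End EnergyLimit.

(** * The functional that defines energy measures *)

Section EnergyFunctional.
Context {R : realType}.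
Local Notation P := ('rV[R]_2).
Implicit Types (x y : P) (i j l : 'I_3) (m k : nat) (a b c : 'I_3 -> R) (u v phi : P -> R).

Lemma within_cvgD (A : set P) u v : {within A, continuous u} -> {within A, continuous v} ->
  {within A, continuous (u \+ v)}.
Proof. by move=> cu cv x; apply: (@cvgD _ _ _ (nbhs x)); [exact: cu|exact: cv]. Qed.

Lemma within_cvgM (A : set P) u v : {within A, continuous u} -> {within A, continuous v} ->
  {within A, continuous (u \* v)}.
Proof. by move=> cu cv x; apply: (@cvgM _ _ (nbhs x)); [exact: cu|exact: cv]. Qed.

Lemma within_bounded (A : set P) u : compact A -> {within A, continuous u} ->
  exists2 M : R, 0 <= M & forall x, A x -> `|u x| <= M.
Proof.
move=> cA cu; have /compact_bounded[M [_ hM]] := continuous_compact cu cA.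
exists (`|M| + 1); first by rewrite addr_ge0.
move=> x Ax; apply: (hM (`|M| + 1)); first by rewrite ltr_pwDr// ler_norm.
by exists x.
Qed.

Lemma bounded_energyD (s t : R) u v : bounded_energy u -> bounded_energy v ->
  bounded_energy (fun x => s * u x + t * v x).
Proof.
move=> [M hM] [N hN]; exists (2 * s ^+ 2 * M + 2 * t ^+ 2 * N) => m.
have h : cell_energy m (fun x => s * u x + t * v x) <=
    2 * s ^+ 2 * cell_energy m u + 2 * t ^+ 2 * cell_energy m v.
  rewrite /cell_energy -!wsumZ -wsumD; apply: ler_wsum => x y _ _; rewrite /sqd.
  set p := u x; set q := u y; set r := v x; set w := v y.
  by have := sqr_ge0 (s * (p - q) - t * (r - w)); rewrite !expr2; lra.
apply: (le_trans h).
by rewrite lerD// ler_wpM2l ?hM ?hN// mulr_ge0 ?sqr_ge0.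
Qed.

Lemma FS0_lin (s t : R) u v : FS0 u -> FS0 v -> FS0 (fun x => s * u x + t * v x).
Proof.
move=> /FS0P[cu bu] /FS0P[cv bv]; apply/FS0P; split; last exact: bounded_energyD.
have cst (z : R) : {within @S0 R, continuous (fun=> z)}.
  by apply: continuous_subspaceT; exact: cst_continuous.
exact: (@within_cvgD _ (fun x => s * u x) (fun x => t * v x)
  (@within_cvgM _ (fun=> s) u (cst s) cu) (@within_cvgM _ (fun=> t) v (cst t) cv)).
Qed.

Lemma FS0D u v : FS0 u -> FS0 v -> FS0 (u \+ v).
Proof.
move=> hu hv; have := FS0_lin 1 1 hu hv.
by rewrite (_ : (fun _ => _) = u \+ v)//; apply/funext => x /=; rewrite !mul1r.
Qed.

Lemma FS0B u v : FS0 u -> FS0 v -> FS0 (u \- v).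
Proof.
move=> hu hv; have := FS0_lin 1 (-1) hu hv.
by rewrite (_ : (fun _ => _) = u \- v)//; apply/funext => x /=; rewrite mul1r mulN1r.
Qed.

Lemma FS0M u v : FS0 u -> FS0 v -> FS0 (u \* v).
Proof.
move=> /FS0P[cu bu] /FS0P[cv bv]; apply/FS0P; split; first exact: within_cvgM.
have [M M0 hM] := within_bounded compact_S0 cu.
have [N N0 hN] := within_bounded compact_S0 cv.
have [E hE] := bu; have [F hF] := bv.
exists (2 * M ^+ 2 * F + 2 * N ^+ 2 * E) => m.
have h : cell_energy m (u \* v) <=
    2 * M ^+ 2 * cell_energy m v + 2 * N ^+ 2 * cell_energy m u.
  rewrite /cell_energy -!wsumZ -wsumD; apply: ler_wsum => x y /V0_S0 Sx /V0_S0 Sy.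
  rewrite /sqd /=; have hux : u x ^+ 2 <= M ^+ 2.
    by rewrite -[u x ^+ 2]real_normK ?num_real// lerXn2r ?nnegrE ?hM.
  have hvy : v y ^+ 2 <= N ^+ 2.
    by rewrite -[v y ^+ 2]real_normK ?num_real// lerXn2r ?nnegrE ?hN.
  have := ler_wpM2r (sqr_ge0 (v x - v y)) hux.
  have := ler_wpM2r (sqr_ge0 (u x - u y)) hvy.
  set p := u x; set q := u y; set r := v x; set w := v y.
  have := sqr_ge0 (p * (r - w) - w * (p - q)).
  by rewrite !expr2; lra.
by apply: (le_trans h); rewrite lerD// ler_wpM2l ?hE ?hF// mulr_ge0 ?sqr_ge0.
Qed.

Lemma energy_ext u v : (forall x, S0 x -> u x = v x) -> energy u = energy v.
Proof.
move=> h; congr (limn _); apply/funext => m; rewrite !energy_mE; congr EFin.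
by apply: eq_wsum => x y /V0_S0 Sx /V0_S0 Sy; rewrite /sqd !h.
Qed.

Lemma FS0_cst (c : R) : FS0 (fun=> c).
Proof.
apply/FS0P; split; first by apply: continuous_subspaceT; exact: cst_continuous.
exists 0 => m; rewrite /cell_energy (@eq_wsum _ _ _ _ _ (fun x y => 0 * 0)) ?wsumZ ?mul0r//.
by move=> x y _ _; rewrite /sqd subrr expr0n.
Qed.

Lemma FS0_pharm k u : FS0 (pharm k u).
Proof.
apply/FS0P; split; first exact: pharm_continuous.
exists (cell_energy k u) => m; rewrite -(cell_energy_pharm k m).
by apply: cell_energy_nondecreasing; exact: leq_addl.
Qed.

Lemma FS0_harm b : FS0 (harm b).
Proof.
apply/FS0P; split; first exact: harm_continuous.
by exists (energy0 b b) => m; rewrite cell_energy_harm.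
Qed.

Lemma FS0_Fmap j u : FS0 u -> FS0 (u \o Fmap j).
Proof.
move=> /FS0P[cu [M hM]]; apply/FS0P; split.
  apply/within_continuousP => x Sx e e0.
  have /within_continuousP/(_ _ (@S0_Fmap _ j x Sx) e e0)[d d0 hd] := cu.
  exists d => // y Sy xy /=; apply: hd; first exact: S0_Fmap.
  rewrite /Fmap -scalerBr opprD addrACA subrr addr0 normrZ ger0_norm//.
  by apply: le_lt_trans xy; rewrite ler_piMl//; lra.
exists (3 / 5 * M) => m; have := hM m.+1; rewrite cell_energyS.
rewrite (bigD1 j)//=; set S := \sum_(_ | _) _.
have : 0 <= S by apply: sumr_ge0 => i _; exact: cell_energy_ge0.
by lra.
Qed.

(** The contribution of one edge to E(phi u, u) - E(phi, u^2) / 2. It is nonnegative for a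
    nonnegative phi, so comparisons between functionals can be made edge by edge. *)
Definition edge_density phi u : P -> P -> R :=
  fun x y => 2^-1 * (phi x + phi y) * (u x - u y) ^+ 2.

Definition energy_functional u phi : R :=
  energy2 (phi \* u) u - energy2 phi (u \* u) / 2.

Lemma fine_energy_cvg u : FS0 u -> energy_m^~ u @ \oo --> fine (energy u).
Proof. by move=> /FS0P[_ hu]; rewrite energyE//=; exact: energy_m_cvg. Qed.

Lemma energy_functional_cvg u phi : FS0 u -> FS0 phi ->
  (fun m => wsum true true m (edge_density phi u)) @ \oo --> energy_functional u phi.
Proof.
move=> hu hp; have hpu := FS0M hp hu; have huu := FS0M hu hu.
rewrite (_ : (fun m => _) = fun m =>
   (energy_m m (phi \* u \+ u) - energy_m m (phi \* u \- u)) / 4 -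
   (energy_m m (phi \+ u \* u) - energy_m m (phi \- u \* u)) / 4 / 2).
  apply: cvgB.
    by apply: cvgMr_tmp; apply: cvgB; apply: fine_energy_cvg; [exact: FS0D|exact: FS0B].
  do 2!apply: cvgMr_tmp.
  by apply: cvgB; apply: fine_energy_cvg; [exact: FS0D|exact: FS0B].
apply/funext => m; rewrite !energy_mE.
set A := sqd _; set B := sqd _; set C := sqd _; set D := sqd _.
transitivity (wsum true true m (fun x y => 4^-1 * A x y + ((- 4^-1) * B x y
   + ((- 8^-1) * C x y + 8^-1 * D x y)))).
  by apply: eq_wsum => x y _ _; rewrite /edge_density /A /B /C /D /sqd /=; field.
by rewrite !wsumD !wsumZ; field.
Qed.

Lemma energy_functional_ext u v phi : (forall x, S0 x -> u x = v x) ->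
  energy_functional u phi = energy_functional v phi.
Proof.
move=> h; rewrite /energy_functional /energy2.
by do ![congr (_ - _)|congr (_ / _)|congr fine|apply: energy_ext => x Sx /=; rewrite ?h//].
Qed.

Lemma is_energy_measure_ext u v M : (forall x, S0 x -> u x = v x) ->
  is_energy_measure u M -> is_energy_measure v M.
Proof.
move=> h [M0 hM]; split=> // phi hphi; rewrite hM//; congr EFin.
exact: energy_functional_ext.
Qed.

Lemma energy_measure_ext u v : (forall x, S0 x -> u x = v x) ->
  energy_measure u = energy_measure v.
Proof.
move=> h; have e : is_energy_measure u = is_energy_measure v.
  apply/funext => M; apply/propext; split; apply: is_energy_measure_ext => //.
  by move=> x Sx; rewrite h.
by rewrite /energy_measure e.
Qed.

Lemma energy_functional_le u v phi psi : FS0 u -> FS0 v -> FS0 phi -> FS0 psi ->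
  (forall x y, S0 x -> S0 y -> edge_density phi u x y <= edge_density psi v x y) ->
  energy_functional u phi <= energy_functional v psi.
Proof.
move=> hu hv hp hq h.
apply: (ler_cvg_to (energy_functional_cvg hu hp) (energy_functional_cvg hv hq)).
apply: nearW => m; apply: ler_wsum => x y /V0_S0 Sx /V0_S0 Sy; exact: h.
Qed.

Lemma energy_functional1 u : FS0 u -> energy_functional u (fun=> 1) = fine (energy u).
Proof.
move=> hu; have h1 := energy_functional_cvg hu (FS0_cst 1).
apply: (cvg_unique _ h1) => //.
rewrite (_ : (fun m => _) = energy_m^~ u)//; first exact: fine_energy_cvg.
by apply/funext => m; rewrite energy_mE; apply: eq_wsum => x y _ _;
  rewrite /edge_density /sqd; field.
Qed.

Lemma edge_density_pullback j phi u :
  pullback (Fmap j) (edge_density phi u) = edge_density (phi \o Fmap j) (u \o Fmap j).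
Proof. by []. Qed.

(** Self-similarity holds only in the limit: the central hole adds a term at each level, bounded by
    the maximum of |phi| times the hole sum of a harmonic function, which decays geometrically. *)
Lemma energy_functional_Fmap b phi : FS0 phi -> energy_functional (harm b) phi =
  5 / 3 * \sum_j energy_functional (harm (extension_mx j b)) (phi \o Fmap j).
Proof.
move=> hp; have h1 := energy_functional_cvg (FS0_harm b) hp.
have hj j := energy_functional_cvg (FS0_harm (extension_mx j b)) (FS0_Fmap j hp).
rewrite -(cvg_shiftn 1) /= in h1.
apply: (cvg_unique _ h1) => //.
have /FS0P[cp _] := hp; have [M M0 hM] := within_bounded compact_S0 cp.
have hz : (fun m => holesum m (edge_density phi (harm b))) @ \oo --> 0.
  have c0 : (fun m => holesum m (sqd (harm b)) * M) @ \oo --> 0.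
    have c1 : (fun m => (3 / 5) ^+ m * (energy0 b b * M)) @ \oo --> 0.
      by apply: geom_cvg0; rewrite ger0_norm; lra.
    apply: (squeeze_cvgr _ (cvg_cst 0) c1); apply: nearW => m.
    apply/andP; split; first by rewrite mulr_ge0 ?holesum_ge0.
    rewrite holesum_harm -[leLHS]mulrA; apply: ler_wpM2r; first by rewrite mulr_ge0 ?energy0_ge0.
    by case/andP: (@hole_coeff_range R m).
  have c0' : (fun m => - (holesum m (sqd (harm b)) * M)) @ \oo --> 0.
    by rewrite -[X in _ --> X]oppr0; exact: cvgN.
  apply: (squeeze_cvgr _ c0' c0); apply: nearW => m; rewrite -ler_norml.
  rewrite /holesum; case: ifP => [_|]; last by rewrite mul0r normr0.
  rewrite normrM ger0_norm ?mulr_ge0 ?exprn_ge0// -[leRHS]mulrA.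
  apply: ler_wpM2l; first by rewrite mulr_ge0 ?exprn_ge0.
  apply: (le_trans (ler_norm_sum _ _ _)); rewrite mulr_suml; apply: ler_sum => t dt.
  rewrite /edge_density /sqd normrM [`|_ ^+ 2|]ger0_norm ?sqr_ge0// mulrC.
  have [V1 V2 _] := @edge_hole_pair R m t dt.
  have := hM _ (V0_S0 V1); have := hM _ (V0_S0 V2) => M2 M1.
  rewrite ler_wpM2l ?sqr_ge0// normrM ger0_norm//.
  by apply: (@le_trans _ _ (2^-1 * (M + M))); [rewrite ler_wpM2l// (le_trans (ler_normD _ _))// lerD|lra].
rewrite (_ : (fun n => _) = fun m => 5 / 3 * (\sum_j wsum true true m (edge_density (phi \o Fmap j)
    (harm (extension_mx j b)))) + holesum m (edge_density phi (harm b))).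
  rewrite /= -[5 / 3 * _ in X in _ --> X]addr0; apply: cvgD; last exact: hz.
  apply: cvgMl_tmp; under eq_fun do rewrite sum3; rewrite sum3.
  by apply: cvgD; [apply: cvgD|]; exact: hj.
apply/funext => m; rewrite addn1 wsumS; congr (_ * _ + _); apply: eq_bigr => j _.
apply: eq_wsum => x y /V0_S0 Sx /V0_S0 Sy.
by rewrite edge_density_pullback /edge_density /comp !harm_Fmap.
Qed.

Lemma energy_harm b : energy (harm b) = ((1 + hole_limit) * energy0 b b)%:E.
Proof.
rewrite energyE; last by have /FS0P[] := FS0_harm b.
congr (_ * _)%:E; apply/cvg_lim => //; rewrite (_ : cell_energy^~ _ = fun=> energy0 b b).
  exact: cvg_cst.
by apply/funext => m; exact: cell_energy_harm.
Qed.

Lemma edge_density0 phi u x y : phi x = 0 -> phi y = 0 -> edge_density phi u x y = 0.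
Proof. by rewrite /edge_density => -> ->; rewrite addr0 mulr0 mul0r. Qed.

Lemma energy_functional0 u phi : FS0 u -> FS0 phi -> (forall x, S0 x -> phi x = 0) ->
  energy_functional u phi = 0.
Proof.
move=> hu hp h; apply: (cvg_unique _ (energy_functional_cvg hu hp)) => //.
rewrite (_ : (fun m => _) = fun=> 0); first exact: cvg_cst.
apply/funext => m; transitivity (wsum true true m (fun x y => 0 * (u x - u y))).
  by apply: eq_wsum => x y /V0_S0 Sx /V0_S0 Sy; rewrite edge_density0 ?h// mul0r.
by rewrite wsumZ mul0r.
Qed.

Fixpoint words m : seq (seq 'I_3) :=
  if m is m'.+1 then [seq j :: s | j <- enum 'I_3, s <- words m'] else [:: [::]].

Definition Fseq (s : seq 'I_3) : P -> P := foldr (fun j f => Fmap j \o f) id s.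

(** The first letter is outermost in [Fseq] and is applied first here, so that this gives the
    boundary values of [harm b \o Fseq s]. *)
Definition ext_seq b (s : seq 'I_3) : 'I_3 -> R := foldl (fun b j => extension_mx j b) b s.

Lemma mem_words m s : (s \in words m) = (size s == m).
Proof.
elim: m s => [|m ih] s; first by rewrite inE size_eq0.
apply/allpairsP/eqP => [[[j s'] /= [_ + ->]]|].
  by rewrite ih => /eqP <-.
case: s => // j s [hs]; exists (j, s); split => //=; first by rewrite mem_enum.
by rewrite ih hs.
Qed.

Lemma sum_wordsS m (F : seq 'I_3 -> R) :
  \sum_(s <- words m.+1) F s = \sum_j \sum_(s <- words m) F (j :: s).
Proof. by rewrite /= big_allpairs_dep big_enum. Qed.

(** Subdivision down to level m: the cells rejected by A contribute 0, and on the others phi is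
    replaced by 1, which leaves the energy of a harmonic function on each cell. *)
Lemma energy_functional_words m b phi (A : pred (seq 'I_3)) : FS0 phi ->
  (forall x, S0 x -> phi x <= 1) ->
  (forall s, size s = m -> ~~ A s -> forall x, S0 x -> phi (Fseq s x) = 0) ->
  energy_functional (harm b) phi <= (1 + hole_limit) * (5 / 3) ^+ m *
    \sum_(s <- words m | A s) energy0 (ext_seq b s) (ext_seq b s).
Proof.
elim: m b phi A => [|m ih] b phi A hp h1 h0.
  rewrite /= big_cons big_nil expr0 mulr1; case: ifP => hA; last first.
    rewrite mulr0 energy_functional0//; first exact: FS0_harm.
    by move=> x Sx; apply: (h0 [::]) => //; rewrite hA.
  rewrite addr0 /= -[leRHS]/(fine _%:E) -energy_harm -energy_functional1; last exact: FS0_harm.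
  apply: energy_functional_le => //; [exact: FS0_harm|exact: FS0_harm|exact: FS0_cst|].
  move=> x y Sx Sy; rewrite /edge_density ler_wpM2r ?sqr_ge0//.
  by have := h1 x Sx; have := h1 y Sy; lra.
rewrite energy_functional_Fmap// [X in _ <= _ * X]big_mkcond sum_wordsS exprS.
rewrite [leRHS](_ : _ = 5 / 3 * \sum_j ((1 + hole_limit) * (5 / 3) ^+ m *
    \sum_(s <- words m | A (j :: s)) energy0 (ext_seq b (j :: s)) (ext_seq b (j :: s)))).
  rewrite ler_wpM2l//; apply: ler_sum => j _.
  apply: (ih (extension_mx j b) (phi \o Fmap j) (fun s => A (j :: s))).
  - exact: FS0_Fmap.
  - by move=> x Sx; apply: h1; exact: S0_Fmap.
  - by move=> s hs As x Sx; apply: (h0 (j :: s)) => //=; rewrite hs.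
rewrite -mulr_sumr; under [in RHS]eq_bigr do rewrite big_mkcond.
by set S := \sum_j _; ring.
Qed.

End EnergyFunctional.

(** * Comparison of measures by cutoff functions *)

Section IntegralMonotone.
Local Open Scope ereal_scope.

(** The integral of a nonnegative function is a supremum over the simple functions below it, so
    monotonicity covers functions not known to be measurable, such as the inner integrals of
    gradients. *)
Lemma le_integral_ge0 d (T : measurableType d) (R : realType)
  (mu : {measure set T -> \bar R}) (D : set T) (f g : T -> \bar R) :
  (forall x, D x -> 0 <= f x) -> (forall x, D x -> f x <= g x) ->
  \int[mu]_(x in D) f x <= \int[mu]_(x in D) g x.
Proof.
move=> f0 fg; rewrite !ge0_integralE//; last first.
  by move=> x Dx; exact: le_trans (f0 x Dx) (fg x Dx).
apply: le_ereal_sup => _ [h /= hf <-]; exists h => //= x.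
apply: (le_trans (hf x)); rewrite /patch; case: ifPn => //; rewrite inE => Dx.
exact: fg.
Qed.

End IntegralMonotone.

Section BorelPlane.
Context {R : realType}.
Local Notation P := ('rV[R]_2).
Local Notation BP := (borel P).
Implicit Types (x y : P) (A K F U : set BP) (m : {measure set BP -> \bar R}).

Lemma open_borel (V : ptopologicalType) (A : set (borel V)) :
  open (A : set V) -> measurable A.
Proof. exact: sub_sigma_algebra. Qed.

Lemma closed_borel (V : ptopologicalType) (A : set (borel V)) :
  closed (A : set V) -> measurable A.
Proof.
by move=> cA; rewrite -[A]setCK; apply: measurableC; apply: open_borel; exact: closed_openC.
Qed.

Lemma measurable_S0 : measurable (@S0 R : set BP).
Proof. by apply: closed_borel; exact: closed_S0. Qed.

Lemma within_continuous_measurable (D : set BP) (u : P -> R) :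
  measurable D -> {within (D : set P), continuous u} ->
  measurable_fun D (u : BP -> R).
Proof.
move=> mD /continuousP cu; apply: (measurability _ (RGenOpens.measurableE R)).
move=> _ [_ [a [b ->] <-]].
have oU : open (from_subspace (D : set P) u @^-1` `]a, b[%classic).
  by apply: cu; exact: interval_open.
have [V oV VD] := proj1 (open_subspaceP (D : set P) _) oU.
have : measurable ((V : set BP) `&` D) by apply: measurableI => //; exact: open_borel.
by rewrite VD setIC.
Qed.

Definition thicken K (d : R) : set BP := [set x : BP | exists2 z, K z & ball (z : P) d x].

Lemma open_thicken K d : 0 < d -> open (thicken K d : set P).
Proof.
move=> d0; rewrite (_ : thicken K d = \bigcup_(z in K) (ball (z : P) d)); last first.
  by apply/seteqP; split=> x [z Kz zx]; exists z.
by apply: bigcup_open => z _; exact: ball_open.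
Qed.

Lemma measurable_thicken K d : 0 < d -> measurable (thicken K d).
Proof. by move=> d0; apply: open_borel; exact: open_thicken. Qed.

Lemma sub_thicken K d : 0 < d -> K `<=` thicken K d.
Proof. by move=> d0 x Kx; exists x => //; exact: ballxx. Qed.

Lemma bigcap_thicken K : closed (K : set P) ->
  \bigcap_k thicken K k.+1%:R^-1 = K.
Proof.
move=> cK; apply/seteqP; split=> [x hx|x Kx k _]; last exact: sub_thicken.
apply: cK => B /nbhs_ballP[e /= e0 eB].
have [k ke] : exists k, k.+1%:R^-1 < e.
  exists (Num.truncn e^-1).
  rewrite invf_plt ?posrE//.
  exact: Num.Theory.truncnS_gt.
have [z Kz zx] := hx k I.
by exists z; split=> //; apply: eB; apply: ball_sym; apply: le_ball zx; exact: ltW.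
Qed.

Lemma thicken_cvg (m : {finite_measure set BP -> \bar R}) K : closed (K : set P) ->
  m \o (fun k => thicken K k.+1%:R^-1) @ \oo --> m K.
Proof.
move=> cK; rewrite -[X in _ --> m X](bigcap_thicken cK); apply: nonincreasing_cvg_mu.
- by rewrite ltey_eq fin_num_measure//; exact: measurable_thicken.
- by move=> k; exact: measurable_thicken.
- by rewrite bigcap_thicken//; exact: closed_borel.
- apply/nonincreasing_seqP => k; apply/subsetPset => x [z Kz zx]; exists z => //.
  by apply: le_ball zx; rewrite lef_pV2 ?posrE// ler_nat.
Qed.

Lemma thicken_le (m : {finite_measure set BP -> \bar R}) K (e : R) : closed (K : set P) ->
  0 < e -> exists2 d, 0 < d & (m (thicken K d) <= m K + e%:E)%E.
Proof.
move=> cK e0; have mK : m K \is a fin_num by apply: fin_num_measure; exact: closed_borel.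
have h : (m K < m K + e%:E)%E by rewrite lteDl// lte_fin.
have := @thicken_cvg m K cK => /(_ [set t | (t < m K + e%:E)%E]).
move=> /(_ (open_ereal_lt' h)) [N _ /(_ N (leqnn N)) /= hN].
by exists N.+1%:R^-1 => //; exact: ltW.
Qed.

(** The sets with this approximation property form a sigma-algebra. It contains the open sets
    because a closed set is the intersection of its thickenings, whose measures converge. *)
Lemma measurable_regular (m : {finite_measure set BP -> \bar R}) A : measurable A ->
  forall e : R, 0 < e -> exists F U, [/\ closed (F : set P), open (U : set P),
    F `<=` A, A `<=` U & (m (U `\` F) <= e%:E)%E].
Proof.
pose G := [set A : set BP | forall e : R, 0 < e -> exists F U,
  [/\ closed (F : set P), open (U : set P), F `<=` A, A `<=` U & (m (U `\` F) <= e%:E)%E]].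
suff : @measurable _ BP `<=` G by move=> h /h.
apply: smallest_sub; last first.
  move=> U oU e e0.
  have cU : closed (~` U : set P) by exact: open_closedC.
  have [d d0 hd] := thicken_le m cU e0.
  exists (~` thicken (~` U) d), U; split => //.
  - by apply: open_closedC; exact: open_thicken.
  - by move=> x nx; apply: contrapT => nUx; apply: nx; exact: sub_thicken.
  have mC : measurable (~` U : set BP) by exact: closed_borel.
  have mT := measurable_thicken (~` U) d0.
  have -> : U `\` ~` thicken (~` U) d = thicken (~` U) d `\` (~` U).
    by rewrite setDE setCK setDE setCK setIC.
  rewrite measureD//; last by rewrite ltey_eq fin_num_measure.
  rewrite (setIidr (sub_thicken (K := ~` U) d0)).
  by rewrite leeBlDl// fin_num_measure.
split.
- move=> e e0; exists set0, set0; split; [exact: closed0|exact: open0|by []|by []|].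
  by rewrite setD0 measure0 lee_fin ltW.
- move=> B GB e e0; have [F [U [cF oU FB BU mUF]]] := GB e e0.
  rewrite setTD; exists (~` U), (~` F); split.
  + exact: open_closedC.
  + exact: closed_openC.
  + exact: subsetC.
  + exact: subsetC.
  + by rewrite setDE setCK setIC -setDE.
- move=> B GB e e0.
  have h n : exists FU : set BP * set BP, [/\ closed (FU.1 : set P), open (FU.2 : set P),
      FU.1 `<=` B n, B n `<=` FU.2 & (m (FU.2 `\` FU.1) <= (e / 2 / (2 ^ n.+1)%:R)%:E)%E].
    have e2 : 0 < e / 2 / (2 ^ n.+1)%:R by rewrite !divr_gt0// ltr0n expn_gt0.
    by have [F [U h]] := GB n _ e2; exists (F, U).
  have [FU hFU] := choice h.
  pose U := \bigcup_n (FU n).2; pose FN N := \bigcup_(n < N) (FU n).1.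
  have mU : measurable U.
    by apply: bigcupT_measurable => n; apply: open_borel; case: (hFU n).
  have mF n : measurable (FU n).1 by apply: closed_borel; case: (hFU n).
  have mU' n : measurable (FU n).2 by apply: open_borel; case: (hFU n).
  have mFN N : measurable (FN N) by exact: bigcup_measurable.
  have mUF : (m (U `\` \bigcup_n (FU n).1) <= (e / 2)%:E)%E.
    have e20 : 0 <= e / 2 by rewrite divr_ge0// ltW.
    apply: (le_trans _ (epsilon_trick0 xpredT e20)).
    apply: (@le_trans _ _ (\sum_(n <oo) m ((FU n).2 `\` (FU n).1))%E).
      apply: measure_sigma_subadditive.
      - by move=> n; apply: measurableD.
      - by apply: measurableD => //; exact: bigcupT_measurable.
      - move=> x [[n _ Ux] nF]; exists n => //; split=> // Fx; apply: nF; by exists n.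
    by apply: lee_nneseries => // n _; case: (hFU n).
  (* The countable union of the closed sets need not be closed; it is cut off at a finite N, which
     costs the second half of e. *)
  have cv : m \o (fun N => U `\` FN N) @ \oo --> m (U `\` \bigcup_n (FU n).1).
    have eq1 : \bigcap_N (U `\` FN N) = U `\` \bigcup_n (FU n).1.
      apply/seteqP; split=> x.
        move=> hx; split; first by case: (hx 0%N I).
        move=> [n _ Fx]; case: (hx n.+1 I) => _; apply; exists n => //=.
      move=> [Ux nF] N _; split=> // -[n nN Fx]; apply: nF; by exists n.
    rewrite -eq1; apply: nonincreasing_cvg_mu.
    - by rewrite ltey_eq fin_num_measure//; apply: measurableD.
    - by move=> N; apply: measurableD.
    - by rewrite eq1; apply: measurableD => //; exact: bigcupT_measurable.
    - apply/nonincreasing_seqP => N; apply/subsetPset; apply: setDS.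
      by move=> x [n nN Fx]; exists n => //=; apply: leq_trans nN _.
  have lt1 : (m (U `\` \bigcup_n (FU n).1) < e%:E)%E.
    by apply: (le_lt_trans mUF); rewrite lte_fin; lra.
  have [N _ /(_ N (leqnn N)) /= hN] := cv [set t | (t < e%:E)%E] (open_ereal_lt' lt1).
  exists (FN N), U; split.
  + apply: closed_bigcup; first exact: finite_II.
    by move=> n _; case: (hFU n).
  + by apply: bigcup_open => n _; case: (hFU n).
  + by move=> x [n _ Fx]; exists n => //; case: (hFU n) => _ _ + _ _; apply.
  + by move=> x [n _ Bx]; exists n => //; case: (hFU n) => _ _ _ + _; apply.
  + exact: ltW.
Qed.

(** Only m1 is approximated, from inside by closed sets; m2 may be infinite. *)
Lemma le_measure_closed (m1 : {finite_measure set BP -> \bar R})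
    (m2 : {measure set BP -> \bar R}) (D : set BP) :
  measurable D ->
  (forall K, closed (K : set P) -> K `<=` D -> (m1 K <= m2 K)%E) ->
  forall A, measurable A -> A `<=` D -> (m1 A <= m2 A)%E.
Proof.
move=> mD h A mA AD; apply/lee_addgt0Pr => e e0.
have [F [U [cF oU FA AU hUF]]] := measurable_regular m1 mA e0.
have mF : measurable F by exact: closed_borel.
have mU : measurable U by exact: open_borel.
have -> : A = F `|` (A `\` F) by rewrite setDUK.
apply: (le_trans (measureU2 _ _ _)) => //; first exact: measurableD.
apply: leeD.
  apply: (le_trans (h F cF (subset_trans FA AD))); apply: le_measure; rewrite ?inE//.
  by apply: measurableU => //; exact: measurableD.
apply: le_trans hUF; apply: le_measure; rewrite ?inE; try exact: measurableD.
exact: setSD.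
Qed.

End BorelPlane.

Section Tents.
Context {R : realType}.
Local Notation P := ('rV[R]_2).
Local Notation BP := (borel P).
Implicit Types (x y : P) (i j l : 'I_3) (m : nat) (b : 'I_3 -> R) (u phi : P -> R) (s : seq 'I_3).

Lemma S0_Fseq s x : S0 x -> S0 (Fseq s x).
Proof. by move=> Sx; elim: s => [//|j s ih] /=; exact: S0_Fmap. Qed.

Lemma S0_cover_words m x : S0 x -> exists s, size s = m /\ exists y, S0 y /\ x = Fseq s y.
Proof.
elim: m x => [|m ih] x Sx; first by exists [::]; split=> //; exists x.
have [j [y [Sy ->]]] := S0_cover Sx; have [s [hs [z [Sz ->]]]] := ih y Sy.
by exists (j :: s); split; [rewrite /= hs|exists z].
Qed.

Lemma norm_Fseq s x y : `|Fseq s x - Fseq s y| = 2 ^- size s * `|x - y|.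
Proof.
elim: s => [|j s ih] /=; first by rewrite expr0 invr1 mul1r.
rewrite /Fmap -scalerBr opprD addrACA subrr addr0 normrZ ih ger0_norm//.
by rewrite exprS invfM mulrA.
Qed.

Lemma S0_diameter : exists2 D : R, 0 < D & forall x y, S0 x -> S0 y -> `|x - y| <= D.
Proof.
have /compact_bounded[M [_ hM]] := @compact_S0 R.
have h x : S0 x -> `|x| <= `|M| + 1 by apply: hM; rewrite ltr_pwDr// ler_norm.
exists (2 * (`|M| + 1)); first by rewrite mulr_gt0// ltr_wpDl.
move=> x y Sx Sy; rewrite (le_trans (ler_normB _ _))//.
by have := h x Sx; have := h y Sy; lra.
Qed.

Lemma pharm_Fseq s (g : P -> R) x : S0 x ->
  pharm (size s) g (Fseq s x) = harm (g \o Fseq s \o corner) x.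
Proof.
elim: s g => [//|j s ih] g Sx.
by rewrite [size _]/= [Fseq _ _]/= pharm_Fmap ?ih//; exact: S0_Fseq.
Qed.

Lemma harm_cst (c : R) b x : S0 x -> (forall k, b k = c) -> harm b x = c.
Proof.
move=> Sx hb; have := harm_range Sx (lo := c) (hi := c).
move=> /(_ b) h; apply/eqP; rewrite eq_sym eq_le; apply: h => k; by rewrite hb lexx.
Qed.

Lemma pow2V_lt (e : R) : 0 < e -> exists m, 2 ^- m < e.
Proof.
move=> e0; have := @cvg_expr R 2^-1; rewrite ger0_norm// => /(_ _)/cvgrPdist_lt.
rewrite invf_lt1// ltr1n => /(_ isT e e0)[m _ /(_ m (leqnn m))].
by rewrite sub0r normrN exprVn ger0_norm ?invr_ge0 ?exprn_ge0// => h; exists m.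
Qed.

(* A piecewise harmonic cutoff of a set K: it is 1 at the vertices of the cells
   of level m meeting K, and 0 at the other vertices of level m. *)
Lemma tent_exists (K : set P) (d : R) : 0 < d -> exists m phi (A : pred (seq 'I_3)),
  [/\ FS0 phi, forall x, S0 x -> 0 <= phi x <= 1,
      forall s y, size s = m -> S0 y -> K (Fseq s y) -> A s,
      forall x, S0 x -> K x -> phi x = 1 &
      (forall s, size s = m -> ~~ A s -> forall x, S0 x -> phi (Fseq s x) = 0) /\
      (forall s, size s = m -> A s -> forall x, S0 x -> thicken K d (Fseq s x))].
Proof.
move=> d0; have [D D0 hD] := S0_diameter.
(* A cell where the cutoff does not vanish shares a vertex with a cell meeting K, so two cell
   diameters have to fit into d. *)
have [m hm] : exists m, 2 ^- m < d / (2 * D) by apply: pow2V_lt; rewrite divr_gt0// mulr_gt0.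
have {}hm : 2 ^- m * D * 2 < d by rewrite ltr_pdivlMr in hm; [lra|rewrite mulr_gt0].
pose g x : R := if `[< exists s, [/\ size s = m, exists i, x = Fseq s (corner i) &
   exists y, S0 y /\ K (Fseq s y)] >] then 1 else 0.
pose A s := `[< exists i, g (Fseq s (corner i)) != 0 >].
have g01 x : 0 <= g x <= 1 by rewrite /g; case: ifP => _; rewrite ?lexx ?ler01.
have gK s y i : size s = m -> S0 y -> K (Fseq s y) -> g (Fseq s (corner i)) = 1.
  move=> hs Sy Ky; rewrite /g asboolT//; exists s; split=> //; first by exists i.
  by exists y.
exists m, (pharm m g), A; split.
- exact: FS0_pharm.
- by move=> x Sx; apply: pharm_range.
- move=> s y hs Sy Ky; apply/asboolP; exists ord0.
  by rewrite (gK s y)// oner_eq0.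
- move=> x Sx Kx; have [s [hs [y [Sy exy]]]] := S0_cover_words m Sx.
  rewrite exy -hs pharm_Fseq//; apply: harm_cst => // k /=.
  by apply: gK hs Sy _; rewrite -exy.
split=> s hs; first move=> /asboolPn nA x Sx.
  rewrite -hs pharm_Fseq//; apply: harm_cst => // k /=.
  by apply: contrapT => /eqP h; apply: nA; exists k.
move=> /asboolP[i]; rewrite {1}/g; case: ifPn; last by rewrite eqxx.
move=> /asboolP[s' [hs' [i' e] [y [Sy Ky]]]] _ x Sx.
exists (Fseq s' y) => //; rewrite -ball_normE /=.
have -> : Fseq s' y - Fseq s x = (Fseq s' y - Fseq s' (corner i')) +
    (Fseq s (corner i) - Fseq s x) by rewrite e addrA subrK.
apply: (le_lt_trans (ler_normD _ _)); rewrite !norm_Fseq hs hs'.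
have u0 : 0 <= (2 : R) ^- m by rewrite invr_ge0 exprn_ge0.
have h1 := ler_wpM2l u0 (hD _ _ Sy (@S0_corner R i')).
have h2 := ler_wpM2l u0 (hD _ _ (@S0_corner R i) Sx).
by lra.
Qed.

Lemma measurable_FS0 phi : FS0 phi -> measurable_fun (@S0 R : set BP) (EFin \o phi : BP -> \bar R).
Proof.
move=> [cp _]; apply/measurable_EFinP; apply: within_continuous_measurable cp.
exact: measurable_S0.
Qed.

(** A cutoff of a closed set K lies between the indicators of K and of a thickening whose m2-measure
    is close to that of K. *)
Lemma le_measure_functional (m1 m2 : {finite_measure set BP -> \bar R}) :
  (forall phi, FS0 phi -> (forall x, S0 x -> 0 <= phi x) ->
    (\int[m1]_(x in (@S0 R : set BP)) (phi x)%:E <=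
     \int[m2]_(x in (@S0 R : set BP)) (phi x)%:E)%E) ->
  forall A : set BP, measurable A -> A `<=` (@S0 R : set BP) -> (m1 A <= m2 A)%E.
Proof.
move=> h; apply: le_measure_closed => [|K cK KS]; first exact: measurable_S0.
apply/lee_addgt0Pr => e e0.
have [d d0 hd] := thicken_le m2 cK e0.
have [m [phi [A [Fphi phi01 _ phi1 [phi0 hA]]]]] := tent_exists K d0.
have phi_ge0 x : S0 x -> 0 <= phi x by move=> /phi01/andP[].
have mS0 := @measurable_S0 R.
have mK : measurable (K : set BP) by exact: closed_borel.
apply: (@le_trans _ _ (\int[m1]_(x in (@S0 R : set BP)) (phi x)%:E)%E).
  rewrite -{1}(setIidl KS) -integral_indic//; apply: le_integral_ge0 => x Sx.
    by rewrite lee_fin.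
  rewrite lee_fin indicE; case: (boolP (x \in K)) => [|_]; last exact: phi_ge0.
  by rewrite inE => Kx; rewrite phi1.
apply: (le_trans (h phi Fphi phi_ge0)); apply: le_trans hd.
have mT := measurable_thicken (K : set BP) d0.
apply: (@le_trans _ _ (m2 (thicken K d `&` (@S0 R : set BP)))); last first.
  by apply: le_measure; rewrite ?inE//; exact: measurableI.
rewrite -integral_indic//; apply: le_integral_ge0 => x Sx.
  by rewrite lee_fin phi_ge0.
rewrite lee_fin indicE; have [s [hs [y [Sy exy]]]] := S0_cover_words m Sx.
have [As|nAs] := boolP (A s).
  rewrite mem_set; first by case/andP: (phi01 x Sx).
  by rewrite exy; exact: hA.
by rewrite exy (phi0 s hs nAs y Sy).
Qed.

End Tents.

(** * Kusuoka measure of the cells *)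

Section KusuokaMass.
Context {R : realType}.
Local Notation P := ('rV[R]_2).
Local Notation BP := (borel P).
Implicit Types (x y : P) (j k l : 'I_3) (m : nat) (b c : 'I_3 -> R) (s : seq 'I_3).

Definition unit_bdry l : 'I_3 -> R := fun k => (k == l)%:R.

(** The mean energy, over the three basis functions, of the restriction to the cell. In this form
    the domination of harmonic energies is a statement about quadratic forms; [cell_massE] recovers
    the trace formula. *)
Definition cell_mass s : R := 3^-1 * (5 / 3) ^+ size s *
  \sum_l energy0 (ext_seq (unit_bdry l) s) (ext_seq (unit_bdry l) s).

Lemma Fseq_rcons s j : Fseq (rcons s j) = Fseq s \o Fmap j :> (P -> P).
Proof. by elim: s => [//|i s ih]; apply/funext => x /=; rewrite ih. Qed.

Lemma eq_Fword (w w' : nat -> 'I_3) m : (forall n : nat, (n < m)%N -> w n = w' n) ->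
  Fword w m = Fword w' m :> (P -> P).
Proof.
elim: m => [//|m ih] h.
transitivity (Fword w m \o Fmap (w m) : P -> P); first by [].
rewrite (h m (ltnSn m)) ih// => k km; apply: h; exact: ltnW.
Qed.

Lemma eq_Yword (w w' : nat -> 'I_3) m : (forall n : nat, (n < m)%N -> w n = w' n) ->
  Yword w m = Yword w' m :> 'M[R]_3.
Proof.
elim: m => [//|m ih] h; transitivity (Ymx (w m) *m Yword w m : 'M[R]_3); first by [].
rewrite (h m (ltnSn m)) ih// => k km; apply: h; exact: ltnW.
Qed.

Lemma nth_rcons_lt s j (k : nat) : (k < size s)%N -> nth ord0 (rcons s j) k = nth ord0 s k.
Proof. by move=> ks; rewrite nth_rcons ks. Qed.

Lemma Fword_nth s : Fword (nth ord0 s) (size s) = Fseq s :> (P -> P).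
Proof.
elim/last_ind: s => [//|s j ih].
rewrite size_rcons /= Fseq_rcons -ih nth_rcons ltnn eqxx; congr (_ \o _).
by apply: eq_Fword => k; exact: nth_rcons_lt.
Qed.

Definition Yseq s : 'M[R]_3 := foldl (fun A j => Ymx j *m A) 1%:M s.

Lemma Yseq_rcons s j : Yseq (rcons s j) = Ymx j *m Yseq s.
Proof. by rewrite /Yseq foldl_rcons. Qed.

Lemma Yword_nth s : Yword (nth ord0 s) (size s) = Yseq s.
Proof.
elim/last_ind: s => [//|s j ih].
rewrite size_rcons /= Yseq_rcons -ih nth_rcons ltnn eqxx; congr (_ *m _).
by apply: eq_Yword => k; exact: nth_rcons_lt.
Qed.

(** The extension rule differs from the matrix Y_j by a term that is the same at all three corners.
    Energies do not see constants, so products of the Y_j compute the energies on all cells. *)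
Lemma extension_mxE j b k :
  extension_mx j b k = \sum_i Ymx j k i * b i + (2 * b j + \sum_i b i) / 5.
Proof.
rewrite /extension_mx.
have [kj|kj] := eqVneq k j.
  have [i /existsP[l /and3P[ij jl il]]] : exists i, [exists l, [&& i != j, j != l & i != l]].
    apply/existsP; case: j {kj} => [[|[|[|//]]] hj].
    - by apply/existsP; exists (@Ordinal 3 1 isT); apply/existsP; exists (@Ordinal 3 2 isT).
    - by apply/existsP; exists (@Ordinal 3 0 isT); apply/existsP; exists (@Ordinal 3 2 isT).
    - by apply/existsP; exists (@Ordinal 3 0 isT); apply/existsP; exists (@Ordinal 3 1 isT).
  rewrite !(sum3_distinct _ ij jl il) !mxE kj !eqxx.
  rewrite [j == i]eq_sym (negbTE ij) (negbTE jl) /=; by field.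
have [l /andP[jl kl]] := ord3_third kj.
rewrite !(sum3_distinct _ kj jl kl) !mxE !eqxx (negbTE kj) (negbTE kl).
by rewrite [l == j]eq_sym (negbTE jl) /=; field.
Qed.

Lemma ext_seq_Yseq s l : exists g : R, forall k,
  ext_seq (unit_bdry l) s k = Yseq s k l + g.
Proof.
elim/last_ind: s => [|s j [g hg]].
  by exists 0 => k; rewrite /ext_seq /= /Yseq /= mxE addr0.
have hY k : \sum_i Ymx j k i = 0 :> R.
  have := extension_mxE j (fun=> 1) k; under eq_bigr do rewrite mulr1.
  rewrite /extension_mx sumr_const card_ord; case: ifP => _.
    set S := \sum_i _; lra.
  by set S := \sum_i _; lra.
exists ((2 * ext_seq (unit_bdry l) s j + \sum_i ext_seq (unit_bdry l) s i) / 5) => k.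
rewrite Yseq_rcons /ext_seq foldl_rcons -/(ext_seq _ s) extension_mxE; congr (_ + _).
rewrite mxE; under eq_bigr do rewrite hg mulrDr.
by rewrite big_split /= -mulr_suml hY mul0r addr0.
Qed.

Lemma Yseq_colsum s j l : \sum_k Yseq (rcons s j) k l = 0.
Proof.
rewrite Yseq_rcons; under eq_bigr do rewrite mxE.
rewrite exchange_big /= big1// => i _; rewrite -mulr_suml.
suff -> : \sum_k Ymx j k i = 0 :> R by rewrite mul0r.
rewrite (_ : \sum_k Ymx j k i = \sum_k Ymx j i k); last first.
  apply: eq_bigr => k _; rewrite !mxE eq_sym orbC.
  by case: eqVneq => // ->.
have := extension_mxE j (fun=> 1) i; under eq_bigr do rewrite mulr1.
rewrite /extension_mx sumr_const card_ord; case: ifP => _; set S := \sum_i _; lra.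
Qed.

Lemma energy0_shift c (g : R) : energy0 (fun k => c k + g) (fun k => c k + g) =
  2^-1 * (3 * \sum_k c k ^+ 2 - (\sum_k c k) ^+ 2).
Proof. by rewrite energy0E !sum3; ring. Qed.

(** For a nonempty word the columns of the product sum to 0, so the energy of a column is 3/2 times
    its sum of squares, and 1/3 turns this into the factor 1/2 of the trace formula. The empty word
    is covered by the mass 1 of a unit cell. *)
Lemma cell_massE s j : cell_mass (rcons s j) =
  2^-1 * (5 / 3) ^+ size (rcons s j) * \tr ((Yseq (rcons s j))^T *m Yseq (rcons s j)).
Proof.
rewrite /cell_mass /mxtrace !mulr_sumr; apply: eq_bigr => l _.
have [g hg] := ext_seq_Yseq (rcons s j) l.
rewrite (_ : ext_seq _ _ = fun k => Yseq (rcons s j) k l + g); last exact/funext.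
rewrite energy0_shift Yseq_colsum expr0n subr0 mxE.
under [in RHS]eq_bigr do rewrite mxE -expr2.
by set S := \sum_k _; field.
Qed.

Lemma energy0_unit l : energy0 (unit_bdry l) (unit_bdry l) = 1.
Proof.
rewrite energy0E /unit_bdry.
have n01 : (ord0 : 'I_3) != inord 1 by rewrite -val_eqE /= inordK.
have n02 : (ord0 : 'I_3) != inord 2 by rewrite -val_eqE /= inordK.
have n12 : (inord 1 : 'I_3) != inord 2 by rewrite -val_eqE /= !inordK.
have := ord3_cases l n01 n12 n02 => /or3P[] /eqP ->.
- by rewrite eqxx ![inord _ == ord0]eq_sym (negbTE n01) (negbTE n02) /=; field.
- by rewrite eqxx [inord 2 == inord 1]eq_sym (negbTE n01) (negbTE n12) /=; field.
- by rewrite eqxx (negbTE n02) (negbTE n12) /=; field.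
Qed.

Lemma sum_words_energy0 m b : (5 / 3) ^+ m *
  \sum_(s <- words m) energy0 (ext_seq b s) (ext_seq b s) = energy0 b b.
Proof.
elim: m b => [|m ih] b; first by rewrite /= big_cons big_nil expr0 mul1r addr0.
rewrite sum_wordsS exprS -mulrA mulr_sumr -(energy0_extension b); congr (_ * _).
by apply: eq_bigr => j _; rewrite -ih.
Qed.

Lemma sum_cell_mass m : \sum_(s <- words m) cell_mass s = 1.
Proof.
rewrite big_seq (eq_bigr (fun s => 3^-1 * ((5 / 3) ^+ m *
  \sum_l energy0 (ext_seq (unit_bdry l) s) (ext_seq (unit_bdry l) s)))); last first.
  by move=> s; rewrite mem_words => /eqP <-; rewrite /cell_mass mulrA.
rewrite -big_seq -mulr_sumr -mulr_sumr exchange_big /= mulr_sumr.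
under eq_bigr do rewrite sum_words_energy0 energy0_unit.
by rewrite sumr_const card_ord; field.
Qed.

Lemma ext_seqD s b c (p q : R) : ext_seq (fun k => p * b k + q * c k) s =
  fun k => p * ext_seq b s k + q * ext_seq c s k.
Proof. by elim: s b c => [//|j s ih] b c /=; rewrite extension_mxD ih. Qed.

(** The nested form with a coefficient 1 lets the two-term linearity lemmas apply twice. *)
Lemma bdry_decomp b : b = fun k => b ord0 * unit_bdry ord0 k +
  1 * (fun k => b (inord 1) * unit_bdry (inord 1) k + b (inord 2) * unit_bdry (inord 2) k) k.
Proof.
apply/funext => k; rewrite mul1r /unit_bdry.
have n01 : (ord0 : 'I_3) != inord 1 by rewrite -val_eqE /= inordK.
have n02 : (ord0 : 'I_3) != inord 2 by rewrite -val_eqE /= inordK.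
have n12 : (inord 1 : 'I_3) != inord 2 by rewrite -val_eqE /= !inordK.
have := ord3_cases k n01 n12 n02 => /or3P[] /eqP ->.
- by rewrite eqxx (negbTE n01) (negbTE n02) /=; ring.
- by rewrite eqxx [_ == ord0]eq_sym (negbTE n01) (negbTE n12) /=; ring.
- rewrite eqxx [_ == ord0]eq_sym [_ == inord 1]eq_sym (negbTE n02) (negbTE n12) /=; ring.
Qed.

(** The 9 is 3 from the square of a sum of three terms, times 3 from the mean in [cell_mass]. *)
Lemma energy0_ext_le s b (B : R) : (forall k, b k ^+ 2 <= B) ->
  (5 / 3) ^+ size s * energy0 (ext_seq b s) (ext_seq b s) <= 9 * B * cell_mass s.
Proof.
move=> hb; rewrite {1}(bdry_decomp b) {1}[in X in energy0 _ X](bdry_decomp b).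
rewrite !ext_seqD /cell_mass.
set e := ext_seq (unit_bdry _) s; set f := ext_seq (unit_bdry _) s.
set g := ext_seq (unit_bdry _) s.
rewrite sum3 -/e -/f -/g.
rewrite (_ : 9 * B * _ = (5 / 3) ^+ size s * (3 * B * (energy0 e e + energy0 f f + energy0 g g)));
  last by field.
rewrite ler_wpM2l ?exprn_ge0//.
have E (p : R) c d : p ^+ 2 <= B -> 0 <= energy0 c c -> p ^+ 2 * energy0 c c <= B * energy0 c c.
  by move=> ? ?; rewrite ler_wpM2r.
have h0 := ler_wpM2r (energy0_ge0 e) (hb ord0).
have h1 := ler_wpM2r (energy0_ge0 f) (hb (inord 1)).
have h2 := ler_wpM2r (energy0_ge0 g) (hb (inord 2)).
set p := b ord0 in h0 *; set q := b (inord 1) in h1 *; set r := b (inord 2) in h2 *.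
apply: (@le_trans _ _ (3 * (p ^+ 2 * energy0 e e + q ^+ 2 * energy0 f f + r ^+ 2 * energy0 g g))).
  rewrite -subr_ge0 (_ : _ - _ = energy0 (fun k => p * e k + (- q) * f k) (fun k => p * e k + (- q) * f k)
    + energy0 (fun k => p * e k + (- r) * g k) (fun k => p * e k + (- r) * g k) +
    energy0 (fun k => q * f k + (- r) * g k) (fun k => q * f k + (- r) * g k)).
    by rewrite !addr_ge0// energy0_ge0.
  by rewrite !energy0E; ring.
by lra.
Qed.

End KusuokaMass.

(** * Domination of energy measures by the Kusuoka measure *)

Section KusuokaMeasure.
Context {R : realType}.
Local Notation P := ('rV[R]_2).
Local Notation BP := (borel P).
Implicit Types (x y : P) (j k l : 'I_3) (b c : 'I_3 -> R) (s : seq 'I_3).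

Definition subcell s : set BP := Fseq s @` (@S0 R).

Lemma continuous_closed_image (V W : ptopologicalType) (f : V -> W) (A : set V) :
  hausdorff_space W -> continuous f -> compact A -> closed (f @` A).
Proof.
move=> hW cf cA; apply: compact_closed => //.
by apply: continuous_compact => //; exact: continuous_subspaceT.
Qed.

Lemma Fseq_continuous s : continuous (Fseq s : P -> P).
Proof.
elim: s => [|j s ih]; first by move=> x; exact: cvg_id.
by move=> x; apply: (continuous_comp (ih x)); exact: Fmap_continuous.
Qed.

Lemma closed_subcell s : closed (subcell s : set P).
Proof.
apply: continuous_closed_image; [exact: norm_hausdorff|exact: Fseq_continuous|].
exact: compact_S0.
Qed.

Lemma measurable_subcell s : measurable (subcell s).
Proof. by apply: closed_borel; exact: closed_subcell. Qed.

Lemma measure_bigsetU_le d (T : measurableType d) (I : eqType) (m : {measure set T -> \bar R})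
    (r : seq I) (Q : pred I) (B : I -> set T) : (forall i, measurable (B i)) ->
  (m (\big[setU/set0]_(i <- r | Q i) B i) <= \sum_(i <- r | Q i) m (B i))%E.
Proof.
move=> mB; elim: r => [|i r ih]; first by rewrite !big_nil measure0.
rewrite !big_cons; case: ifP => // Qi.
apply: (le_trans (measureU2 _ _ _)) => //; last by rewrite leeD2l.
by apply: bigsetU_measurable.
Qed.

(** A lower bound for a union of cells would require null overlaps; passing to the complement avoids
    them. The cells outside A cover the rest of S0, subadditivity bounds that rest from above, and
    all masses of level m add up to 1. *)
Lemma sum_mass_le (m0 : {measure set BP -> \bar R}) (T : set BP) m (A : pred (seq 'I_3)) :
  (forall s, m0 (subcell s) = (cell_mass s)%:E) -> measurable T ->
  (forall s, size s = m -> A s -> subcell s `<=` T) ->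
  ((\sum_(s <- words m | A s) cell_mass s)%:E <= m0 (T `&` (@S0 R : set BP)))%E.
Proof.
move=> hm mT hA; have mS := @measurable_S0 R.
have m1 : m0 (@S0 R : set BP) = 1%:E.
  have := hm [::]; rewrite /subcell /= image_id => ->.
  by have := @sum_cell_mass R 0; rewrite /= big_cons big_nil addr0 => ->.
have hle : (m0 ((@S0 R : set BP) `\` T) <= (\sum_(s <- words m | ~~ A s) cell_mass s)%:E)%E.
  rewrite -sumEFin; under eq_bigr do rewrite -hm.
  apply: (le_trans _ (measure_bigsetU_le _ _ _ measurable_subcell)).
  apply: le_measure; rewrite ?inE; [exact: measurableD|by apply: bigsetU_measurable => s _; exact: measurable_subcell|].
  move=> x [Sx nT]; have [s [hs [y [Sy exy]]]] := S0_cover_words m Sx.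
  rewrite -bigcup_seq_cond; exists s; last by rewrite exy; exists y.
  rewrite /= mem_words hs eqxx /=; apply/negP => As; apply: nT.
  by apply: (hA s hs As); rewrite exy; exists y.
have e1 : (1%:E = m0 ((@S0 R : set BP) `\` T) + m0 ((@S0 R : set BP) `&` T))%E.
  by rewrite -m1; exact: measureDI.
have e2 := @sum_cell_mass R m; rewrite (bigID A) /= in e2.
rewrite setIC; have fin2 : m0 ((@S0 R : set BP) `\` T) \is a fin_num.
  by rewrite ge0_fin_numE// (le_lt_trans hle)// ltry.
have : (m0 ((@S0 R : set BP) `&` T) = 1%:E - m0 ((@S0 R : set BP) `\` T))%E.
  by rewrite e1 addeAC subee// add0e.
by move=> ->; rewrite leeBrDr// (le_trans (leeD2l _ hle))// -EFinD e2.
Qed.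

Variable mu : {sigma_finite_measure set BP -> \bar R}.
Hypothesis hmu : is_kusuoka mu.

Lemma tau_continuous (i : int) : continuous (tau i : P -> P).
Proof.
case: i => k x /=; apply: (@cvgD _ _ _ (nbhs x)); try exact: cvg_cst.
  exact: cvg_id.
by apply: (@cvgN _ _ _ (nbhs x)); exact: cvg_id.
Qed.

Lemma tau_inv_continuous (i : int) : continuous (tau_inv i : P -> P).
Proof.
case: i => k x /=; apply: (@cvgD _ _ _ (nbhs x)); try exact: cvg_cst.
  exact: cvg_id.
by apply: (@cvgN _ _ _ (nbhs x)); exact: cvg_id.
Qed.

Lemma tauK (i : int) : cancel (tau i : P -> P) (tau_inv i).
Proof. by case: i => k x /=; rewrite ?addrK// opprB opprK addrAC subrr add0r. Qed.

Lemma tau_invK (i : int) : cancel (tau_inv i : P -> P) (tau i).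
Proof. by case: i => k x /=; rewrite ?subrK// opprB opprK addrAC subrr add0r. Qed.

Lemma tau0 : tau 0 = id :> (P -> P).
Proof. by apply/funext => x /=; rewrite /cell_offset big_ord0 addr0. Qed.

Lemma kusuoka_subcell (i : int) s : mu (tau i @` subcell s) = (cell_mass s)%:E.
Proof.
case: hmu => _ h1 h2; elim/last_ind: s => [|s j _].
  rewrite /subcell /= image_id -/(cell i) h1.
  by have := @sum_cell_mass R 0; rewrite /= big_cons big_nil addr0 => ->.
rewrite cell_massE -Yword_nth /subcell -Fword_nth.
by apply: h2; rewrite size_rcons.
Qed.

Lemma kusuoka_S0_lty : (mu (@S0 R : set BP) < +oo)%E.
Proof. by case: hmu => _ /(_ 0) + _; rewrite /cell tau0 image_id => ->; rewrite ltry. Qed.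

Let mu0 : {finite_measure set BP -> \bar R} := mfrestr (@measurable_S0 R) kusuoka_S0_lty.

Lemma subcell_S0 s : subcell s `<=` (@S0 R : set BP).
Proof. by move=> _ [y Sy <-]; exact: S0_Fseq. Qed.

Let mu0_subcell s : mu0 (subcell s) = (cell_mass s)%:E.
Proof.
rewrite -(kusuoka_subcell 0) tau0 image_id /mu0 /= /mfrestr /mrestr.
by rewrite (setIidl (@subcell_S0 s)).
Qed.

Let mu0_le (T : set BP) : measurable T -> T `<=` (@S0 R : set BP) -> mu0 T = mu T.
Proof. by move=> mT TS; rewrite /mu0 /= /mfrestr /mrestr (setIidl TS). Qed.

Lemma continuous_measurable_plane (f : P -> P) : continuous f ->
  measurable_fun [set: BP] (f : BP -> BP).
Proof.
move=> /continuousP cf; have e : @measurable _ BP = <<s @open P >> by [].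
apply: (measurability _ e).
move=> _ [U oU <-]; rewrite setTI; apply: open_borel; exact: cf.
Qed.

Lemma image_tau (i : int) (A : set BP) : tau i @` A = tau_inv i @^-1` A.
Proof.
apply/seteqP; split=> [_ [x Ax <-]|x Ax]; first by rewrite /= tauK.
by exists (tau_inv i x) => //; rewrite tau_invK.
Qed.

(** The transported measure and the one on S0 have the same mass on every subcell. Covering a closed
    set by the subcells that meet it gives one inequality between them, which is enough for null
    sets. *)
Lemma kusuoka_tau_null (i : int) (N : set BP) : measurable N -> N `<=` (@S0 R : set BP) ->
  mu N = 0%E -> mu (tau i @` N) = 0%E.
Proof.
move=> mN NS N0.
have mt := continuous_measurable_plane (@tau_inv_continuous i).
pose push : {measure set BP -> \bar R} := pushforward mu (tau_inv i : BP -> BP).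
pose m1' := push mt.
have m1'E A : m1' A = mu (tau i @` A) by rewrite image_tau.
have lt1 : (m1' (@S0 R : set BP) < +oo)%E.
  by rewrite m1'E; case: hmu => _ /(_ i) + _; rewrite /cell => ->; rewrite ltry.
pose m1 : {finite_measure set BP -> \bar R} := mfrestr (@measurable_S0 R) lt1.
have m1E A : A `<=` (@S0 R : set BP) -> m1 A = mu (tau i @` A).
  by move=> AS; rewrite /m1 /= /mfrestr /mrestr (setIidl AS) -m1'E.
suff : (m1 N <= mu0 N)%E.
  rewrite m1E// mu0_le// N0 => h; apply/eqP; rewrite eq_le h measure_ge0//.
apply: (@le_measure_closed _ _ mu0 (@S0 R : set BP)) => //; first exact: measurable_S0.
move=> K cK KS; apply/lee_addgt0Pr => e e0.
have [d d0 hd] := thicken_le mu0 cK e0.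
have [m [phi [A [_ _ KA _ [_ hA]]]]] := tent_exists K d0.
have mT := measurable_thicken (K : set BP) d0.
have hA' s : size s = m -> A s -> subcell s `<=` thicken K d.
  by move=> hs As _ [y Sy <-]; exact: hA.
have := sum_mass_le mu0_subcell mT hA' => h.
have h' : (mu0 (thicken K d `&` (@S0 R : set BP)) <= mu0 (thicken K d))%E.
  apply: le_measure; rewrite ?inE//; apply: measurableI => //; exact: measurable_S0.
apply: le_trans hd; apply: le_trans h'; apply: le_trans h.
rewrite -sumEFin (eq_bigr (fun s => m1 (subcell s))); last first.
  by move=> s _; rewrite m1E ?kusuoka_subcell//; exact: subcell_S0.
apply: (le_trans _ (measure_bigsetU_le _ _ _ measurable_subcell)).
apply: le_measure; rewrite ?inE; [exact: closed_borel|by apply: bigsetU_measurable => s _; exact: measurable_subcell|].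
move=> x Kx; have [s [hs [y [Sy exy]]]] := S0_cover_words m (KS x Kx).
rewrite -bigcup_seq_cond; exists s; last by rewrite exy; exists y.
by rewrite /= mem_words hs eqxx /=; apply: KA hs Sy _; rewrite -exy.
Qed.

Definition kusuoka_const : R := 9 * (1 + hole_limit).

Lemma kusuoka_const_gt0 : 0 < kusuoka_const.
Proof. by rewrite /kusuoka_const; have := @hole_limit_ge0 R; lra. Qed.

(** A cutoff of K bounds the energy measure of K by the energy of the cells near K, each of which is
    bounded by its Kusuoka mass. *)
Lemma energy_measure_le_kusuoka b (B : R) (M : {finite_measure set BP -> \bar R}) :
  is_energy_measure (harm b) M -> (forall k, b k ^+ 2 <= B) ->
  forall A, measurable A -> A `<=` (@S0 R : set BP) ->
    (M A <= (kusuoka_const * B)%:E * mu A)%E.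
Proof.
move=> [M0 hM] hB.
have B0 : 0 <= B by apply: le_trans (hB ord0); exact: sqr_ge0.
have C0 : 0 <= kusuoka_const * B by rewrite mulr_ge0// ltW// kusuoka_const_gt0.
pose m2 : {measure set BP -> \bar R} := mscale (NngNum C0) mu.
have mS := @measurable_S0 R.
apply: (@le_measure_closed _ M m2 (@S0 R : set BP)) => //.
move=> K cK KS; apply/lee_addgt0Pr => e e0.
pose C := kusuoka_const * B.
(* The error of the thickening is multiplied by C at the end, and C e / (C + 1) is at most e even
   when C = 0. *)
have e1 : 0 < e / (C + 1) by rewrite divr_gt0// ltr_wpDl.
have [d d0 hd] := thicken_le mu0 cK e1.
have [m [phi [A [Fphi phi01 KA phi1 [phi0 hA]]]]] := tent_exists K d0.
have mT := measurable_thicken (K : set BP) d0.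
have mK : measurable (K : set BP) by exact: closed_borel.
have hA' s : size s = m -> A s -> subcell s `<=` thicken K d.
  by move=> hs As _ [y Sy <-]; exact: hA.
have h := sum_mass_le mu0_subcell mT hA'.
have h' : (mu0 (thicken K d `&` (@S0 R : set BP)) <= mu0 (thicken K d))%E.
  by apply: le_measure; rewrite ?inE//; exact: measurableI.
have hK : (M K <= (energy_functional (harm b) phi)%:E)%E.
  rewrite -hM// -{1}(setIidl KS) -integral_indic//; apply: le_integral_ge0 => x Sx.
    by rewrite lee_fin.
  rewrite lee_fin indicE; case: (boolP (x \in K)) => [|_].
    by rewrite inE => Kx; rewrite phi1.
  by case/andP: (phi01 x Sx).
have hphi x : S0 x -> phi x <= 1 by move=> /phi01/andP[].
have hL := energy_functional_words b Fphi hphi phi0.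
have hS : (1 + hole_limit) * (5 / 3) ^+ m *
    \sum_(s <- words m | A s) energy0 (ext_seq b s) (ext_seq b s) <=
    C * \sum_(s <- words m | A s) cell_mass s.
  rewrite -mulrA /C /kusuoka_const [9 * _]mulrC -!mulrA ler_wpM2l//.
    by rewrite addr_ge0// hole_limit_ge0.
  rewrite !mulr_sumr big_seq_cond [leRHS]big_seq_cond; apply: ler_sum => s /andP[ws _].
  by rewrite mulrA; move: ws; rewrite mem_words => /eqP <-; exact: energy0_ext_le.
apply: (le_trans hK); rewrite /m2 /mscale /= -/C.
apply: (@le_trans _ _ (C%:E * (mu0 K + (e / (C + 1))%:E))%E).
  apply: (@le_trans _ _ (C%:E * (\sum_(s <- words m | A s) cell_mass s)%:E)%E).
    by rewrite -EFinM lee_fin (le_trans hL).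
  apply: lee_wpmul2l; first by rewrite lee_fin.
  exact: (le_trans h (le_trans h' hd)).
rewrite mu0_le// ge0_muleDr ?lee_fin ?(ltW e1)// leeD2l// -EFinM lee_fin.
rewrite mulrA ler_pdivrMr; last by rewrite ltr_wpDl.
have : C * e <= (C + 1) * e by rewrite ler_wpM2r ?(ltW e0)// lerDl.
lra.
Qed.

End KusuokaMeasure.

(** * Existence of energy measures *)

Section EnergyMeasures.
Context {R : realType}.
Local Notation P := ('rV[R]_2).
Local Notation BP := (borel P).
Local Notation DS := (@S0 R : set BP).
Implicit Types (x y : P) (j k l : 'I_3) (b c : 'I_3 -> R) (phi v : P -> R).

Lemma energy_functional_lin v phi psi (s t : R) : FS0 v -> FS0 phi -> FS0 psi ->
  energy_functional v (fun x => s * phi x + t * psi x) =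
  s * energy_functional v phi + t * energy_functional v psi.
Proof.
move=> hv hp hq.
apply: (cvg_unique _ (energy_functional_cvg hv (FS0_lin s t hp hq))) => //.
rewrite (_ : (fun m => _) = (fun m => s * wsum true true m (edge_density phi v) +
   t * wsum true true m (edge_density psi v))).
  by apply: cvgD; apply: cvgMl_tmp; exact: energy_functional_cvg.
apply/funext => m; rewrite -!wsumZ -wsumD; apply: eq_wsum => x y _ _.
by rewrite /edge_density; ring.
Qed.

Lemma energy_comb_cvg (n : nat) (s : nat -> R) (u : nat -> P -> R) phi :
  (forall i : nat, FS0 (u i)) -> FS0 phi ->
  (fun m => wsum true true m (fun x y => \sum_(i < n) s i * edge_density phi (u i) x y)) @ \oo
    --> \sum_(i < n) s i * energy_functional (u i) phi.
Proof.
move=> hu hp; rewrite (_ : (fun m => _) = (fun m : nat => \sum_(i < n)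
   s i * wsum true true m (edge_density phi (u i)))).
  elim: n => [|n ih].
    by rewrite big_ord0 (_ : (fun m => _) = fun=> 0); [exact: cvg_cst|apply/funext => m; rewrite big_ord0].
  rewrite big_ord_recr (_ : (fun m => _) = (fun m : nat => (\sum_(i < n)
     s i * wsum true true m (edge_density phi (u i))) +
     s n * wsum true true m (edge_density phi (u n)))); last first.
    by apply/funext => m; rewrite big_ord_recr.
  by apply: cvgD => //; apply: cvgMl_tmp; exact: energy_functional_cvg.
apply/funext => m; elim: n => [|n ih].
  rewrite big_ord0 (@eq_wsum _ _ _ _ _ (fun x y => 0 * 0)) ?wsumZ ?mul0r//.
  by move=> x y _ _; rewrite big_ord0.
rewrite big_ord_recr /= -ih -wsumZ -wsumD; apply: eq_wsum => x y _ _.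
by rewrite big_ord_recr.
Qed.

Lemma sum_edge_density (n : nat) (s : nat -> R) (u : nat -> P -> R) phi x y :
  \sum_(i < n) s i * edge_density phi (u i) x y =
  2^-1 * (phi x + phi y) * \sum_(i < n) s i * (u i x - u i y) ^+ 2.
Proof.
by rewrite mulr_sumr; apply: eq_bigr => i _; rewrite /edge_density; ring.
Qed.

(** The coefficients may be negative: it is enough that the quadratic form in the increments is
    nonnegative on every pair of points. *)
Lemma energy_comb_ge0 (n : nat) (s : nat -> R) (u : nat -> P -> R) phi :
  (forall i : nat, FS0 (u i)) -> FS0 phi -> (forall x, S0 x -> 0 <= phi x) ->
  (forall x y, S0 x -> S0 y -> 0 <= \sum_(i < n) s i * (u i x - u i y) ^+ 2) ->
  0 <= \sum_(i < n) s i * energy_functional (u i) phi.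
Proof.
move=> hu hp p0 h; apply: (cvgr_to_ge (@energy_comb_cvg n s u phi hu hp)).
apply: nearW => m; rewrite -[leLHS](mul0r (wsum true true m (fun x y => 0))) -wsumZ.
apply: ler_wsum => x y /V0_S0 Sx /V0_S0 Sy; rewrite mul0r sum_edge_density.
by rewrite !mulr_ge0 ?addr_ge0 ?p0 ?h.
Qed.

Lemma energy_comb_eq (n : nat) (s : nat -> R) (u : nat -> P -> R) v phi :
  (forall i : nat, FS0 (u i)) -> FS0 phi -> FS0 v ->
  (forall x y, S0 x -> S0 y -> \sum_(i < n) s i * (u i x - u i y) ^+ 2 = (v x - v y) ^+ 2) ->
  \sum_(i < n) s i * energy_functional (u i) phi = energy_functional v phi.
Proof.
move=> hu hp hv h; apply: (cvg_unique _ (@energy_comb_cvg n s u phi hu hp)) => //.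
rewrite (_ : (fun m => _) = fun m => wsum true true m (edge_density phi v)).
  exact: energy_functional_cvg.
apply/funext => m; apply: eq_wsum => x y /V0_S0 Sx /V0_S0 Sy.
by rewrite sum_edge_density h.
Qed.

Definition finite_restr (m : {measure set BP -> \bar R}) (h : (m DS < +oo)%E) :
  {finite_measure set BP -> \bar R} := mfrestr (@measurable_S0 R) h.

Lemma finite_restrE (m : {measure set BP -> \bar R}) (h : (m DS < +oo)%E) A :
  A `<=` DS -> finite_restr h A = m A.
Proof. by move=> AS; rewrite /finite_restr /= /mfrestr /mrestr (setIidl AS). Qed.

Lemma integrable_FS0 (M : {finite_measure set BP -> \bar R}) phi : FS0 phi ->
  M.-integrable DS (EFin \o phi).
Proof.
move=> hp; apply/integrableP; split; first exact: measurable_FS0.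
have [cp _] := hp; have [B B0 hB] := within_bounded compact_S0 cp.
have mS := @measurable_S0 R.
apply: (@le_lt_trans _ _ (B%:E * M DS)%E).
  rewrite -integral_cst//; apply: le_integral_ge0 => x Sx //=.
  by rewrite lee_fin hB.
by rewrite lte_mul_pinfty ?lee_fin//= ?fin_num_measure// -ge0_fin_numE// fin_num_measure.
Qed.

(* Adding a constant to a test function reduces the defining identity of an
   energy measure to nonnegative test functions. *)
Lemma energy_measure_restr v (m : {measure set BP -> \bar R}) (h : (m DS < +oo)%E) :
  FS0 v ->
  (forall phi, FS0 phi -> (forall x, S0 x -> 0 <= phi x) ->
    (\int[m]_(x in DS) (phi x)%:E = (energy_functional v phi)%:E)%E) ->
  is_energy_measure v (finite_restr h).
Proof.
move=> hv hm; split; first by rewrite /finite_restr /= /mfrestr /mrestr setICl measure0.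
have hM phi : FS0 phi -> (forall x, S0 x -> 0 <= phi x) ->
    (\int[finite_restr h]_(x in DS) (phi x)%:E = (energy_functional v phi)%:E)%E.
  move=> hp p0; rewrite -hm//; apply: eq_measure_integral => A mA AS.
  exact: finite_restrE.
move=> phi hp; rewrite -/(energy_functional v phi).
have [B B0 hB] := within_bounded compact_S0 (proj1 hp).
have h1 : forall x : P, S0 x -> 0 <= (fun=> 1 : R) x by [].
have p0 x : S0 x -> 0 <= 1 * phi x + B * 1.
  by move=> /hB; rewrite ler_norml => /andP[+ _]; lra.
have e1 := hM _ (FS0_lin 1 B hp (FS0_cst 1)) p0.
have e2 := hM _ (FS0_cst 1) h1.
move: e1; rewrite energy_functional_lin//; last exact: FS0_cst.
have mS := @measurable_S0 R.
under eq_integral do rewrite mul1r mulr1 EFinD.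
rewrite integralD//; [|exact: integrable_FS0|exact: integrable_FS0 (FS0_cst B)].
have -> : (\int[finite_restr h]_(x in DS) B%:E = (B * energy_functional v (fun=> 1))%:E)%E.
  by rewrite EFinM -e2 integral_cst// integral_cst// mul1e.
rewrite mul1r; case: (integral _ _ _) => [z||//] /=; last by [].
by move=> [] /addIr ->.
Qed.

Lemma pos_part_ge0 (t : R) : 0 <= (`|t| + t) / 2.
Proof. by rewrite divr_ge0// -lerBlDr sub0r -normrN ler_norm. Qed.

(** Measures only admit nonnegative coefficients, so a signed combination is handled as the
    difference of the one for s and the one for - s, each keeping the positive parts. *)
Definition pos_comb (s : nat -> R) (M : nat -> {finite_measure set BP -> \bar R}) (n : nat) :
  {measure set BP -> \bar R} :=
  msum (fun i => mscale (NngNum (pos_part_ge0 (s i))) (M i)) n.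

Lemma pos_combE s M n A : pos_comb s M n A = (\sum_(i < n) ((`|s i| + s i) / 2)%:E * M i A)%E.
Proof. by rewrite /pos_comb /msum; apply: eq_bigr. Qed.

Lemma pos_comb_fin s M n A : measurable A ->
  pos_comb s M n A = (\sum_(i < n) (`|s i| + s i) / 2 * fine (M i A))%:E.
Proof.
move=> mA; rewrite pos_combE -sumEFin; apply: eq_bigr => i _.
by rewrite [RHS]EFinM fineK//; exact: fin_num_measure.
Qed.

Lemma pos_comb_lty s M n : (pos_comb s M n DS < +oo)%E.
Proof. by rewrite pos_comb_fin ?ltry//; exact: measurable_S0. Qed.

Lemma pos_comb_sub s M n A : measurable A ->
  (pos_comb s M n A = pos_comb (fun i => (- s i)%R) M n A +
    (\sum_(i < n) s i * fine (M i A))%:E)%E.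
Proof.
move=> mA; rewrite !pos_comb_fin// -EFinD -big_split /=; congr EFin.
by apply: eq_bigr => i _; rewrite normrN; field.
Qed.

Lemma integral_pos_comb s M n (u : nat -> P -> R) phi :
  (forall i : nat, is_energy_measure (u i) (M i)) ->
  FS0 phi -> (forall x, S0 x -> 0 <= phi x) ->
  (\int[pos_comb s M n]_(x in DS) (phi x)%:E =
   (\sum_(i < n) (`|s i| + s i) / 2 * energy_functional (u i) phi)%:E)%E.
Proof.
move=> hM hp p0; have mS := @measurable_S0 R.
have hp0 x : DS x -> (0 <= (phi x)%:E)%E by move=> Sx; rewrite lee_fin p0.
rewrite ge0_integral_measure_sum//; last exact: measurable_FS0.
rewrite -sumEFin; apply: eq_bigr => i _.
rewrite ge0_integral_mscale//; last exact: measurable_FS0.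
by have [_ ->] := hM i.
Qed.

Lemma pos_comb_functional (n : nat) (s : nat -> R) (u : nat -> P -> R) phi :
  \sum_(i < n) (`|s i| + s i) / 2 * energy_functional (u i) phi =
  \sum_(i < n) (`|- s i| - s i) / 2 * energy_functional (u i) phi +
  \sum_(i < n) s i * energy_functional (u i) phi.
Proof. by rewrite -big_split /=; apply: eq_bigr => i _; rewrite normrN; field. Qed.

Lemma le_pos_comb (n : nat) (s : nat -> R) (u : nat -> P -> R) M A :
  (forall i : nat, FS0 (u i)) -> (forall i : nat, is_energy_measure (u i) (M i)) ->
  (forall x y, S0 x -> S0 y -> 0 <= \sum_(i < n) s i * (u i x - u i y) ^+ 2) ->
  measurable A -> A `<=` DS ->
  (pos_comb (fun i => (- s i)%R) M n A <= pos_comb s M n A)%E.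
Proof.
move=> hu hM h mA AS.
rewrite -(finite_restrE (pos_comb_lty (fun i => (- s i)%R) M n) AS).
rewrite -(finite_restrE (pos_comb_lty s M n) AS).
apply: le_measure_functional => // phi hp p0.
have e (s' : nat -> R) : (\int[finite_restr (pos_comb_lty s' M n)]_(x in DS) (phi x)%:E =
    (\sum_(i < n) (`|s' i| + s' i) / 2 * energy_functional (u i) phi)%:E)%E.
  rewrite -(integral_pos_comb s' n hM hp p0); apply: eq_measure_integral => B mB BS.
  exact: finite_restrE.
rewrite !e lee_fin [leRHS]pos_comb_functional lerDl.
exact: energy_comb_ge0.
Qed.

Lemma measure_comb_ge0 (n : nat) (s : nat -> R) (u : nat -> P -> R) M A :
  (forall i : nat, FS0 (u i)) -> (forall i : nat, is_energy_measure (u i) (M i)) ->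
  (forall x y, S0 x -> S0 y -> 0 <= \sum_(i < n) s i * (u i x - u i y) ^+ 2) ->
  measurable A -> A `<=` DS -> 0 <= \sum_(i < n) s i * fine (M i A).
Proof.
move=> hu hM h mA AS; have := le_pos_comb hu hM h mA AS.
by rewrite (pos_comb_sub s)// pos_comb_fin// -EFinD lee_fin lerDl.
Qed.

(** The difference is a signed measure, nonnegative on all sets, hence zero on the negative part of
    a Hahn decomposition and equal to its Jordan positive part. *)
Lemma measure_diff (m1 m2 : {finite_measure set BP -> \bar R}) :
  (forall A, measurable A -> (m2 A <= m1 A)%E) ->
  exists m3 : {finite_measure set BP -> \bar R},
    forall A, measurable A -> (m3 A + m2 A = m1 A)%E.
Proof.
move=> h; pose th := cadd (charge_of_finite_measure m1) (copp (charge_of_finite_measure m2)).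
have [Q [N hQN]] := Hahn_decomposition th.
exists (jordan_pos hQN) => A mA.
have [[mQ hQ] [mN hN] QN QN0] := hQN.
have thE B : measurable B -> th B = (m1 B - m2 B)%E by [].
have th0 : th (A `&` N) = 0%E.
  have mAN : measurable (A `&` N) by exact: measurableI.
  apply/eqP; rewrite eq_le hN//= thE//.
  by rewrite sube_ge0 ?h// fin_num_measure.
have mAQ : measurable (A `&` Q) by exact: measurableI.
have e : jordan_pos hQN A = (m1 A - m2 A)%E.
  rewrite jordan_posE cjordan_posE /crestr0 mem_set// /crestr -thE//.
  have -> : th A = (th (A `&` Q) + th (A `&` N))%E by exact: charge_partition.
  by rewrite th0 adde0.
transitivity ((m1 A - m2 A) + m2 A)%E; first by congr (_ + _)%E.
by rewrite subeK//; exact: fin_num_measure.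
Qed.

(** The positive combination dominates the negative one as measures because squares are nonnegative
    on each pair; their difference satisfies the defining identity of v. *)
Lemma energy_measure_comb (n : nat) (s : nat -> R) (u : nat -> P -> R) M v :
  (forall i : nat, FS0 (u i)) -> (forall i : nat, is_energy_measure (u i) (M i)) -> FS0 v ->
  (forall x y, S0 x -> S0 y -> \sum_(i < n) s i * (u i x - u i y) ^+ 2 = (v x - v y) ^+ 2) ->
  exists M', is_energy_measure v M'.
Proof.
move=> hu hM hv h; have mS := @measurable_S0 R.
have h0 x y : S0 x -> S0 y -> 0 <= \sum_(i < n) s i * (u i x - u i y) ^+ 2.
  by move=> Sx Sy; rewrite h// sqr_ge0.
pose m1 := finite_restr (pos_comb_lty s M n).
pose m2 := finite_restr (pos_comb_lty (fun i => (- s i)%R) M n).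
have [A mA|m3 hm3] := @measure_diff m1 m2.
  rewrite /m1 /m2 /finite_restr /= /mfrestr /mrestr.
  by apply: (le_pos_comb hu hM h0); [exact: measurableI|move=> x []].
have m3lt : (m3 DS < +oo)%E by rewrite -ge0_fin_numE// fin_num_measure.
exists (finite_restr m3lt); apply: energy_measure_restr => // phi hp p0.
have hp0 x : DS x -> (0 <= (phi x)%:E)%E by move=> Sx; rewrite lee_fin p0.
have e (s' : nat -> R) : (\int[finite_restr (pos_comb_lty s' M n)]_(x in DS) (phi x)%:E =
    (\sum_(i < n) (`|s' i| + s' i) / 2 * energy_functional (u i) phi)%:E)%E.
  rewrite -(integral_pos_comb s' n hM hp p0); apply: eq_measure_integral => B mB BS.
  exact: finite_restrE.
have : (\int[measure_add m3 m2]_(x in DS) (phi x)%:E = \int[m1]_(x in DS) (phi x)%:E)%E.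
  apply: eq_measure_integral => B mB BS.
  by transitivity (m3 B + m2 B)%E; [exact: measure_addE|exact: hm3].
rewrite ge0_integral_measure_add//; last exact: measurable_FS0.
rewrite /m1 /m2 !e [in RHS]pos_comb_functional (energy_comb_eq hu hp hv h).
case: (integral _ _ _) => [z||//]; last by [].
by rewrite -EFinD => -[]; rewrite addrC => /addrI ->.
Qed.

Lemma bc_sum i (c : 'I_3 -> R) (q : 'I_3 -> P) : \sum_k c k = 1 ->
  bc i (\sum_k c k *: q k) = \sum_k c k * bc i (q k).
Proof.
rewrite !sum3 => c1; have -> : c ord0 = 1 - c (inord 1) - c (inord 2) by lra.
by case: i => [[|[|[|?]]] ?] //; rewrite /bc /= !mxE /=; field.
Qed.

(** The symmetry of the triangle that exchanges the corners ord0 and j, as a permutation of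
    barycentric coordinates. *)
Definition reflection j x : P := \sum_k bc k x *: corner (tperm ord0 j k).

Lemma bc_reflection i j x : bc i (reflection j x) = bc (tperm ord0 j i) x.
Proof.
rewrite /reflection bc_sum ?sum_bc// (bigD1 (tperm ord0 j i))//= tpermK bc_corner eqxx mulr1.
rewrite big1 ?addr0// => k kji; rewrite bc_corner (_ : (i == _) = false) ?mulr0//.
by apply: contraNF kji => /eqP ->; rewrite tpermK.
Qed.

Lemma reflectionK j : involutive (reflection j).
Proof. by move=> x; apply: bc_ext => i; rewrite !bc_reflection tpermK. Qed.

Lemma reflection_corner j k : reflection j (corner k) = corner (tperm ord0 j k).
Proof.
apply: bc_ext => i; rewrite bc_reflection !bc_corner; congr (_%:R).
by rewrite -(inj_eq (@perm_inj _ (tperm ord0 j)) i) tpermK eq_sym -(inj_eq (@perm_inj _ (tperm ord0 j))) tpermK eq_sym.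
Qed.

Lemma reflection_Fmap j k x :
  reflection j (Fmap k x) = Fmap (tperm ord0 j k) (reflection j x).
Proof.
apply: bc_ext => i; rewrite bc_reflection !bc_Fmap bc_reflection; congr (_ * (_ + _%:R)).
by rewrite -{2}(tpermK ord0 j i) (inj_eq (@perm_inj _ (tperm ord0 j))).
Qed.

Lemma reflection_continuous j : continuous (reflection j).
Proof.
rewrite (_ : reflection j = fun x => bc ord0 x *: corner (tperm ord0 j ord0) +
  bc (inord 1) x *: corner (tperm ord0 j (inord 1)) +
  bc (inord 2) x *: corner (tperm ord0 j (inord 2))); last first.
  by apply/funext => x; rewrite /reflection sum3.
move=> x; apply: (@cvgD _ _ _ (nbhs x)); first apply: (@cvgD _ _ _ (nbhs x)).
all: by apply: (@cvgZr_tmp _ _ _ (nbhs x)); exact: bc_continuous.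
Qed.

Lemma V0_reflection m j x : V0 m x -> V0 m (reflection j x).
Proof.
elim: m x => [|m ih] x.
  by move=> [k _ <-]; rewrite reflection_corner; exists (tperm ord0 j k).
move=> /V0S[k [y [Vy ->]]]; rewrite reflection_Fmap; apply: V0_Fmap; exact: ih.
Qed.

Lemma S0_reflection j x : S0 x -> S0 (reflection j x).
Proof.
move: x; apply: S0_sub => [|m x Vx].
  exact: (preimage_closed (@reflection_continuous j) closed_S0).
exact: (@V0_S0 _ m _ (V0_reflection j Vx)).
Qed.

Lemma enorm_reflection j x y : enorm (reflection j x - reflection j y) = enorm (x - y).
Proof.
apply/eqP; rewrite -(@eqrXn2 _ 2)// ?enorm_ge0// !enorm_sqr; apply/eqP; congr (_ * _).
rewrite [RHS](reindex_inj (@perm_inj _ (tperm ord0 j))).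
by apply: eq_bigr => k _; rewrite !bc_reflection.
Qed.

Lemma energy_reflection j v : energy (v \o reflection j) = energy v.
Proof.
congr (limn _); apply/funext => m; congr EFin; rewrite /energy_m.
symmetry; apply: (@reindex_fsbig _ _ _ _ _
  (fun e : P * P => (reflection j e.1, reflection j e.2))).
split => [e /= [V1 V2 h]|e e' _ _ /= []|e /= [V1 V2 h]].
- by split; rewrite ?enorm_reflection//; exact: V0_reflection.
- by case: e => x y; case: e' => x' y' /= /(can_inj (@reflectionK j)) -> /(can_inj (@reflectionK j)) ->.
- exists (reflection j e.1, reflection j e.2); last by rewrite /= !reflectionK; case: (e).
  by split; rewrite /= ?enorm_reflection//; exact: V0_reflection.
Qed.

Lemma energy_functional_reflection j v phi :
  energy_functional (v \o reflection j) (phi \o reflection j) = energy_functional v phi.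
Proof.
rewrite /energy_functional /energy2.
by do ![congr (_ - _)|congr (_ / _)|congr fine|exact: energy_reflection].
Qed.

Lemma FS0_reflection j v : FS0 v -> FS0 (v \o reflection j).
Proof.
move=> [cv ev]; split; last by rewrite energy_reflection.
apply/subspace_continuousP => x Sx.
have /subspace_continuousP/(_ _ (@S0_reflection j x Sx)) h := cv.
move=> U /h hU; have hU' : \forall y \near x, S0 (reflection j y) -> U (v (reflection j y)).
  exact: (@reflection_continuous j x _ hU).
change (\forall y \near x, S0 y -> U (v (reflection j y))).
near=> y => Sy; have : S0 (reflection j y) -> U (v (reflection j y)) by near: y.
by apply; exact: S0_reflection.
Unshelve. all: by end_near.
Qed.

Lemma harm_reflection j b x : S0 x ->
  harm b (reflection j x) = harm (b \o tperm ord0 j) x.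
Proof.
have h m c y : S0 y -> harm_approx m c (reflection j y) = harm_approx m (c \o tperm ord0 j) y.
  elim: m c y => [|m ih] c y Sy.
    rewrite /= (reindex_inj (@perm_inj _ (tperm ord0 j))).
    by apply: eq_bigr => k _; rewrite bc_reflection tpermK.
  have [k [z [Sz ->]]] := S0_cover Sy.
  have tz := S0_triangle Sz; have tz' := S0_triangle (@S0_reflection j z Sz).
  rewrite reflection_Fmap !harm_approxS// ih//.
  congr (harm_approx _ _ _); apply/funext => l; rewrite /extension_mx /=.
  rewrite -{2}(tpermK ord0 j k) (inj_eq (@perm_inj _ (tperm ord0 j))).
  by rewrite [in LHS](reindex_inj (@perm_inj _ (tperm ord0 j))) tpermK.
move=> Sx; apply/cvg_lim => //.
rewrite (_ : (fun m => _) = fun m => harm_approx m (b \o tperm ord0 j) x).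
  exact: harm_cvg.
by apply/funext => m; exact: h.
Qed.

(** Energies are invariant under the reflection, so the image of an energy measure of the first
    basis function is one of the j-th. *)
Lemma energy_measure_harm_corner : 
  (exists M : {finite_measure set BP -> \bar R},
     is_energy_measure (harm (fun k => (k == ord0)%:R)) M) ->
  forall j, exists M : {finite_measure set BP -> \bar R},
     is_energy_measure (harm (fun k => (k == j)%:R)) M.
Proof.
move=> [M [_ hM]] j; have mr := continuous_measurable_plane (@reflection_continuous j).
pose push : {measure set BP -> \bar R} := pushforward M (reflection j : BP -> BP).
pose m := push mr.
have preS : reflection j @^-1` DS = DS.
  apply/seteqP; split=> x /= Sx; last exact: S0_reflection.
  by rewrite -(reflectionK j x); exact: S0_reflection.
have mS := @measurable_S0 R.
have mlt : (m DS < +oo)%E.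
  have -> : m DS = M DS by rewrite -[in RHS]preS.
  by rewrite -ge0_fin_numE// fin_num_measure.
exists (finite_restr mlt); apply: energy_measure_restr => [|phi hp p0]; first exact: FS0_harm.
rewrite ge0_integral_pushforward//; last 2 first.
- exact: measurable_FS0.
- by move=> x /[!inE] Sx; rewrite lee_fin p0.
rewrite preS hM; last exact: FS0_reflection.
suff <- : energy_functional (harm (unit_bdry ord0)) (phi \o reflection j) =
  energy_functional (harm (fun k => (k == j)%:R)) phi by [].
rewrite -(energy_functional_reflection j).
have -> : (phi \o reflection j) \o reflection j = phi by apply/funext => x /=; rewrite reflectionK.
apply: energy_functional_ext => x Sx /=; rewrite harm_reflection//; congr (harm _ x).
apply/funext => k /=; congr (_%:R).
have -> : (k == j) = (tperm ord0 j k == tperm ord0 j j) by rewrite (inj_eq (@perm_inj _ _)).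
by rewrite tpermR.
Qed.

End EnergyMeasures.

(** * The gradient bound *)

(** The families of null sets below are indexed by [rat * bool], [int * nat] and [int * 'I_3], hence
    a general countable index type. *)
Lemma null_bigcup d (T : measurableType d) (R : realType) (m : {measure set T -> \bar R})
    (I : countType) (N : I -> set T) : (forall i, measurable (N i) /\ m (N i) = 0%E) ->
  measurable (\bigcup_i N i) /\ m (\bigcup_i N i) = 0%E.
Proof.
move=> hN; pose N' k := if unpickle k is Some i then N i else set0.
have -> : \bigcup_i N i = \bigcup_k N' k.
  apply/seteqP; split=> [x [i _ Nx]|x [k _]]; last by rewrite /N'; case: unpickle => // i Nx; exists i.
  by exists (pickle i) => //; rewrite /N' pickleK.
have mN k : measurable (N' k) by rewrite /N'; case: unpickle => // i; case: (hN i).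
have mU : measurable (\bigcup_k N' k) by exact: bigcupT_measurable.
split=> //; apply: measure_negligible => //; apply: negligible_bigcup => k; apply/negligibleP => //.
by rewrite /N'; case: unpickle => // i; case: (hN i).
Qed.

Section GradientBound.
Context {R : realType}.
Local Notation P := ('rV[R]_2).
Local Notation BP := (borel P).
Local Notation DS := (@S0 R : set BP).
Implicit Types (x y : P) (j k l : 'I_3) (b c : 'I_3 -> R) (phi v : P -> R).

Lemma harm_decomp b x : S0 x -> harm b x = b ord0 * harm (unit_bdry ord0) x +
  b (inord 1) * harm (unit_bdry (inord 1)) x + b (inord 2) * harm (unit_bdry (inord 2)) x.
Proof. by move=> Sx; rewrite {1}(bdry_decomp b) !harmD// mul1r addrA. Qed.

Lemma sum_harm_unit x : S0 x -> harm (unit_bdry ord0) x + harm (unit_bdry (inord 1)) x +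
  harm (unit_bdry (inord 2)) x = 1 :> R.
Proof.
move=> Sx; have := harm_decomp (fun=> 1) Sx; rewrite !mul1r => <-.
exact: harm_cst.
Qed.

Lemma is_energy_measure_energy_measure v :
  (exists M : {finite_measure set BP -> \bar R}, is_energy_measure v M) ->
  is_energy_measure v (energy_measure v).
Proof. by rewrite /energy_measure; case: pselect => // h _; case: cid. Qed.

Lemma energy_measure_harm_exists b :
  (exists M : {finite_measure set BP -> \bar R}, is_energy_measure (harm (unit_bdry ord0)) M) ->
  is_energy_measure (harm b) (energy_measure (harm b)).
Proof.
move=> /energy_measure_harm_corner hM; apply: is_energy_measure_energy_measure.
pose u (i : nat) : P -> R := harm (unit_bdry (inord i)).
(* The increments d_i of the three basis functions sum to 0, so 2 d_1 d_2 = d_0^2 - d_1^2 - d_2^2.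
   This turns the square of the sum of the b_i d_i into a combination of the d_i^2 with these
   coefficients. *)
pose s (i : nat) : R :=
  nth 0 [:: (b ord0 - b (inord 1)) * (b ord0 - b (inord 2));
    (b (inord 1) - b ord0) * (b (inord 1) - b (inord 2));
    (b (inord 2) - b ord0) * (b (inord 2) - b (inord 1))] i.
have /choice[M hM'] (i : nat) : exists M : {finite_measure set BP -> \bar R},
  is_energy_measure (u i) M by exact: hM.
apply: (@energy_measure_comb _ 3 s u M) => //.
- by move=> i; exact: FS0_harm.
- exact: FS0_harm.
move=> x y Sx Sy; rewrite !big_ord_recl big_ord0 /s /u /= addr0.
rewrite (harm_decomp b Sx) (harm_decomp b Sy).
have -> : inord 0 = ord0 :> 'I_3 by apply/val_inj; rewrite /= inordK.
have hx := sum_harm_unit Sx; have hy := sum_harm_unit Sy.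
set p0 := harm _ x; set q0 := harm _ y.
have -> : p0 = 1 - harm (unit_bdry (inord 1)) x - harm (unit_bdry (inord 2)) x by rewrite /p0; lra.
have -> : q0 = 1 - harm (unit_bdry (inord 1)) y - harm (unit_bdry (inord 2)) y by rewrite /q0; lra.
by ring.
Qed.

Lemma energy0_eq0 c j : energy0 c c <= 0 -> c j = 0 -> forall k, c k = 0.
Proof.
move=> h cj.
have sq (t : R) : t ^+ 2 <= 0 -> t = 0 by move=> ?; apply/eqP; rewrite -sqrf_eq0 eq_le sqr_ge0 andbT.
move: h; rewrite energy0E -!expr2 => h.
set d1 := c ord0 - c (inord 1) in h; set d2 := c ord0 - c (inord 2) in h.
set d3 := c (inord 1) - c (inord 2) in h.
have := sqr_ge0 d1; have := sqr_ge0 d2; have := sqr_ge0 d3 => h3 h2 h1.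
have e1 : c ord0 - c (inord 1) = 0 by apply: sq; rewrite -/d1; lra.
have e2 : c ord0 - c (inord 2) = 0 by apply: sq; rewrite -/d2; lra.
have e k : c k = c ord0.
  have /or3P[/eqP->|/eqP->|/eqP->] // : [|| k == ord0, k == inord 1 | k == inord 2]; last 2 first.
  - by lra.
  - by lra.
  by rewrite -!val_eqE /= !inordK//; case: k => [[|[|[|?]]] ?].
by move=> k; rewrite e -(e j).
Qed.

Lemma cell_energy_eq0 m v : cell_energy m v <= 0 -> (forall j, v (corner j) = 0) ->
  forall x, V0 m x -> v x = 0.
Proof.
elim: m v => [|m ih] v h v0 x; first by move=> [k _ <-].
move=> /V0S[j [y [Vy ->]]].
have hj i : cell_energy m (v \o Fmap i) <= 0.
  move: h; rewrite cell_energyS pmulr_rle0// (bigD1 i)//=.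
  by apply: le_trans; rewrite lerDl; apply: sumr_ge0 => k _; exact: cell_energy_ge0.
apply: (ih (v \o Fmap j)) => // k.
have h0 := le_trans (energy0_le m (v \o Fmap j)) (hj j).
by apply: (energy0_eq0 (j := j) h0); rewrite /= Fmap_corner.
Qed.

Lemma eq0_dense v : {within @S0 R, continuous v} -> (forall m x, V0 m x -> v x = 0) ->
  forall x, S0 x -> v x = 0.
Proof.
move=> /within_continuousP cv v0 x Sx; apply/eqP; apply: contraT => vx.
have [d d0 hd] := cv x Sx `|v x| ltac:(by rewrite normr_gt0).
have [y [[m _ Vy] xy]] := Sx _ (nbhsx_ballx x d d0).
have := hd y (V0_S0 Vy); rewrite -ball_normE /= in xy.
by move=> /(_ xy); rewrite (v0 m y Vy) subr0 ltxx.
Qed.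

Lemma is_harmonic1_harm : is_harmonic1 (harm (unit_bdry ord0) : P -> R).
Proof.
split; [exact: FS0_harm|by move=> j; rewrite harm_corner|].
move=> w /FS0P[cw bw] hw; rewrite energy_harm energyE// lee_fin.
rewrite ler_wpM2l ?addr_ge0 ?hole_limit_ge0//.
apply: le_trans (cell_energy_le_limit 0 bw); rewrite cell_energy0.
by rewrite (_ : w \o corner = unit_bdry ord0)//; apply/funext => j; rewrite /= hw.
Qed.

(** By Pythagoras the difference of two minimisers has energy 0 at every level; it vanishes at the
    corners, hence at all lattice points, and by continuity on S0. *)
Lemma harmonic1E x : S0 x -> harmonic1 x = harm (unit_bdry ord0) x :> R.
Proof.
have [/FS0P[ch bh] hc hmin] : is_harmonic1 (@harmonic1 R).
  by apply: (xgetPex (cst 0)); exists (harm (unit_bdry ord0)); exact: is_harmonic1_harm.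
have := hmin _ (FS0_harm (unit_bdry ord0)) (fun j => harm_corner _ j).
rewrite energy_harm energyE// lee_fin ler_pM2l; last first.
  by have := @hole_limit_ge0 R; lra.
rewrite energy0_unit => hle.
pose v y : R := harmonic1 y - harm (unit_bdry ord0) y.
have v0 m y : V0 m y -> v y = 0.
  apply: cell_energy_eq0; last by move=> j; rewrite /v hc harm_corner subrr.
  rewrite /v cell_energy_sub_harm.
  have -> : @harmonic1 R \o corner = unit_bdry ord0 by apply/funext => j; rewrite /= hc.
  by rewrite energy0_unit; have := cell_energy_le_limit m bh; lra.
move=> Sx; apply/eqP; rewrite -subr_eq0; apply/eqP; apply: (eq0_dense _ v0) Sx.
have [cv _] := FS0B (proj2 (FS0P _) (conj ch bh)) (FS0_harm (unit_bdry ord0)).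
exact: cv.
Qed.

Variable mu : {sigma_finite_measure set BP -> \bar R}.
Hypothesis hmu : is_kusuoka mu.

Local Open Scope charge_scope.

(** The exceptional set is where the inequality of densities fails. Integrated over that very set
    the excess is at most 0, while it is positive pointwise, so the set is null. *)
Lemma Radon_Nikodym_le (Th : {charge set BP -> \bar R}) (M : {finite_measure set BP -> \bar R})
    (s p c : R) : Th `<< mu -> charge_of_finite_measure M `<< mu ->
  (forall A, measurable A -> A `<=` DS -> (s%:E * Th A <= p%:E * M A + c%:E * mu A)%E) ->
  exists N : set BP, [/\ measurable N, N `<=` DS, mu N = 0%E & forall x, S0 x -> ~ N x ->
    s * fine (('d Th '/d mu) x) <= p * fine (('d (charge_of_finite_measure M) '/d mu) x) + c].
Proof.
move=> hT hM h; have mS := @measurable_S0 R.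
set f := 'd Th '/d mu; set g := 'd (charge_of_finite_measure M) '/d mu.
have ff x : f x \is a fin_num by exact: Radon_Nikodym_fin_num.
have gf x : g x \is a fin_num by exact: Radon_Nikodym_fin_num.
have If : mu.-integrable setT f by exact: Radon_Nikodym_integrable.
have Ig : mu.-integrable setT g by exact: Radon_Nikodym_integrable.
pose F x : \bar R := (s%:E * f x - (p%:E * g x + c%:E))%E.
have Slt : (mu DS < +oo)%E by exact: kusuoka_S0_lty.
have mD A : measurable A -> A `<=` DS -> (mu A < +oo)%E.
  by move=> mA AS; apply: le_lt_trans Slt; apply: le_measure; rewrite ?inE.
have Ic A : measurable A -> A `<=` DS -> mu.-integrable A (fun=> c%:E).
  move=> mA AS; apply/integrableP; split; first exact: measurable_cst.
  by rewrite integral_cst// lte_mul_pinfty// mD.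
have IF A : measurable A -> A `<=` DS -> mu.-integrable A F.
  move=> mA AS; apply: integrableB => //; first by apply: integrableZl => //; exact: integrableS If.
  apply: integrableD => //; first by apply: integrableZl => //; exact: integrableS Ig.
  exact: Ic.
pose N : set BP := DS `&` [set x | (0 < F x)%E].
have mN : measurable N.
  have /integrableP[mF _] := IF DS mS (fun _ => id).
  rewrite /N; exact: emeasurable_fun_o_infty.
have NS : N `<=` DS by move=> x [].
have intF : (\int[mu]_(x in N) F x <= 0)%E.
  have INf : mu.-integrable N f by exact: integrableS If.
  have INg : mu.-integrable N g by exact: integrableS Ig.
  have INc : mu.-integrable N (fun=> c%:E) by exact: Ic.
  rewrite integralB//; [|exact: integrableZl|by apply: integrableD => //; exact: integrableZl].
  rewrite integralD//; last exact: integrableZl.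
  rewrite !integralZl// integral_cst// -!Radon_Nikodym_integral//.
  rewrite sube_le0; exact: h.
have F0 x : N x -> (0 <= F x)%E by move=> [_ /ltW].
exists N; split=> //.
  have /integrableP[mF _] := IF N mN NS.
  have : ae_eq mu N F (cst 0%E).
    apply/ae_eq_integral_abs => //; under eq_integral => x xN.
      rewrite gee0_abs; last by apply: F0; rewrite inE in xN.
      over.
    by apply/eqP; rewrite eq_le intF/=; apply: integral_ge0.
  move=> [B [mB B0 hB]]; apply/eqP; rewrite eq_le measure_ge0 andbT -B0.
  apply: le_measure; rewrite ?inE// => x Nx; apply: hB => /= /(_ Nx) Fx0.
  by have [_ /=] := Nx; rewrite Fx0 ltxx.
move=> x Sx nNx; rewrite leNgt; apply/negP => hlt; apply: nNx; split=> //=.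
have -> : F x = (s * fine (f x) - (p * fine (g x) + c))%:E.
  by rewrite EFinB EFinD !EFinM !fineK.
by rewrite lte_fin subr_gt0.
Qed.

Lemma energy_measure_dominated b (M : {finite_measure set BP -> \bar R}) :
  is_energy_measure (harm b) M -> charge_of_finite_measure M `<< mu.
Proof.
move=> hM; have mS := @measurable_S0 R; apply/null_content_dominatesP => A mA A0.
pose B := b ord0 ^+ 2 + b (inord 1) ^+ 2 + b (inord 2) ^+ 2.
have hB k : b k ^+ 2 <= B.
  by rewrite /B -(sum3 (fun i => b i ^+ 2)) (bigD1 k)//= lerDl sumr_ge0// => i _; exact: sqr_ge0.
have mAS : measurable (A `&` DS) by exact: measurableI.
have e : M A = (M (A `\` DS) + M (A `&` DS))%E by exact: measureDI.
have e1 : M (A `\` DS) = 0%E.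
  have [M0 _] := hM; apply/eqP; rewrite eq_le measure_ge0 andbT -M0.
  apply: le_measure; rewrite ?inE; [exact: measurableD|exact: measurableC|].
  by move=> x [].
have e2 : M (A `&` DS) = 0%E.
  apply/eqP; rewrite eq_le measure_ge0 andbT.
  have AS : A `&` DS `<=` DS by move=> x [].
  apply: (le_trans (energy_measure_le_kusuoka hmu hM hB mAS AS)).
  have -> : mu (A `&` DS) = 0%E; last by rewrite mule0.
  apply/eqP; rewrite eq_le measure_ge0 andbT -A0.
  by apply: le_measure; rewrite ?inE// => x [].
by rewrite /charge_of_finite_measure e e1 e2 adde0.
Qed.

Lemma lee_comb_fine (z p c : R) (X Y : \bar R) : X \is a fin_num -> Y \is a fin_num ->
  z <= p * fine X + c * fine Y -> (z%:E <= p%:E * X + c%:E * Y)%E.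
Proof. by move=> /fineK <- /fineK <-; rewrite -!EFinM -EFinD lee_fin. Qed.

Lemma energy_measure2E b A : measurable A ->
  energy_measure2 (harm b) harmonic1 A =
  (4^-1 * (fine (energy_measure (harm b \+ harmonic1) A) -
           fine (energy_measure (harm b \- harmonic1) A)))%:E.
Proof.
move=> mA; rewrite /energy_measure2 /cscale /= /cadd /= /copp /= /charge_of_finite_measure.
by rewrite EFinM EFinB !fineK//; exact: fin_num_measure.
Qed.

Lemma harmD_harmonic1 b (t : R) x : S0 x ->
  harm b x + t * harmonic1 x = harm (fun k => 1 * b k + t * unit_bdry ord0 k) x.
Proof. by move=> Sx; rewrite harmD// mul1r harmonic1E. Qed.

Lemma energy_measure_harmD b :
  energy_measure (harm b \+ harmonic1) = energy_measure (harm (fun k => 1 * b k + 1 * unit_bdry ord0 k))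
  /\ energy_measure (harm b \- harmonic1) =
    energy_measure (harm (fun k => 1 * b k + (-1) * unit_bdry ord0 k)).
Proof.
split; apply: energy_measure_ext => x Sx /=.
  by rewrite -harmD_harmonic1// mul1r.
by rewrite -harmD_harmonic1// mulN1r.
Qed.

Hypothesis hE : exists M : {finite_measure set BP -> \bar R},
  is_energy_measure (harm (unit_bdry ord0)) M.

Lemma energy_measure2_dominated b : energy_measure2 (harm b) harmonic1 `<< mu.
Proof.
apply/null_content_dominatesP => A mA A0; rewrite energy_measure2E//.
have [-> ->] := energy_measure_harmD b.
have h c : energy_measure (harm c) A = 0%E.
  have /null_content_dominatesP := energy_measure_dominated (energy_measure_harm_exists c hE).
  by apply.
have hz c : fine (energy_measure (harm c) A) = 0 by rewrite h.
have e (p q : R) : p = 0 -> q = 0 -> (4^-1 * (p - q))%:E = 0%E :> \bar R.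
  by move=> -> ->; rewrite subrr mulr0.
exact: (e _ _ (hz _) (hz _)).
Qed.

Lemma energy_measure_harmonic1E :
  energy_measure (@harmonic1 R) = energy_measure (harm (unit_bdry ord0)).
Proof. by apply: energy_measure_ext => x Sx; rewrite harmonic1E. Qed.

Lemma sum4 (F : nat -> R) : \sum_(i < 4) F i = F 0 + (F 1 + (F 2 + F 3)).
Proof. by rewrite !big_ord_recl big_ord0 addr0. Qed.

Lemma comb_arith (s t w Z Mm Mp Ma Mb : R) : 0 < t ->
  0 <= s * Mm + (- s * Mp + (2 * t * Ma + 2 / t * Mb)) -> Mb <= w * Z ->
  s * (4^-1 * (Mp - Mm)) <= t / 2 * Ma + w / (2 * t) * Z.
Proof.
move=> t0 h hb; have : 2^-1 / t * Mb <= 2^-1 / t * (w * Z).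
  by apply: ler_wpM2l => //; rewrite divr_ge0// ltW.
rewrite [(2 * t)^-1]invfM; set v := t^-1; move: h; rewrite -/v.
set w1 := s * Mm; set w2 := - s * Mp; have e2 : s * Mp = - w2 by rewrite /w2 mulNr opprK.
have -> : s * (4^-1 * (Mp - Mm)) = 4^-1 * (- w2 - w1) by rewrite -e2 /w1; ring.
have -> : 2^-1 * v * (w * Z) = w * (2^-1 * v) * Z by ring.
have -> : 2 * t * Ma = 4 * (t / 2 * Ma) by field.
have -> : 2 * v * Mb = 4 * (2^-1 * v * Mb) by field.
lra.
Qed.

(* AM-GM: 2 (db)(dh) <= t (dh)^2 + (db)^2 / t for the increments along an edge. *)
Lemma energy_measure2_le b (B t s : R) A : (forall k, b k ^+ 2 <= B) -> 0 < t -> s ^+ 2 = 1 ->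
  measurable A -> A `<=` DS ->
  (s%:E * energy_measure2 (harm b) harmonic1 A <=
   (t / 2)%:E * energy_measure harmonic1 A + (@kusuoka_const R * B / (2 * t))%:E * mu A)%E.
Proof.
move=> hB t0 s1 mA AS; rewrite energy_measure2E// energy_measure_harmonic1E.
have [-> ->] := energy_measure_harmD b.
set bp := (fun k => 1 * b k + 1 * _); set bm := (fun k => 1 * b k + _ * _).
(* The default of [nth] supplies the fourth term, [harm b] with coefficient 2 / t. By polarisation
   the first two terms give a multiple of the mixed measure, and the four together form a square
   since s^2 = 1. *)
pose u (i : nat) := nth (harm b) [:: harm bm; harm bp; harm (unit_bdry ord0)] i.
pose c (i : nat) := nth (2 / t) [:: s; - s; 2 * t] i.
have hu (i : nat) : FS0 (u i).
  by case: i => [|[|[|[|i]]]]; exact: FS0_harm.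
have hM (i : nat) : is_energy_measure (u i) (energy_measure (u i)).
  by case: i => [|[|[|[|i]]]]; exact: energy_measure_harm_exists.
have hc x y : S0 x -> S0 y -> 0 <= \sum_(i < 4) c i * (u i x - u i y) ^+ 2.
  move=> Sx Sy; rewrite !big_ord_recl big_ord0 /c /u /= addr0 /bm /bp !harmD//.
  set p := harm b x; set q := harm b y; set p' := harm _ x; set q' := harm _ y.
  have -> : s * (1 * p + -1 * p' - (1 * q + -1 * q')) ^+ 2 +
    (- s * (1 * p + 1 * p' - (1 * q + 1 * q')) ^+ 2 +
    (2 * t * (p' - q') ^+ 2 + 2 / t * (p - q) ^+ 2)) =
    2 / t * ((p - q) - s * t * (p' - q')) ^+ 2 + 2 * t * (1 - s ^+ 2) * (p' - q') ^+ 2.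
    by field; rewrite gt_eqF.
  by rewrite s1 subrr mulr0 mul0r addr0 mulr_ge0 ?sqr_ge0// divr_ge0 ?ltW.
have h := measure_comb_ge0 hu hM hc mA AS.
rewrite (sum4 (fun i => c i * fine (energy_measure (u i) A))) in h.
have mufin : mu A \is a fin_num.
  rewrite ge0_fin_numE//; apply: le_lt_trans (kusuoka_S0_lty hmu).
  by apply: le_measure; rewrite ?inE//; exact: measurable_S0.
have hb : fine (energy_measure (harm b) A) <= kusuoka_const * B * fine (mu A).
  rewrite -lee_fin EFinM fineK//; last exact: fin_num_measure.
  by rewrite fineK//; exact: (energy_measure_le_kusuoka hmu (energy_measure_harm_exists b hE) hB mA AS).
rewrite -EFinM; apply: lee_comb_fine => //; first exact: fin_num_measure.
exact: (comb_arith t0 h hb).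
Qed.

(** The optimal parameter is the square root of K / g. A rational one between it and its double
    costs at most the factor 2. *)
Lemma norm_le_sqrt (f g K : R) : 0 < K -> 0 < g ->
  (forall q : rat, 0 < ratr q :> R ->
     `|f| <= ratr q / 2 * g + K / (2 * ratr q)) ->
  `|(- Num.sqrt g)^-1 * f| <= 2 * Num.sqrt K.
Proof.
move=> K0 g0 h; set k := Num.sqrt K; set w := Num.sqrt g.
have k0 : 0 < k by rewrite sqrtr_gt0.
have w0 : 0 < w by rewrite sqrtr_gt0.
have eK : K = k * k by rewrite -expr2 sqr_sqrtr// ltW.
have eg : g = w * w by rewrite -expr2 sqr_sqrtr// ltW.
have [q] : exists q : rat, k / w < ratr q < 2 * (k / w).
  have kw : 0 < k / w by rewrite divr_gt0.
  have [q] := @rat_in_itvoo R (k / w) (2 * (k / w)) ltac:(lra).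
  by rewrite in_itv /= => ?; exists q.
set t : R := ratr q => /andP[t1 t2].
have t0 : 0 < t by apply: lt_trans t1; rewrite divr_gt0.
rewrite normrM normfV normrN (gtr0_norm w0) mulrC ler_pdivrMr//.
apply: (le_trans (h q t0)); rewrite -/t eK eg.
have a1 : t * w <= 2 * k by rewrite -ler_pdivlMr// -mulrA ltW.
have a2 : k / t <= w by rewrite ler_pdivrMr// mulrC -ler_pdivrMr// ltW.
have b1 : t * w * w <= 2 * k * w by rewrite ler_wpM2r// ltW.
have b2 : k / t * k <= w * k by rewrite ler_wpM2r// ltW.
rewrite [(2 * t)^-1]invfM.
have -> : k * k * (2^-1 / t) = 2^-1 * (k / t * k) by ring.
have -> : t / 2 * (w * w) = 2^-1 * (t * w * w) by ring.
have : 0 < k * w by rewrite mulr_gt0.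
lra.
Qed.

Lemma grad0_harm_bound_exists b (B : R) : 0 < B -> (forall k, b k ^+ 2 <= B) ->
  exists N : set BP, [/\ measurable N, N `<=` DS, mu N = 0%E & forall x, S0 x -> ~ N x ->
    `|grad0 mu (harm b) x| <= 2 * Num.sqrt (kusuoka_const * B)].
Proof.
move=> B0 hB; have K0 : 0 < kusuoka_const * B by rewrite mulr_gt0// kusuoka_const_gt0.
have hT := energy_measure2_dominated b.
have hM : charge_of_finite_measure (energy_measure (@harmonic1 R)) `<< mu.
  rewrite energy_measure_harmonic1E.
  exact: (energy_measure_dominated (energy_measure_harm_exists (unit_bdry ord0) hE)).
set f := 'd (energy_measure2 (harm b) harmonic1) '/d mu.
set g := 'd (charge_of_finite_measure (energy_measure (@harmonic1 R))) '/d mu.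
(* The boolean is the sign s in front of the mixed density; both signs together bound its absolute
   value. *)
have /choice[N hN] (i : rat * bool) : exists N : set BP, [/\ measurable N, N `<=` DS, mu N = 0%E &
    forall x, S0 x -> ~ N x -> 0 < ratr i.1 :> R ->
      (-1) ^+ i.2 * fine (f x) <= ratr i.1 / 2 * fine (g x) +
        kusuoka_const * B / (2 * ratr i.1)].
  case: i => q e /=; have [q0|q0] := boolP (0 < ratr q :> R); last first.
    by exists set0; rewrite measure0; split.
  have hle A : measurable A -> A `<=` DS ->
     (((-1) ^+ e)%:E * energy_measure2 (harm b) harmonic1 A <=
      (ratr q / 2)%:E * energy_measure harmonic1 A + (kusuoka_const * B / (2 * ratr q))%:E * mu A)%E.
    by move=> mA AS; apply: energy_measure2_le => //; rewrite -exprM mulnC exprM sqrrN expr1n expr1n.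
  have [N [mN NS N0 hN]] := Radon_Nikodym_le hT hM hle.
  by exists N; split=> // x Sx nN _; exact: hN.
have [mN N0] : measurable (\bigcup_i N i) /\ mu (\bigcup_i N i) = 0%E.
  by apply: null_bigcup => i; have [] := hN i.
exists (\bigcup_i N i); split=> //.
  by move=> x [i _]; have [_ + _ _] := hN i; exact.
move=> x Sx nN; rewrite /grad0 /grad_h1 -/g -/f.
(* Where the density of h_1 is not positive, its root is 0 and so is the inverse, by convention; the
   gradient is then 0. *)
have [g0|g0] := leP (fine (g x)) 0.
  by rewrite ler0_sqrtr// oppr0 invr0 mul0r normr0 mulr_ge0.
apply: norm_le_sqrt => // q q0.
have [e1|e1] := leP 0 (fine (f x)).
  rewrite ger0_norm//; have [_ _ _ h] := hN (q, false).
  by have := h x Sx (fun h => nN (ex_intro2 _ _ _ I h)) q0; rewrite expr0 mul1r.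
rewrite ltr0_norm//; have [_ _ _ h] := hN (q, true).
by have := h x Sx (fun h => nN (ex_intro2 _ _ _ I h)) q0; rewrite expr1 mulN1r.
Qed.

End GradientBound.

Section GradientBoundHarm.
Context {R : realType}.
Local Notation P := ('rV[R]_2).
Local Notation BP := (borel P).
Local Notation DS := (@S0 R : set BP).
Variable mu : {sigma_finite_measure set BP -> \bar R}.
Hypothesis hmu : is_kusuoka mu.

(* Without an energy measure of [h_1] its gradient, hence every gradient, is 0. *)
Lemma grad0_harm_bound (b : 'I_3 -> R) (B : R) : 0 < B -> (forall k, b k ^+ 2 <= B) ->
  exists N : set BP, [/\ measurable N, N `<=` DS, mu N = 0%E & forall x, S0 x -> ~ N x ->
    `|grad0 mu (harm b) x| <= 2 * Num.sqrt (kusuoka_const * B)].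
Proof.
move=> B0 hB.
have [hE|nhE] := pselect (exists M : {finite_measure set BP -> \bar R},
  is_energy_measure (harm (unit_bdry ord0)) M); first exact: grad0_harm_bound_exists.
have e : energy_measure (@harmonic1 R) = mzero.
  rewrite energy_measure_harmonic1E /energy_measure; by case: pselect.
have hM : charge_of_finite_measure (energy_measure (@harmonic1 R)) `<< mu.
  by rewrite e; apply/null_content_dominatesP.
(* With the zero measure for [harmonic1], its density is at most 0 almost everywhere, so that the
   inverse root is 0 there. *)
have [|N [mN NS N0 hN]] := @Radon_Nikodym_le _ _ hmu _ _ 1 0 0 hM hM.
  by move=> A mA AS; rewrite mul1e !mul0e add0e e.
exists N; split=> // x Sx nN; rewrite /grad0 /grad_h1.
have := hN x Sx nN; rewrite mul1r mul0r add0r => h.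
by rewrite ler0_sqrtr// oppr0 invr0 mul0r normr0 mulr_ge0.
Qed.

End GradientBoundHarm.

(** * Cells of the unbounded gasket *)

Section Cells.
Context {R : realType}.
Local Notation P := ('rV[R]_2).
Implicit Types (x y : P) (k : nat) (m : nat) (i j : 'I_3) (s : seq 'I_3) (g : P -> R).

Lemma corner0 : corner ord0 = 0 :> P.
Proof. by apply: bc_ext => i; rewrite bc_corner; case: i => [[|[|[|?]]] ?] //; rewrite /bc /= !mxE /=; ring. Qed.

Lemma Fmap0 x : Fmap ord0 x = 2^-1 *: x.
Proof. by rewrite /Fmap corner0 addr0. Qed.

Lemma cell_offsetS k :
  cell_offset k = corner (inord (k %% 3)%N) + 2 *: cell_offset (k %/ 3)%N :> P.
Proof.
rewrite /cell_offset; case: k => [|k].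
  rewrite div0n mod0n !big_ord0 scaler0 addr0.
  by rewrite -corner0; congr corner; apply/val_inj; rewrite /= inordK.
rewrite big_ord_recl expr0 scale1r expn0 divn1; congr (_ + _).
rewrite scaler_sumr; set q := (k.+1 %/ 3)%N.
have qk : (q <= k)%N by rewrite /q; lia.
(* The offset of k is a sum of k terms, more than k has digits; the surplus digits are 0 and
   contribute p_1 = 0. *)
rewrite (big_ord_widen_cond k xpredT (fun l => 2 *: (2 ^+ l *: corner (inord ((q %/ 3 ^ l) %% 3)%N))) qk).
rewrite [RHS]big_mkcond /=; apply: eq_bigr => l _.
rewrite /bump /= add1n expnS divnMA -/q scalerA -exprS; case: ifPn => //; rewrite -leqNgt => ql.
rewrite divn_small; last by apply: (leq_ltn_trans ql); exact: ltn_expl.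
by rewrite mod0n (_ : inord 0 = ord0) ?corner0 ?scaler0//; apply/val_inj; rewrite /= inordK.
Qed.

Lemma cell_offset_digit k j : cell_offset (3 * k + j)%N = corner j + 2 *: cell_offset k :> P.
Proof.
rewrite cell_offsetS; have j3 := ltn_ord j.
have -> : ((3 * k + j) %% 3)%N = j by lia.
have -> : ((3 * k + j) %/ 3)%N = k by lia.
by rewrite inord_val.
Qed.

Definition word_index s : nat := foldl (fun a j => 3 * a + j)%N 0 s.

(** Links the two descriptions of cells: blown up to unit size, the cell of a word is the unit cell
    whose index has that word as its base 3 digits. *)
Lemma Fseq_offset s y : 2 ^+ size s *: Fseq s y = y + cell_offset (word_index s).
Proof.
elim/last_ind: s y => [|s j ih] y.
  by rewrite expr0 scale1r /cell_offset big_ord0 addr0.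
rewrite size_rcons exprS -scalerA Fseq_rcons /= ih /word_index foldl_rcons -/(word_index s).
rewrite cell_offset_digit scalerDr /Fmap scalerA divff// scale1r addrA.
by [].
Qed.

Lemma word_indexP m k : (k < 3 ^ m)%N -> exists s, size s = m /\ word_index s = k.
Proof.
elim: m k => [|m ih] k; first by rewrite expn0 ltnS leqn0 => /eqP ->; exists [::].
rewrite expnS => km; have [|s [hs hi]] := ih (k %/ 3)%N; first by lia.
exists (rcons s (inord (k %% 3)%N)); rewrite size_rcons hs; split=> //.
rewrite /word_index foldl_rcons -/(word_index s) hi inordK; lia.
Qed.

Lemma bc_add_corner i j x : bc i (x + corner j) = bc i x + (i == j)%:R - (i == ord0)%:R.
Proof.
case: i => [[|[|[|?]]] ?] //; case: j => [[|[|[|?]]] ?] //;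
  by rewrite /bc /= !mxE /= -?/s3; field.
Qed.

(** Offsets shift barycentric coordinates by integers, nonnegative except for the first one. The
    meeting of two cells is decided from these integers. *)
Lemma bc_offset k : exists z : 'I_3 -> int, (forall i, i != ord0 -> 0 <= z i) /\
  forall i x, bc i (x + cell_offset k) = bc i x + (z i)%:~R.
Proof.
have [m] := ubnP k; elim: m k => // m ih k; rewrite ltnS => km.
have [->|k0] := posnP k.
  by exists (fun=> 0); split=> // i x; rewrite /cell_offset big_ord0 !addr0.
have [|z [z0 hz]] := ih (k %/ 3)%N; first by lia.
pose j : 'I_3 := inord (k %% 3)%N.
exists (fun i => z i + z i + (i == j)%:R - (i == ord0)%:R); split=> [i i0|i x].
  by rewrite (negbTE i0) subr0 !addr_ge0 ?z0.
rewrite cell_offsetS -/j scaler_nat mulr2n !addrA !hz bc_add_corner.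
by rewrite !rmorphD rmorphN /= !rmorph_nat; ring.
Qed.

Lemma cell_offset_inj : injective (@cell_offset R).
Proof.
have h m k k' : (k < 3 ^ m)%N -> (k' < 3 ^ m)%N -> cell_offset k = cell_offset k' :> P -> k = k'.
  elim: m k k' => [|m ih] k k'; first by rewrite expn0 !ltnS !leqn0 => /eqP -> /eqP ->.
  rewrite expnS => km km' e.
  have [z [_ hz]] := bc_offset (k %/ 3); have [z' [_ hz']] := bc_offset (k' %/ 3).
  have e1 : inord (k %% 3)%N = inord (k' %% 3)%N :> 'I_3.
    have p i : (i == inord (k %% 3)%N) = (i == inord (k' %% 3)%N) :> bool.
      have := congr1 (bc i) (congr1 (fun v => 0 + v) e).
      rewrite (cell_offsetS k) (cell_offsetS k') !scaler_nat !mulr2n !addrA !hz !hz' !bc_add_corner.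
      (* Apart from the even parts 2 z and 2 z' only the indicators of the last digits remain, so
         parity identifies these digits. *)
      move=> e2; have : (((i == inord (k %% 3)%N)%:R : int) + z i + z i =
        (i == inord (k' %% 3)%N)%:R + z' i + z' i)%R.
        apply: (@intr_inj R); rewrite !rmorphD /= !rmorph_nat; lra.
      by case: (i == _); case: (i == _) => //=; lia.
    by apply/eqP; rewrite -p.
  have kk : (k %% 3 = k' %% 3)%N by have := congr1 val e1; rewrite /= !inordK//; lia.
  have e2 : cell_offset (k %/ 3) = cell_offset (k' %/ 3) :> P.
    move: e; rewrite (cell_offsetS k) (cell_offsetS k') kk => /addrI.
    by move/(congr1 (fun v => 2^-1 *: v)); rewrite !scalerA mulVf// !scale1r.
  have := ih _ _ _ _ e2; move=> /(_ ltac:(lia) ltac:(lia)); lia.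
move=> k k'; apply: (h (maxn k k')).
  by apply: (leq_ltn_trans (leq_maxl k k')); exact: ltn_expl.
by apply: (leq_ltn_trans (leq_maxr k k')); exact: ltn_expl.
Qed.

Lemma bc_ge0 i x : S0 x -> 0 <= bc i x.
Proof. by move=> /S0_triangle; exact. Qed.

Lemma bc1_corner i x : S0 x -> bc i x = 1 -> x = corner i.
Proof.
move=> Sx h; apply: bc_ext => l; rewrite bc_corner; have [->//|li] := eqVneq l i.
have := sum_bc x; rewrite (bigD1 i)//= h (bigD1 l)//=.
have : 0 <= \sum_(t | (t != i) && (t != l)) bc t x by apply: sumr_ge0 => t _; exact: bc_ge0.
have := bc_ge0 l Sx; lra.
Qed.

(** Two distinct shifts differ by at least 1 in some coordinate. As coordinates on S0 lie between 0
    and 1, the point has that coordinate equal to 1 and is a corner. *)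
Lemma offset_meet k k' y y' : S0 y -> S0 y' -> k != k' ->
  y + cell_offset k = y' + cell_offset k' -> exists i, y' = corner i.
Proof.
move=> Sy Sy' kk e; have [z [_ hz]] := bc_offset k; have [z' [_ hz']] := bc_offset k'.
have e1 i : bc i y' = bc i y + (z i - z' i)%:~R.
  by rewrite rmorphB /= addrA -hz e hz' addrK.
have [i hi] : exists i, z i - z' i > 0.
  apply: contrapT => /forallNP h.
  have h0 i : z i - z' i <= 0 by rewrite leNgt; apply/negP; exact: h.
  have s0 : \sum_i (z i - z' i)%:~R = 0 :> R.
    have := sum_bc y'; rewrite (eq_bigr _ (fun i _ => e1 i)) big_split /= sum_bc; lra.
  have zz i : z i - z' i = 0.
    have h1 : forall l, true -> 0 <= - (z l - z' l)%:~R :> R.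
      by move=> l _; rewrite oppr_ge0 -(mulr0z 1) ler_int.
    have := psumr_eq0P h1; rewrite sumrN s0 oppr0 => /(_ erefl i isT) /eqP.
    by rewrite oppr_eq0 intr_eq0 => /eqP.
  have yy : y = y' by apply: bc_ext => i; rewrite e1 zz addr0.
  by move: e; rewrite yy => /addrI /cell_offset_inj /eqP; rewrite (negbTE kk).
exists i; apply: bc1_corner => //.
have h1 : 1 <= (z i - z' i)%:~R :> R by rewrite -(mulr1z 1) ler_int; lia.
have := e1 i; have := bc_le1 i (S0_triangle Sy'); have := bc_ge0 i Sy; lra.
Qed.

Lemma bc_opp i x : i != ord0 -> bc i (- x) = - bc i x :> R.
Proof. by case: i => [[|[|[|?]]] ?] //; rewrite /bc /= !mxE /= => _; ring. Qed.

(** The coordinates other than the first are nonnegative on one half of the gasket and nonpositive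
    on the other, so the halves meet at the origin only. *)
Lemma offset_opp_meet k k' y y' : S0 y -> S0 y' ->
  y + cell_offset k = - y' - cell_offset k' -> y' = corner ord0.
Proof.
move=> Sy Sy' e; have [z [z0 hz]] := bc_offset k; have [z' [z0' hz']] := bc_offset k'.
have h i : i != ord0 -> bc i y' = 0.
  move=> i0; have := congr1 (bc i) e; rewrite hz -opprD bc_opp// hz'.
  have h1 : 0 <= (z i)%:~R :> R by rewrite -(mulr0z 1) ler_int z0.
  have h2 : 0 <= (z' i)%:~R :> R by rewrite -(mulr0z 1) ler_int z0'.
  have := bc_ge0 i Sy; have := bc_ge0 i Sy'; lra.
apply: bc1_corner => //; have := sum_bc y'; rewrite (bigD1 ord0)//= big1 ?addr0//.
Qed.

Lemma tau_meet (p q : int) y y' : S0 y -> S0 y' -> p != q -> tau p y = tau q y' ->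
  exists i, y' = corner i.
Proof.
case: p q => k [] k' Sy Sy' kk /= e.
- by apply: (offset_meet Sy Sy' _ e); apply: contra kk => /eqP ->.
- by exists ord0; exact: (offset_opp_meet Sy Sy' e).
- exists ord0; apply: (offset_opp_meet (k := k) (k' := k') Sy Sy').
  by apply: oppr_inj; rewrite opprD e opprD !opprK.
- apply: (offset_meet Sy Sy' _ (k := k) (k' := k')).
    by apply: contra kk => /eqP ->.
  by apply: oppr_inj; rewrite !opprD.
Qed.

End Cells.

(** * Piecewise harmonic functions on the whole gasket *)

Section CellTest.
Context {R : realType}.
Local Notation P := ('rV[R]_2).
Implicit Types (x y : P) (k : nat) (m : nat) (i j : 'I_3) (s : seq 'I_3) (g : P -> R).

Definition shrink m x : P := 2^-1 ^+ m *: x.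

Definition expand m x : P := 2 ^+ m *: x.

Lemma expandK m : cancel (expand m) (shrink m).
Proof. by move=> x; rewrite /expand /shrink scalerA -exprMn mulVf// expr1n scale1r. Qed.

Lemma shrinkK m : cancel (shrink m) (expand m).
Proof. by move=> x; rewrite /expand /shrink scalerA -exprMn divff// expr1n scale1r. Qed.

Lemma shrinkS m x : shrink m.+1 x = Fmap ord0 (shrink m x).
Proof. by rewrite Fmap0 /shrink scalerA exprS. Qed.

Lemma shrink_iter m x : iter m (Fmap ord0) x = shrink m x.
Proof. by elim: m => [|m /= ->]; [rewrite /shrink expr0 scale1r|rewrite shrinkS]. Qed.

Lemma shrink_continuous m : continuous (shrink m).
Proof. by move=> x; apply: (@cvgZl_tmp _ _ _ (nbhs x)); exact: cvg_id. Qed.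

Definition orthant : set P := [set x | exists m, S0 (shrink m x)].

Lemma shrink_S0_le m n x : (m <= n)%N -> S0 (shrink m x) -> S0 (shrink n x).
Proof.
move=> /subnKC <-; elim: (n - m)%N => [|d ih] h; first by rewrite addn0.
by rewrite addnS shrinkS; apply: S0_Fmap; exact: ih.
Qed.

Lemma bc_shrink m x : bc ord0 (shrink m x) = 1 - 2^-1 ^+ m * (1 - bc ord0 x).
Proof.
have -> : shrink m x = 2^-1 ^+ m *: x + (1 - 2^-1 ^+ m) *: corner ord0.
  by rewrite corner0 scaler0 addr0.
rewrite bc_aff; last by rewrite addrC subrK.
by rewrite bc_corner eqxx mulr1; set q := _ ^+ m; ring.
Qed.

(** Going down from a large dilate, the point stays in the first subcell as long as its first
    coordinate is at least 1/2, which the bound guarantees. *)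
Lemma shrink_S0_bc m x : orthant x -> 1 - bc ord0 x <= 2 ^+ m -> S0 (shrink m x).
Proof.
move=> [n Sn] h; have [mn|nm] := leqP m n; last by apply: shrink_S0_le Sn; exact: ltnW.
move: Sn; rewrite -(subnKC mn); elim: (n - m)%N => [|d ih]; first by rewrite addn0.
rewrite addnS => Sd; apply: ih.
rewrite -(FmapK ord0 (shrink (m + d) x)) -shrinkS; apply: S0_Gmap => //.
rewrite bc_shrink exprS exprD.
have h1 : 2^-1 ^+ m * (1 - bc ord0 x) <= 1.
  by rewrite exprVn mulrC ler_pdivrMr ?mul1r// exprn_gt0.
have h2 : 2^-1 ^+ d <= 1 :> R by apply: exprn_ile1; lra.
have h3 : 2^-1 ^+ d * (2^-1 ^+ m * (1 - bc ord0 x)) <= 1.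
  by apply: le_trans h2; rewrite -[leRHS]mulr1; apply: ler_wpM2l => //; exact: exprn_ge0.
rewrite -mulrA [_ ^+ m * _]mulrC -[_ * _ * (1 - _)]mulrA; lra.
Qed.

(** Near each point one dilate of S0 suffices, which reduces closedness and continuity to the
    compact cell. *)
Lemma orthant_near x : exists m, \forall y \near x, orthant y -> S0 (shrink m y).
Proof.
have [m hm] := pow2V_lt (e := (2 + `|bc ord0 x|)^-1) ltac:(by rewrite invr_gt0 ltr_pwDl).
exists m.
have : \forall y \near x, `|bc ord0 x - bc ord0 y| < 1.
  by have /cvgrPdist_lt := @bc_continuous R ord0 x; apply.
apply: filterS => y hy oy; apply: shrink_S0_bc => //.
move: hm; rewrite ltf_pV2 ?posrE ?exprn_gt0// ?ltr_pwDl// => /ltW; apply: le_trans.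
have := ler_norm (bc ord0 x - bc ord0 y); have := ler_norm (- bc ord0 x); rewrite normrN; lra.
Qed.

Lemma closed_orthant : closed orthant.
Proof.
move=> x clx; have [m hm] := orthant_near x; exists m.
apply: (preimage_closed (@shrink_continuous m) closed_S0) => B hB.
have [y [oy [/(_ oy) Sy By]]] := clx _ (filterI hm hB).
by exists y.
Qed.

(** Harmonic on each unit cell with the values of g at its vertices. The level m is any one whose
    dilate contains x: the spline of level m.+1 restricts to the one of level m on the first
    subcell. *)
Definition orthant_fun g x : R :=
  let m := xget 0%N [set m | S0 (shrink m x)] in pharm m (g \o expand m) (shrink m x).

Lemma orthant_funE m g x : S0 (shrink m x) ->
  orthant_fun g x = pharm m (g \o expand m) (shrink m x).
Proof.
have step d n : S0 (shrink n x) -> pharm (n + d) (g \o expand (n + d)) (shrink (n + d) x) =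
    pharm n (g \o expand n) (shrink n x).
  move=> Sn; elim: d => [|d ih]; first by rewrite addn0.
  rewrite addnS -ih [in LHS]shrinkS pharm_Fmap; last by apply: shrink_S0_le Sn; exact: leq_addr.
  congr (pharm _ _ _); apply/funext => y; rewrite /= /expand Fmap0 scalerA exprSr.
  by rewrite -mulrA divff// mulr1.
move=> Sm; rewrite /orthant_fun; set n := xget _ _.
have Sn : S0 (shrink n x) by apply: (xgetPex 0%N (P := [set m | S0 (shrink m x)])); exists m.
have [mn|nm] := leqP m n.
  by rewrite -(subnKC mn) step.
by rewrite -(subnKC (ltnW nm)) step.
Qed.

Lemma orthant_fun_continuous g : {within orthant, continuous (orthant_fun g)}.
Proof.
apply/within_continuousP => x ox e e0.
have [m hm] := orthant_near x.
have Sx : S0 (shrink m x) by move/nbhs_singleton: hm => /(_ ox).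
have /within_continuousP/(_ _ Sx e e0)[d d0 hd] := @pharm_continuous R m (g \o expand m).
have /nbhs_ballP[d' /= d0' hd'] := hm.
exists (Num.min d d'); first by rewrite lt_min d0 d0'.
move=> y oy; rewrite lt_min => /andP[xy xy'].
have Sy : S0 (shrink m y) by apply: hd' => //; rewrite -ball_normE.
rewrite (orthant_funE g Sx) (orthant_funE g Sy); apply: hd => //.
rewrite /shrink -scalerBr normrZ ger0_norm ?exprn_ge0//.
apply: le_lt_trans xy; rewrite -[leRHS]mul1r ler_wpM2r// exprn_ile1//; lra.
Qed.

Lemma shrink_offset s y : shrink (size s) (y + cell_offset (word_index s)) = Fseq s y.
Proof. by rewrite -Fseq_offset -/(expand _ _) expandK. Qed.

Lemma orthant_fun_cell g k y : S0 y ->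
  orthant_fun g (y + cell_offset k) = harm (fun i => g (corner i + cell_offset k)) y.
Proof.
move=> Sy; have [s [_ <-]] := word_indexP (ltn_expl k (isT : (1 < 3)%N)).
rewrite (@orthant_funE (size s)); last by rewrite shrink_offset; exact: S0_Fseq.
rewrite shrink_offset pharm_Fseq//; congr (harm _ y); apply/funext => i /=.
by rewrite -shrink_offset shrinkK.
Qed.

Lemma orthant_cell x : orthant x -> exists k y, S0 y /\ x = y + cell_offset k.
Proof.
move=> [m /(S0_cover_words m)[s [hs [y [Sy e]]]]]; exists (word_index s), y; split=> //.
by rewrite -Fseq_offset hs -e -/(expand _ _) shrinkK.
Qed.

Lemma orthant_offset k y : S0 y -> orthant (y + cell_offset k).
Proof.
move=> Sy; have [s [_ <-]] := word_indexP (ltn_expl k (isT : (1 < 3)%N)).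
by exists (size s); rewrite shrink_offset; exact: S0_Fseq.
Qed.

Lemma gasketE x : gasket x <-> orthant x \/ orthant (- x).
Proof.
have e m : shrink m (- x) = - shrink m x by rewrite /shrink scalerN.
split=> [[m _ [|[y Sy h]]]|[[m Sm]|[m]]].
- by rewrite shrink_iter; left; exists m.
- by move: h; rewrite shrink_iter => h; right; exists m; rewrite e -h opprK.
- by exists m => //; left; rewrite shrink_iter.
- by rewrite e => Sm; exists m => //; right; exists (- shrink m x) => //; rewrite opprK shrink_iter.
Qed.

Lemma gasket_cell x : gasket x -> exists (p : int) y, S0 y /\ x = tau p y.
Proof.
move=> /gasketE[/orthant_cell[k [y [Sy ->]]]|/orthant_cell[k [y [Sy e]]]].
  by exists (Posz k), y.
by exists (Negz k), y; split => //=; rewrite -opprD -e opprK.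
Qed.

Lemma gasket_tau (p : int) y : S0 y -> gasket (tau p y).
Proof.
case: p => k Sy; apply/gasketE; first by left; exact: orthant_offset.
by right; rewrite /= opprD !opprK; exact: orthant_offset.
Qed.

Lemma orthant_bc_ge0 i x : i != ord0 -> orthant x -> 0 <= bc i x.
Proof.
move=> i0 /orthant_cell[k [y [Sy ->]]]; have [z [z0 hz]] := @bc_offset R k.
by rewrite hz addr_ge0 ?bc_ge0// -(mulr0z 1) ler_int z0.
Qed.

Lemma orthant_opp x : orthant x -> orthant (- x) -> x = 0.
Proof.
move=> ox onx; have h i : i != ord0 -> bc i x = 0.
  move=> i0; have := orthant_bc_ge0 i0 ox; have := orthant_bc_ge0 i0 onx.
  by rewrite bc_opp//; lra.
rewrite -corner0; apply: bc_ext => i; rewrite bc_corner; have [->|/h//] := eqVneq i ord0.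
by have := sum_bc x; rewrite (bigD1 ord0)//= big1 ?addr0.
Qed.

Lemma orthant_fun0 g : orthant_fun g 0 = g 0.
Proof.
have e : shrink 0 (0 : P) = corner ord0 by rewrite /shrink scaler0 corner0.
rewrite (@orthant_funE 0); last by rewrite e; exact: S0_corner.
by rewrite e pharm_corner /= /expand corner0 scaler0.
Qed.

(** The negative half is reached through x -> - x. The two definitions overlap at the origin, where
    both give g 0. *)
Definition gasket_fun g x : R :=
  if pselect (orthant x) then orthant_fun g x else orthant_fun (g \o -%R) (- x).

Lemma gasket_funE g x : orthant x -> gasket_fun g x = orthant_fun g x.
Proof. by rewrite /gasket_fun; case: pselect. Qed.

Lemma gasket_funN g x : orthant (- x) -> gasket_fun g x = orthant_fun (g \o -%R) (- x).
Proof.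
rewrite /gasket_fun; case: pselect => [ox|no] onx; last by [].
have x0 := orthant_opp ox onx.
have e : orthant_fun g x = orthant_fun (g \o -%R) (- x) by rewrite x0 oppr0 !orthant_fun0 /= oppr0.
exact: e.
Qed.

Lemma gasket_fun_tau g (p : int) y : S0 y ->
  gasket_fun g (tau p y) = harm (g \o tau p \o corner) y.
Proof.
case: p => k Sy /=; first by rewrite gasket_funE ?orthant_fun_cell//; exact: orthant_offset.
have e : - (- y - cell_offset k) = y + cell_offset k by rewrite opprD !opprK.
rewrite gasket_funN; last by rewrite e; exact: orthant_offset.
rewrite e orthant_fun_cell//; congr (harm _ y); apply/funext => i /=.
by rewrite opprD.
Qed.

Lemma gasket_fun_continuous g : {within gasket, continuous (gasket_fun g)}.
Proof.
have -> : gasket = orthant `|` -%R @^-1` orthant.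
  by apply/seteqP; split=> x; rewrite gasketE.
apply: withinU_continuous; [exact: closed_orthant| |..].
- apply: preimage_closed closed_orthant => x.
  by apply: (@cvgN _ _ _ (nbhs x)); exact: cvg_id.
- apply/within_continuousP => x ox e e0.
  have /within_continuousP/(_ _ ox e e0)[d d0 hd] := @orthant_fun_continuous g.
  by exists d => // y oy xy; rewrite (gasket_funE g ox) (gasket_funE g oy); exact: hd.
- apply/within_continuousP => x ox e e0.
  have /within_continuousP/(_ _ ox e e0)[d d0 hd] := @orthant_fun_continuous (g \o -%R).
  exists d; first exact: d0.
  move=> y oy xy; rewrite (gasket_funN g ox) (gasket_funN g oy); apply: (hd _ oy).
  by rewrite -opprD normrN.
Qed.

End CellTest.

(** * Norms of piecewise harmonic functions *)

Section LnormBounds.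
Local Open Scope ereal_scope.
Context d (T : measurableType d) (R : realType) (M : {measure set T -> \bar R}).

Lemma Lnorm_le_indic (f : T -> R) (A : set T) (p : R) : (0 < p)%R -> measurable A ->
  (forall x, `|f x| <= \1_A x)%R -> Lnorm M p%:E (EFin \o f) <= M A `^ p^-1.
Proof.
move=> p0 mA h; have i0 : 0 <= \int[M]_x (`|(EFin \o f) x| `^ p).
  by apply: integral_ge0 => x _; exact: poweR_ge0.
rewrite unlock /Lnorm; apply: gt0_ler_poweR; first by rewrite invr_ge0 ltW.
- by rewrite in_itv /= leey andbT; exact: i0.
- by rewrite in_itv/= leey andbT.
rewrite -[leRHS]mul1e -integral_cst// [leRHS]integral_mkcond.
apply: le_integral_ge0 => x _; first exact: poweR_ge0.
change (`|f x|%:E `^ p <= (cst 1 \_ A) x).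
rewrite poweR_EFin patchE; have := h x; rewrite indicE; case: ifPn => xA /= fx.
  rewrite lee_fin; have -> : 1%R = (1 `^ p)%R :> R by rewrite powR1.
  by apply: ge0_ler_powR; rewrite ?nnegrE// ltW.
have -> : f x = 0%R by apply/eqP; rewrite -normr_le0.
by rewrite normr0 powR0// gt_eqF.
Qed.

Lemma Lnorm_ge_indic (f : T -> R) (A : set T) (p : R) : (0 < p)%R -> measurable A ->
  (forall x, A x -> f x = 1)%R -> M A `^ p^-1 <= Lnorm M p%:E (EFin \o f).
Proof.
move=> p0 mA h; have i0 : 0 <= \int[M]_x (`|(EFin \o f) x| `^ p).
  by apply: integral_ge0 => x _; exact: poweR_ge0.
rewrite unlock /Lnorm; apply: gt0_ler_poweR; first by rewrite invr_ge0 ltW.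
- by rewrite in_itv/= leey andbT.
- by rewrite in_itv /= leey andbT; exact: i0.
rewrite -[leLHS]mul1e -integral_cst// [leLHS]integral_mkcond.
apply: le_integral_ge0 => x _; rewrite patchE; case: ifPn => //; rewrite ?poweR_ge0//.
by rewrite inE => /h fx; change (1 <= `|f x|%:E `^ p); rewrite fx normr1 poweR1r.
Qed.

Lemma Lnorm_pinfty_le (f : T -> R) (A : set T) : (forall x, `|f x| <= \1_A x)%R ->
  Lnorm M +oo (EFin \o f) <= 1.
Proof.
move=> h; rewrite unlock /Lnorm; case: ifP => // _.
apply/ess_supP; apply: nearW => x /=; rewrite lee_fin; apply: le_trans (h x) _.
by rewrite indicE; case: (_ \in _).
Qed.

(** The bound is completed by the value +oo on N, which makes it hold everywhere and adds nothing to
    the integral. *)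
Lemma integral_le_indic_null (f : T -> \bar R) (D A N : set T) (c : R) : (0 <= c)%R ->
  measurable A -> measurable N -> M N = 0 -> (forall x, D x -> 0 <= f x) ->
  (forall x, D x -> ~ N x -> f x <= (c * \1_A x)%:E) ->
  \int[M]_(x in D) f x <= c%:E * M A.
Proof.
move=> c0 mA mN N0 f0 h; pose g x := (cst c%:E \_ A) x + (cst +oo \_ N) x.
apply: (@le_trans _ _ (\int[M]_x g x)).
  rewrite integral_mkcond; apply: le_integral_ge0 => x _.
    by rewrite patchE; case: ifPn => //; rewrite inE; exact: f0.
  have e (B : set T) (h' : T -> \bar R) : (h' \_ B) x = if x \in B then h' x else 0 by [].
  rewrite /g !e; case: (boolP (x \in D)) => [|_]; last first.
    by apply: adde_ge0; case: ifPn => // _; rewrite /cst ?lee_fin ?leey.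
  rewrite inE => Dx; case: (boolP (x \in N)) => [_|xN].
    rewrite addey ?leey//; case: ifPn => // _; exact: ltNyr.
  have nN : ~ N x by move=> Nx; rewrite mem_set in xN.
  rewrite adde0; apply: (le_trans (h x Dx nN)).
  by rewrite indicE; case: (boolP (x \in A)) => _; rewrite ?mulr1 ?mulr0.
have mc (B : set T) (a : \bar R) : measurable B -> measurable_fun setT (cst a \_ B).
  by move=> mB; apply/(measurable_restrictT _ mB); exact: measurable_cst.
have pos (B : set T) (a : \bar R) x : 0 <= a -> 0 <= (cst a \_ B) x.
  by move=> a0; rewrite patchE; case: ifPn.
rewrite ge0_integralD//; [|by move=> x _; exact: pos|exact: mc|by move=> x _; exact: pos|exact: mc].
by rewrite -!integral_mkcond !integral_cst// N0 mule0 adde0.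
Qed.

End LnormBounds.

Section CellHarmonic.
Context {R : realType}.
Local Notation P := ('rV[R]_2).
Local Notation BP := (borel P).
Variables (mu : {sigma_finite_measure set BP -> \bar R}).
Hypothesis hmu : is_kusuoka mu.
Implicit Types (x y t : P) (p : int) (v : P -> R) (b : int -> 'I_3 -> R) (J : seq int).

Definition cell_harmonic v b J :=
  [/\ {within gasket, continuous v},
      forall p y, S0 y -> v (tau p y) = harm (b p) y,
      forall p k, b p k ^+ 2 <= 1 &
      forall p, p \notin J -> forall k, b p k = 0].

Definition cells J : set BP := \big[setU/set0]_(p <- J) cell p.

Lemma measurable_cell p : measurable (cell p : set BP).
Proof.
apply: closed_borel; apply: continuous_closed_image; [exact: norm_hausdorff|exact: tau_continuous|].
exact: compact_S0.
Qed.

Lemma measurable_cells J : measurable (cells J).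
Proof. by apply: bigsetU_measurable => p _; exact: measurable_cell. Qed.

Lemma mem_cells J p y : p \in J -> S0 y -> cells J (tau p y).
Proof. by move=> pJ Sy; rewrite /cells -bigcup_seq; exists p => //; exists y. Qed.

Lemma measure_cells_le (m : {measure set BP -> \bar R}) J :
  (forall p, m (cell p) = 1%E) -> (m (cells J) <= (size J)%:R%:E)%E.
Proof.
move=> h; apply: (le_trans (measure_bigsetU_le _ _ _ measurable_cell)).
rewrite (eq_bigr (fun=> 1%:E)) => [|p _]; last by rewrite h.
by rewrite sumEFin big_const_seq count_predT iter_addr_0 lee_fin.
Qed.

Lemma grad0_ext u v x : (forall x, S0 x -> u x = v x) -> grad0 mu u x = grad0 mu v x.
Proof.
move=> h; suff e : energy_measure2 u harmonic1 = energy_measure2 v harmonic1 by rewrite /grad0 e.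
have e1 : energy_measure (u \+ harmonic1) = energy_measure (v \+ harmonic1).
  by apply: energy_measure_ext => y Sy /=; rewrite h.
have e2 : energy_measure (u \- harmonic1) = energy_measure (v \- harmonic1).
  by apply: energy_measure_ext => y Sy /=; rewrite h.
by rewrite /energy_measure2 e1 e2.
Qed.

Definition gradient_const : R := 2 * Num.sqrt (kusuoka_const * 1).

(** The gradient bound asks for a positive bound on the squared boundary values; for vanishing ones
    it is applied with every 1 / (n + 1). *)
Lemma le0_archimedean (g K : R) : 0 <= g ->
  (forall n : nat, g <= 2 * Num.sqrt (K * n.+1%:R^-1)) -> g = 0.
Proof.
move=> g0 h; apply/eqP; rewrite eq_le g0 andbT leNgt; apply/negP => gp.
pose n := Num.truncn (4 * `|K| / (g ^+ 2)).
have K0 : 0 <= K * n.+1%:R^-1 \/ K * n.+1%:R^-1 <= 0 by case: (leP 0 (K * n.+1%:R^-1)) => ?; [left|right; exact: ltW].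
have hn := h n.
case: K0 => K0; last by move: hn; rewrite ler0_sqrtr// mulr0 leNgt gp.
have h2 : g ^+ 2 <= 4 * (K * n.+1%:R^-1).
  have -> : 4 * (K * n.+1%:R^-1) = (2 * Num.sqrt (K * n.+1%:R^-1)) ^+ 2.
    by rewrite exprMn sqr_sqrtr//; ring.
  by rewrite lerXn2r// nnegrE ?mulr_ge0// ltW.
have g2 : 0 < g ^+ 2 by rewrite exprn_gt0.
have : 4 * `|K| / (g ^+ 2) < n.+1%:R by exact: truncnS_gt.
rewrite ltr_pdivrMr// => h3.
move: h2; rewrite mulrA ler_pdivlMr// mulrC => h4.
have := ler_norm K; lra.
Qed.

(** [grad] refers to an unspecified cell containing t, so the exceptional set gathers the
    transported null sets of all cells and of all bounds. *)
Lemma grad_cell_harmonic v b J : cell_harmonic v b J ->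
  exists N : set BP, [/\ measurable N, mu N = 0%E &
    forall t, gasket t -> ~ N t -> `|grad mu v t| <= gradient_const * \1_(cells J) t].
Proof.
move=> [_ hv b1 b0].
have /choice[N hN] (i : int * nat) : exists N : set BP,
    [/\ measurable N, mu N = 0%E &
     forall y, S0 y -> ~ N (tau i.1 y) -> `|grad0 mu (harm (b i.1)) y| <=
       2 * Num.sqrt (kusuoka_const * (if i.1 \in J then 1 else i.2.+1%:R^-1))].
  case: i => p n /=; set B := (if _ then _ else _).
  have B0 : 0 < B by rewrite /B; case: ifP => _.
  have hB k : b p k ^+ 2 <= B.
    by rewrite /B; case: ifPn => [_|/b0 ->] //; rewrite expr0n/= invr_ge0.
  have [N [mN NS N0 hN]] := grad0_harm_bound hmu B0 hB.
  exists (tau p @` N); split.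
  - rewrite image_tau -[X in measurable X]setTI.
    exact: (continuous_measurable_plane (@tau_inv_continuous R p)).
  - exact: kusuoka_tau_null.
  - by move=> y Sy nN; apply: hN => // Ny; apply: nN; exists y.
have [mN N0] : measurable (\bigcup_i N i) /\ mu (\bigcup_i N i) = 0%E.
  by apply: null_bigcup => i; have [] := hN i.
exists (\bigcup_i N i); split=> // t gt nN; rewrite /grad.
set p := xget _ _.
have [y Sy ety] : cell p t.
  have [q [y [Sy e]]] := gasket_cell gt.
  by apply: (xgetPex 0 (P := [set i | cell i t])); exists q; exists y.
rewrite (@grad0_ext (v \o tau p) (harm (b p))); last by move=> z Sz /=; exact: hv.
rewrite -ety tauK.
have h n : `|grad0 mu (harm (b p)) y| <=
    2 * Num.sqrt (kusuoka_const * (if p \in J then 1 else n.+1%:R^-1)).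
  have [_ _ h] := hN (p, n); apply: h => // Np.
  by apply: nN; exists (p, n) => //; rewrite -ety.
have [pJ|pJ] := boolP (p \in J).
  rewrite indicE mem_set ?mulr1; last exact: mem_cells.
  by have := h 0%N; rewrite pJ.
rewrite (@le0_archimedean _ kusuoka_const (normr_ge0 _)) ?mulr_ge0 ?sqrtr_ge0//.
by move=> n; have := h n; rewrite (negbTE pJ).
Qed.

Lemma integral_grad_le v b J (r : R) : 0 < r -> cell_harmonic v b J ->
  (\int[mu]_(t in gasket) (`|grad mu v t| `^ r)%:E <=
   (gradient_const `^ r * (size J)%:R)%:E)%E.
Proof.
move=> r0 hv; have [N [mN N0 hN]] := grad_cell_harmonic hv.
have K0 : 0 <= gradient_const by rewrite mulr_ge0.
apply: (@le_trans _ _ ((gradient_const `^ r)%:E * mu (cells J))%E).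
  apply: (integral_le_indic_null (N := N)) => //; first exact: powR_ge0.
  - exact: measurable_cells.
  move=> t gt nN; rewrite lee_fin; have := hN t gt nN.
  rewrite indicE; case: (_ \in _); rewrite ?mulr1 ?mulr0 => h.
    by apply: ge0_ler_powR; rewrite ?nnegrE// ltW.
  by rewrite (_ : `|_| = 0) ?powR0 ?gt_eqF//; apply/eqP; rewrite eq_le h normr_ge0.
rewrite EFinM; apply: lee_wpmul2l; first by rewrite lee_fin powR_ge0.
by apply: measure_cells_le => p; case: hmu.
Qed.

Lemma cell_harmonic_le_indic v b J x : cell_harmonic v b J -> gasket x -> `|v x| <= \1_(cells J) x.
Proof.
move=> [_ hv b1 b0] /gasket_cell[p [y [Sy ->]]]; rewrite hv//.
have [pJ|pJ] := boolP (p \in J).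
  rewrite indicE mem_set; last exact: mem_cells.
  rewrite /= mulr1n ler_norml; apply: harm_range => // k.
  by rewrite -ler_norml -(@ler_pXn2r _ 2)// ?nnegrE// expr1n real_normK// num_real.
by rewrite (@harm_cst R 0)// ?normr0; [rewrite indicE|exact: b0].
Qed.

Lemma FS_cell_harmonic (nu : {measure set BP -> \bar R}) v b J :
  (forall p, nu (cell p) = 1%E) -> cell_harmonic v b J -> FS nu v.
Proof.
move=> hnu hv; have [cv hv' b1 b0] := hv; split => //.
  apply: (@le_lt_trans _ _ (nu (cells J) `^ 2^-1)%E).
    apply: Lnorm_le_indic => //; first exact: measurable_cells.
    move=> x; rewrite patchE; case: ifPn => [|_]; last by rewrite normr0.
    by rewrite inE; exact: cell_harmonic_le_indic hv.
  by apply: poweR_lty; apply: le_lt_trans (measure_cells_le _ hnu) _; exact: ltry.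
have e p : energy (v \o tau p) = ((1 + hole_limit) * energy0 (b p) (b p))%:E.
  by rewrite -energy_harm; apply: energy_ext => y Sy; exact: hv'.
have e0 p : (0 <= energy (v \o tau p))%E.
  by rewrite e lee_fin mulr_ge0 ?energy0_ge0// addr_ge0// hole_limit_ge0.
rewrite (esumID [set p | p \in J])// [X in (_ + X)%E]esum1 ?adde0; last first.
  by move=> p [_ /negP pJ]; rewrite e energy0E !(b0 p pJ) subrr !mul0r !addr0 !mulr0.
rewrite esum_fset//; first last.
  by rewrite setTI; exact: finite_seq.
rewrite fsbig_finite/=; last by rewrite setTI; exact: finite_seq.
by under eq_bigr do rewrite e; rewrite sumEFin ltry.
Qed.

End CellHarmonic.

(** * The bump of a unit cell *)

Section CellBump.
Context {R : realType}.
Local Notation P := ('rV[R]_2).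
Implicit Types (x y t : P) (p : int) (k : 'I_3).

Definition vertex_indic p x : R := if pselect (exists k, x = tau p (corner k)) then 1 else 0.

Definition bump p : P -> R := gasket_fun (vertex_indic p).

Definition bump_bdry p (q : int) k : R := vertex_indic p (tau q (corner k)).

Definition signed_index (e : bool) (m : nat) : int := if e then Posz m else Negz m.

(* Each unit cell is determined by its orientation, one of its vertices and the
   role that this vertex plays, which leaves at most 18 cells touching a given one. *)
Definition touching p (a : 'I_3 * 'I_3 * bool) : int :=
  if pselect (exists m, tau (signed_index a.2 m) (corner a.1.1) = tau p (corner a.1.2) :> P) is left h
  then signed_index a.2 (sval (cid h)) else p.

Definition neighbours p : seq int := [seq touching p a | a <- enum {: 'I_3 * 'I_3 * bool}].

Lemma size_neighbours p : size (neighbours p) = 18.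
Proof. by rewrite size_map -cardE !card_prod !card_ord card_bool. Qed.

Lemma mem_neighbours p q k k' : tau q (corner k) = tau p (corner k') :> P -> q \in neighbours p.
Proof.
move=> e; have [b [m eq]] : exists b m, q = signed_index b m.
  by case: q e => m _; [exists true, m|exists false, m].
have -> : q = touching p (k, k', b).
  rewrite /touching /=; case: pselect => [h|[]]; last by exists m; rewrite -eq.
  case: cid => m' /=; rewrite -e eq; case: (b) => /=.
    by move=> /addrI /cell_offset_inj ->.
  by move=> /addrI /oppr_inj /cell_offset_inj ->.
by apply: map_f; rewrite mem_enum.
Qed.

Lemma bump_bdry_self p k : bump_bdry p p k = 1.
Proof. by rewrite /bump_bdry /vertex_indic; case: pselect => // -[]; exists k. Qed.

Lemma bump_cell p y : S0 y -> bump p (tau p y) = 1.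
Proof. by move=> Sy; rewrite /bump gasket_fun_tau//; apply: harm_cst => // k; exact: bump_bdry_self. Qed.

(** The factor c will be the product of the bumps in the other coordinates. The list is empty for c
    = 0, so that the gradient integral vanishes where that product does. *)
Lemma cell_harmonic_bump p (c : R) : `|c| <= 1 ->
  cell_harmonic (fun t => c * bump p t) (fun q k => c * bump_bdry p q k)
    (if c == 0 then [::] else neighbours p).
Proof.
move=> c1; split.
- apply: (@within_cvgM _ gasket (fun=> c) (bump p)); last exact: gasket_fun_continuous.
  by apply: continuous_subspaceT; exact: cst_continuous.
- move=> q y Sy; rewrite /bump gasket_fun_tau//.
  have h := harmD (bump_bdry p q) (fun=> 0) c 0 Sy.
  rewrite !mul0r addr0 in h; rewrite -[LHS]h.
  by congr (harm _ y); apply/funext => k; rewrite addr0.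
- move=> q k; rewrite exprMn -[leRHS]mulr1 ler_pM ?sqr_ge0//.
    by rewrite -real_normK ?num_real// expr_le1.
  by rewrite /bump_bdry /vertex_indic; case: pselect => ?; rewrite ?expr1n ?expr0n.
- move=> q qJ k; have [->|c0] := eqVneq c 0; first by rewrite mul0r.
  rewrite (negbTE c0) in qJ; rewrite /bump_bdry /vertex_indic.
  case: pselect => h /=; last by rewrite mulr0.
  by have [k' /mem_neighbours] := h; rewrite (negbTE qJ).
Qed.

Lemma bump_le_indic p x : gasket x -> `|bump p x| <= \1_(cells (neighbours p)) x.
Proof.
move=> gx; have := @cell_harmonic_bump p 1; rewrite normr1 => /(_ (lexx _)) h.
by have := cell_harmonic_le_indic h gx; rewrite mul1r oner_eq0.
Qed.

End CellBump.

(** * The product bump as a Sobolev function *)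

Section SobolevBump.
Context {R : realType}.
Local Notation P := ('rV[R]_2).
Local Notation BP := (borel P).
Variables (nu mu : {sigma_finite_measure set BP -> \bar R}).
Variable nus : forall k, {measure set (borel 'M[R]_(k, 2)) -> \bar R}.
Hypotheses (hnu : is_hausdorff nu) (hmu : is_kusuoka mu).
Hypothesis hnus : forall k : nat, is_product_measure (fun _ : 'I_k => nu) (nus k).
Implicit Types (n : nat).

Lemma hausdorff_cell (p : int) : nu (cell p) = 1%E.
Proof.
by case: hnu => _ /(_ p (fun=> ord0) 0%N); rewrite /= image_id expr0 invr1.
Qed.

Lemma row_continuous n (k : 'I_n) : continuous (row k : 'M[R]_(n, 2) -> P).
Proof.
move=> x U [A hA AU]; exists (fun i j => if i == k then A ord0 j else setT).
  move=> i j; case: eqP => [->|_]; last exact: filterT.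
  by have := hA ord0 j; rewrite mxE.
move=> y hy; apply: AU => i j; rewrite ord1 mxE.
by have := hy k j; rewrite eqxx.
Qed.

Definition box n (A : 'I_n -> set BP) : set (borel 'M[R]_(n, 2)) :=
  [set x | forall k, A k (row k x)].

Lemma measurable_box n (A : 'I_n -> set BP) : (forall k, closed (A k : set P)) ->
  measurable (box A).
Proof.
move=> cA; apply: closed_borel.
have -> : box A = \bigcap_(k in [set: 'I_n]) (row k @^-1` A k).
  by apply/seteqP; split=> [x hx k _|x hx k]; exact: hx.
by apply: closed_bigI => k _; apply: preimage_closed (cA k); exact: row_continuous.
Qed.

Lemma closed_cells (J : seq int) : closed (cells J : set P).
Proof.
rewrite /cells; elim: J => [|p J ih]; first by rewrite big_nil; exact: closed0.
rewrite big_cons; apply: closedU => //.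
apply: continuous_closed_image; [exact: norm_hausdorff|exact: tau_continuous|].
exact: compact_S0.
Qed.

Lemma measure_box_le n (J : 'I_n -> seq int) : (forall k, size (J k) = 18) ->
  (nus n (box (fun k => cells (J k))) <= ((18 : R) ^+ n)%:E)%E.
Proof.
move=> hJ; have -> : nus n (box (fun k => cells (J k))) = (\prod_(k < n) nu (cells (J k)))%E.
  by apply: hnus => k; exact: measurable_cells.
have -> : 18 ^+ n = \prod_(k < n) (18 : R) by rewrite prodr_const card_ord.
suff /andP[] : (0 <= \prod_(k < n) nu (cells (J k)) <= (\prod_(k < n) (18 : R))%:E)%E by [].
elim/big_ind2 : _ => [|x a y b /andP[x0 xa] /andP[y0 yb]|k _].
- by rewrite lexx lee01.
- by rewrite mule_ge0//= EFinM lee_pmul.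
by rewrite measure_ge0/=; have := measure_cells_le (J k) hausdorff_cell; rewrite hJ.
Qed.

(** The list J may vary with y; the bound on its length hands the indicator of B i to the outer
    integral. *)
Lemma W_seminorm_le n (r : R) (V : 'M[R]_(n, 2) -> R) (B : 'I_n -> set (borel 'M[R]_(n.-1, 2))) :
  0 < r -> (forall i, measurable (B i)) ->
  (forall i y, gasket_pow n.-1 y -> exists b J,
     cell_harmonic (fun t => V (insert_coord i t y)) b J /\ (size J)%:R <= 18 * \1_(B i) y :> R) ->
  (W_seminorm mu nus r V <=
    (\sum_(i < n) (gradient_const `^ r * 18)%:E * nus n.-1 (B i)) `^ r^-1)%E.
Proof.
move=> r0 mB hV.
have K0 : 0 <= (@gradient_const R) `^ r by exact: powR_ge0.
have i0 (i : 'I_n) y : (0 <= \int[mu]_(t in gasket)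
    (`|grad mu (fun s => V (insert_coord i s y)) t| `^ r)%:E)%E.
  by apply: integral_ge0 => t _; rewrite lee_fin powR_ge0.
apply: gt0_ler_poweR; first by rewrite invr_ge0 ltW.
- by rewrite in_itv /= leey andbT; apply: sume_ge0 => i _; apply: integral_ge0 => y _.
- rewrite in_itv /= leey andbT; apply: sume_ge0 => i _.
  by rewrite mule_ge0// lee_fin mulr_ge0.
apply: lee_sum => i _; apply: (integral_le_indic_null (N := set0)) => //.
- by rewrite mulr_ge0.
move=> y gy _; have [b [J [hb hJ]]] := hV i y gy.
apply: (le_trans (integral_grad_le hmu r0 hb)).
by rewrite lee_fin -mulrA; apply: ler_wpM2l.
Qed.

Lemma W_seminorm_ge0 n (r : R) (V : 'M[R]_(n, 2) -> R) : (0 <= W_seminorm mu nus r V)%E.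
Proof. exact: poweR_ge0. Qed.

Lemma W_norm0 n (r : R) : 0 < r -> W_norm mu nus r (fun _ : 'M[R]_(n, 2) => 0) = 0%E.
Proof.
move=> r0; have rV : r^-1 != 0 by rewrite invr_neq0// gt_eqF.
have e1 : W_seminorm mu nus r (fun _ : 'M[R]_(n, 2) => 0) = 0%E.
  apply/eqP; rewrite eq_le W_seminorm_ge0 andbT.
  apply: (le_trans (@W_seminorm_le n r _ (fun=> set0) r0 _ _)) => //.
    move=> i y _; exists (fun q k => 0 * bump_bdry 0 q k), [::]; split; last by rewrite mulr_ge0.
    have := @cell_harmonic_bump R 0 0; rewrite eqxx normr0 => /(_ ler01).
    by rewrite (_ : (fun t => _) = fun=> 0)//; apply/funext => t; rewrite mul0r.
  by rewrite big1 ?poweR0r// => i _; rewrite measure0 mule0.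
have e2 : LnormS (nus n) r%:E (fun _ : 'M[R]_(n, 2) => 0) = 0%E.
  rewrite /LnormS (_ : EFin \o _ = cst 0%E) ?Lnorm0//.
    by rewrite eqe gt_eqF.
  by apply/funext => x /=; rewrite patchE; case: ifP.
by rewrite /W_norm e1 e2 poweR0r ?gt_eqF// adde0 poweR0r.
Qed.

Section ProductBump.
Variables (n : nat) (p : 'I_n -> int).

Definition product_bump (x : 'M[R]_(n, 2)) : R := \prod_(k < n) bump (p k) (row k x).

Definition product_box : set (borel 'M[R]_(n, 2)) :=
  box (fun k => cells (@neighbours R (p k))).

Lemma measurable_product_box : measurable product_box.
Proof. by apply: measurable_box => k; exact: closed_cells. Qed.

Lemma product_bump_continuous : {within gasket_pow n, continuous product_bump}.
Proof.
apply/subspace_continuousP => x gx.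
have h k : (fun y => bump (p k) (row k y)) @ within (gasket_pow n) (nbhs x) --> bump (p k) (row k x).
  have /subspace_continuousP/(_ _ (gx k)) hk := @gasket_fun_continuous R (vertex_indic (p k)).
  move=> U /hk hU.
  have hU' : \forall y \near x, gasket (row k y) -> U (bump (p k) (row k y)).
    exact: (@row_continuous n k x _ hU).
  change (\forall y \near x, gasket_pow n y -> U (bump (p k) (row k y))).
  near=> y => gy; have : gasket (row k y) -> U (bump (p k) (row k y)) by near: y.
  by apply; exact: gy.
change ((fun y => product_bump y) @ within (gasket_pow n) (nbhs x) --> product_bump x).
rewrite /product_bump; elim: (index_enum _) => [|k s ih].
  rewrite big_nil (_ : (fun _ => _) = fun=> 1); first exact: cvg_cst.
  by apply/funext => y; rewrite big_nil.
rewrite big_cons (_ : (fun _ => _) = fun y => bump (p k) (row k y) * \prod_(j <- s) bump (p j) (row j y)).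
  exact: cvgM.
by apply/funext => y; rewrite big_cons.
Unshelve. all: by end_near.
Qed.

Lemma product_bump_cell x : cell_pow p x -> product_bump x = 1.
Proof.
by move=> hx; rewrite /product_bump big1// => k _; have [y Sy <-] := hx k; rewrite bump_cell.
Qed.

Lemma prod_le_indic (I : finType) (Q A : pred I) (f : I -> R) :
  (forall i, Q i -> `|f i| <= (A i)%:R) ->
  `|\prod_(i | Q i) f i| <= [forall (i | Q i), A i]%:R.
Proof.
move=> h; rewrite normr_prod.
apply: (@le_trans _ _ (\prod_(i | Q i) (A i)%:R)).
  by apply: ler_prod => i Qi; rewrite normr_ge0 h.
case: forallP => [hA|/forallP]; first by rewrite big1// => i Qi; have /implyP -> := hA i.
rewrite negb_forall => /existsP[i]; rewrite negb_imply => /andP[Qi nA].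
by rewrite (bigD1 i)//= (negbTE nA) mul0r.
Qed.

Lemma bump_le_mem q (x : P) : gasket x -> `|bump q x| <= (x \in cells (@neighbours R q))%:R.
Proof. by move=> /(bump_le_indic q); rewrite indicE. Qed.

Lemma product_bump_le_indic x : `|(product_bump \_ (gasket_pow n)) x| <= \1_product_box x.
Proof.
rewrite patchE; case: ifPn => [|_]; last by rewrite normr0 indicE.
rewrite inE => gx; have := @prod_le_indic _ xpredT (fun k => row k x \in cells (@neighbours R (p k)))
  (fun k => bump (p k) (row k x)) (fun k _ => bump_le_mem (p k) (gx k)).
move/le_trans; apply; rewrite indicE ler_nat; case: forallP => // h.
by rewrite mem_set// => k; have := h k; rewrite /= inE.
Qed.

(** The inserted point 0 only completes the vector: the i-th factor is left out of the product. *)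
Definition section_coeff (i : 'I_n) (y : 'M[R]_(n.-1, 2)) : R :=
  \prod_(k | k != i) bump (p k) (row k (insert_coord i 0 y)).

Definition section_box (i : 'I_n) : set (borel 'M[R]_(n.-1, 2)) :=
  box (fun k => cells (@neighbours R (p (lift i k)))).

Lemma measurable_section_box i : measurable (section_box i).
Proof. by apply: measurable_box => k; exact: closed_cells. Qed.

Lemma row_insert_coord (i : 'I_n) t (y : 'M[R]_(n.-1, 2)) : row i (insert_coord i t y) = t.
Proof. by apply/rowP => l; rewrite !mxE unlift_none. Qed.

Lemma row_insert_coord_lift (i : 'I_n) t (y : 'M[R]_(n.-1, 2)) k :
  row (lift i k) (insert_coord i t y) = row k y.
Proof. by apply/rowP => l; rewrite !mxE liftK. Qed.

Lemma product_bump_section i t y :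
  product_bump (insert_coord i t y) = section_coeff i y * bump (p i) t.
Proof.
rewrite /product_bump (bigD1 i)//= row_insert_coord mulrC; congr (_ * _).
apply: eq_bigr => k ki; congr (bump _ _).
by rewrite eq_sym in ki; have [l -> _] := unlift_some ki; rewrite !row_insert_coord_lift.
Qed.

Lemma section_coeff_le_indic i y : gasket_pow n.-1 y -> `|section_coeff i y| <= \1_(section_box i) y.
Proof.
move=> gy; have := @prod_le_indic _ (fun k => k != i)
  (fun k => row k (insert_coord i 0 y) \in cells (@neighbours R (p k)))
  (fun k => bump (p k) (row k (insert_coord i 0 y))).
move=> h; apply: le_trans (h _) _ => [k ki|].
  rewrite eq_sym in ki; have [l -> _] := unlift_some ki.
  by rewrite row_insert_coord_lift; apply: bump_le_mem; exact: gy.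
rewrite indicE ler_nat; case: forallP => // hA.
rewrite mem_set// => k; have := hA (lift i k); rewrite row_insert_coord_lift.
by rewrite eq_sym neq_lift /= inE.
Qed.

Lemma section_cell_harmonic i y : gasket_pow n.-1 y -> exists b J,
  cell_harmonic (fun t => product_bump (insert_coord i t y)) b J /\
  (size J)%:R <= 18 * \1_(section_box i) y :> R.
Proof.
move=> gy; have hc := section_coeff_le_indic i gy.
have c1 : `|section_coeff i y| <= 1.
  by apply: le_trans hc _; rewrite indicE; case: (_ \in _).
have h := cell_harmonic_bump (p i) c1.
exists (fun q k => section_coeff i y * bump_bdry (p i) q k).
exists (if section_coeff i y == 0 then [::] else @neighbours R (p i)); split.
  have -> // : (fun t => product_bump (insert_coord i t y)) =
    fun t => section_coeff i y * bump (p i) t.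
  by apply/funext => t; exact: product_bump_section.
case: eqP => [_|/eqP c0]; first by rewrite mulr_ge0// indicE.
rewrite size_neighbours; move: hc; rewrite !indicE; case: (_ \in _); first by rewrite mulr1.
by rewrite normr_le0 (negbTE c0).
Qed.

Lemma W_seminorm_product_bump (r : R) : 0 < r ->
  (W_seminorm mu nus r product_bump <=
   ((n%:R * (gradient_const `^ r * 18 * 18 ^+ n.-1)) `^ r^-1)%:E)%E.
Proof.
move=> r0; have K0 : 0 <= (@gradient_const R) `^ r by exact: powR_ge0.
apply: (le_trans (W_seminorm_le r0 measurable_section_box section_cell_harmonic)).
rewrite -poweR_EFin; apply: gt0_ler_poweR; first by rewrite invr_ge0 ltW.
- rewrite in_itv /= leey andbT; apply: sume_ge0 => i _.
  by rewrite mule_ge0// lee_fin mulr_ge0.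
- by rewrite in_itv /= leey andbT lee_fin !mulr_ge0.
have -> : n%:R * (gradient_const `^ r * 18 * 18 ^+ n.-1) =
    \sum_(i < n) (gradient_const `^ r * 18 * 18 ^+ n.-1) :> R.
  by rewrite sumr_const card_ord mulr_natl.
rewrite -sumEFin; apply: lee_sum => i _; rewrite [leRHS]EFinM.
apply: lee_wpmul2l; first by rewrite lee_fin mulr_ge0.
by apply: measure_box_le => k; exact: size_neighbours.
Qed.

Lemma Lnorm_product_bump (s : \bar R) : (1 <= s)%E ->
  (LnormS (nus n) s product_bump <= (18 ^+ n)%:E)%E.
Proof.
have e1 : (1%:E <= ((18 : R) ^+ n)%:E)%E by rewrite lee_fin exprn_ege1// ler1n.
case: s => [s||//]; last first.
  by move=> _; apply: le_trans e1; exact: (Lnorm_pinfty_le (nus n) product_bump_le_indic).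
rewrite lee_fin => s1; have s0 : 0 < s by exact: lt_le_trans s1.
have h := Lnorm_le_indic (nus n) s0 measurable_product_box product_bump_le_indic.
apply: (le_trans h).
have hb : (nus n product_box <= (18 ^+ n)%:E)%E.
  by apply: measure_box_le => k; exact: size_neighbours.
apply: (@le_trans _ _ ((18 ^+ n)%:E `^ s^-1)%E).
  apply: gt0_ler_poweR => //; first by rewrite invr_ge0 ltW.
    by rewrite in_itv /= leey andbT.
  by rewrite in_itv /= leey andbT lee_fin exprn_ge0.
rewrite poweR_EFin lee_fin -[leRHS]powRr1 ?exprn_ge0//.
by apply: ler_powR; rewrite ?invf_le1// -lee_fin.
Qed.

Lemma W_core_product_bump (r : R) : 1 <= r -> W_core nu mu nus r product_bump.
Proof.
move=> r1; have r0 : 0 < r by exact: lt_le_trans r1.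
split; first exact: product_bump_continuous.
  move=> i y gy; have [b [J [hb _]]] := section_cell_harmonic i gy.
  exact: FS_cell_harmonic hausdorff_cell hb.
apply: poweR_lty; apply: lte_add_pinfty; apply: poweR_lty.
  apply: le_lt_trans (Lnorm_product_bump _) _; rewrite ?lee_fin ?ltry//.
by apply: le_lt_trans (W_seminorm_product_bump r0) _; exact: ltry.
Qed.

(** The constant sequence represents the function; its differences have norm 0, whence the
    computation in [W_norm0]. *)
Lemma sobolev_product_bump (r : R) : 1 <= r -> exists u : sobolev nu mu nus n r,
  sobolev_seminorm u = W_seminorm mu nus r product_bump /\ W_rep u = product_bump.
Proof.
move=> r1; have r0 : 0 < r by exact: lt_le_trans r1.
have e : (product_bump \- product_bump)%R = fun=> 0 by apply/funext => x /=; rewrite subrr.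
have hcore (j : nat) := W_core_product_bump r1.
have hcauchy (d : R) : 0 < d -> exists N : nat, forall j k, (N <= j)%N -> (N <= k)%N ->
    (W_norm mu nus r ((fun _ : nat => product_bump) j \- (fun _ : nat => product_bump) k)%R < d%:E)%E.
  by move=> d0; exists 0%N => j k _ _; rewrite e W_norm0.
have hlim : (fun j : nat => LnormS (nus n) r%:E ((fun _ : nat => product_bump) j \- product_bump)%R)
    @ \oo --> 0%E.
  rewrite e; have -> : LnormS (nus n) r%:E (fun=> 0) = 0%E; last exact: cvg_cst.
  rewrite /LnormS (_ : EFin \o _ = cst 0%E) ?Lnorm0//; first by rewrite eqe gt_eqF.
  by apply/funext => x /=; rewrite patchE; case: ifP.
exists (Sobolev hcore hcauchy product_bump_continuous hlim); split=> //.
by rewrite /sobolev_seminorm /= lim_cst.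
Qed.

End ProductBump.

End SobolevBump.

(** * Dyadic simplexes *)

Section DyadicCells.
Context {R : realType}.
Local Notation P := ('rV[R]_2).
Local Notation BP := (borel P).
Implicit Types (x y t : P) (p q : int) (k j : 'I_3) (d : nat).

(** Doubling the plane splits a cell into three unit cells, whose indices arise by appending a base
    3 digit; halving drops the last digit. *)
Definition child p j : int :=
  match p with Posz m => Posz (3 * m + j)%N | Negz m => Negz (3 * m + j)%N end.

Definition parent p : int := match p with Posz m => Posz (m %/ 3)%N | Negz m => Negz (m %/ 3)%N end.

Fixpoint descendants d p : seq int :=
  if d is d'.+1 then [seq child q j | q <- descendants d' p, j <- enum 'I_3] else [:: p].

Lemma size_descendants d p : size (descendants d p) = (3 ^ d)%N.
Proof.
by elim: d => [//|d ih] /=; rewrite size_allpairs ih size_enum_ord expnSr.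
Qed.

Lemma uniq_descendants d p : uniq (descendants d p).
Proof.
elim: d => [//|d ih] /=; apply: allpairs_uniq => //; first exact: enum_uniq.
move=> [q j] [q' j'] _ _ /=; have := ltn_ord j; have := ltn_ord j'.
case: q q' => m [m'|m'] //= hj' hj [] e; have em : m = m' by lia.
  have ej : (j : nat) = j' by lia.
  by rewrite em (val_inj ej).
have ej : (j : nat) = j' by lia.
by rewrite em (val_inj ej).
Qed.

Lemma double_tau q j y : 2 *: tau q (Fmap j y) = tau (child q j) y.
Proof.
have e : 2 *: Fmap j y = y + corner j by rewrite /Fmap scalerA divff// scale1r.
case: q => m /=; rewrite cell_offset_digit scalerDr ?scalerN e.
  by rewrite addrA.
by rewrite !opprD addrA.
Qed.

Lemma half_cell q x : cell q x -> cell (parent q) (2^-1 *: x).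
Proof.
move=> [y Sy <-]; have e (m : nat) : 2^-1 *: (y + cell_offset m) =
    Fmap (inord (m %% 3)%N) y + cell_offset (m %/ 3)%N :> P.
  by rewrite [in LHS]cell_offsetS addrA scalerDr scalerA mulVf// scale1r.
exists (Fmap (inord ((match q with Posz m => m | Negz m => m end) %% 3)%N) y).
  exact: S0_Fmap.
case: q => m /=; first by rewrite -e.
by rewrite -opprD -e -scalerN opprD.
Qed.

Lemma shrink_cell d q : exists q', forall x, cell q x -> cell q' (shrink d x).
Proof.
elim: d => [|d [q' h]]; first by exists q => x; rewrite /shrink expr0 scale1r.
by exists (parent q') => x /h /half_cell; rewrite shrinkS Fmap0.
Qed.

Lemma expand_cell d q : expand d @` (cell q : set P) = cells (descendants d q).
Proof.
elim: d => [|d ih].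
  rewrite /cells /= big_seq1 (_ : expand 0 = id) ?image_id//.
  by apply/funext => x; rewrite /expand expr0 scale1r.
rewrite (_ : expand d.+1 = (fun x => 2 *: x) \o expand d); last first.
  by apply/funext => x; rewrite /= /expand scalerA exprS.
rewrite -image_comp ih /cells -!bigcup_seq; apply/seteqP; split=> [_ [x [p /= pd [y Sy <-]] <-]|].
  have [j [z [Sz ->]]] := S0_cover Sy; exists (child p j); last by exists z; rewrite ?double_tau.
  by rewrite /=; apply: allpairs_f => //; exact: mem_enum.
move=> _ [p' /= /allpairsP[[p j] /= [pd _ ->]] [y Sy <-]].
exists (tau p (Fmap j y)); last by rewrite double_tau.
by exists p => //; exists (Fmap j y) => //; exact: S0_Fmap.
Qed.

Lemma corner_Fword k m : Fword (fun=> k) m (corner k) = corner k :> P.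
Proof. by elim: m => [//|m ih] /=; rewrite Fmap_corner ih. Qed.

Variable nu : {measure set BP -> \bar R}.
Hypothesis hnu : is_hausdorff nu.

Lemma measurable_point x : measurable ([set x] : set BP).
Proof. by apply: closed_borel; apply: compact_closed; [exact: norm_hausdorff|exact: compact_set1]. Qed.

Lemma hausdorff_corner p k : nu [set tau p (corner k)] = 0%E.
Proof.
apply/eqP; rewrite eq_le measure_ge0 andbT; apply/lee_addgt0Pr => e e0; rewrite add0e.
have [m hm] := pow2V_lt e0; have [_ h] := hnu.
have eF : Fword (fun=> k) m = Fseq (nseq m k) :> (P -> P).
  by rewrite -Fword_nth size_nseq; apply: eq_Fword => n nm; rewrite nth_nseq nm.
apply: (@le_trans _ _ ((3 ^+ m)^-1)%:E).
  rewrite -(h p (fun=> k) m); apply: le_measure; rewrite ?inE.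
  - exact: measurable_point.
  - rewrite eF image_tau -[X in measurable X]setTI.
    exact: (continuous_measurable_plane (@tau_inv_continuous R p) _ (measurable_subcell _)).
  - move=> _ ->; exists (corner k) => //; exists (corner k); first exact: S0_corner.
    exact: corner_Fword.
rewrite lee_fin ltW// (le_lt_trans _ hm)// lef_pV2 ?posrE ?exprn_gt0//.
by rewrite lerXn2r ?nnegrE// ler_nat.
Qed.

Definition vertices : set BP := \bigcup_(a in [set: int * 'I_3]) [set tau a.1 (corner a.2)].

Lemma hausdorff_vertices : measurable vertices /\ nu vertices = 0%E.
Proof.
apply: null_bigcup => a; split; first exact: measurable_point.
exact: hausdorff_corner.
Qed.

(** Distinct cells meet only in vertices, which are null because a vertex lies in cells of mass 3^-m
    for every m. *)
Lemma measure_cells_ge L : uniq L -> ((size L)%:R%:E <= nu (cells L))%E.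
Proof.
have [mZ Z0] := hausdorff_vertices.
have mc := @measurable_cell R; have mcs := @measurable_cells R.
have nz (A : set BP) : measurable A -> nu (A `\` vertices) = nu A.
  move=> mA; have e : nu A = (nu (A `\` vertices) + nu (A `&` vertices))%E by exact: measureDI.
  have e0 : nu (A `&` vertices) = 0%E; last by rewrite e e0 adde0.
  apply/eqP; rewrite eq_le measure_ge0 andbT -Z0.
  by apply: le_measure; rewrite ?inE//; exact: measurableI.
elim: L => [|p L ih] /=; first by rewrite measure_ge0.
move=> /andP[pL uL]; have -> : cells (p :: L) = (cell p : set BP) `|` cells L.
  by rewrite /cells big_cons.
rewrite -nz; last exact: measurableU.
rewrite setDUl measureU; [|exact: measurableD|exact: measurableD|]; last first.
  apply/seteqP; split=> // x [[[y Sy <-] nV] [+ _]].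
  rewrite /cells -bigcup_seq => -[q /= qL [y' Sy' e]].
  have pq : p != q by apply: contraNneq pL => ->.
  have [i ey] := tau_meet Sy Sy' pq (esym e).
  by apply: nV; exists (q, i) => //=; rewrite -e ey.
have l1 : (nu (cell p : set BP) <= nu ((cell p : set BP) `\` vertices))%E by rewrite (nz _ (mc p)).
have l2 : (nu (cells L) <= nu (cells L `\` vertices))%E by rewrite (nz _ (mcs L)).
rewrite -natr1 addrC EFinD; apply: leeD; last exact: le_trans (ih uL) l2.
apply: le_trans l1; have [_ /(_ p (fun=> ord0) 0%N)] := hnu.
by rewrite /= image_id expr0 invr1 => ->.
Qed.

End DyadicCells.

Section Diameter.
Context {R : realType}.
Local Notation P := ('rV[R]_2).
Implicit Types (x y : P).

(** Half the sum of the squared differences is at most half the sum of all six coordinates, since (a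
    - b)^2 <= a^2 + b^2 <= a + b on [0, 1]; that sum is 2. *)
Lemma enorm_S0_le1 x y : S0 x -> S0 y -> enorm (x - y) <= 1.
Proof.
move=> Sx Sy; rewrite -(@ler_pXn2r _ 2)// ?nnegrE ?enorm_ge0// expr1n enorm_sqr sum3.
have sx := sum_bc x; have sy := sum_bc y; rewrite !sum3 in sx sy.
have x0 := bc_ge0 ord0 Sx; have x1 := bc_ge0 (inord 1) Sx; have x2 := bc_ge0 (inord 2) Sx.
have y0 := bc_ge0 ord0 Sy; have y1 := bc_ge0 (inord 1) Sy; have y2 := bc_ge0 (inord 2) Sy.
move: x0 x1 x2 y0 y1 y2 sx sy.
set a0 := bc ord0 x; set a1 := bc (inord 1) x; set a2 := bc (inord 2) x.
set b0 := bc ord0 y; set b1 := bc (inord 1) y; set b2 := bc (inord 2) y.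
move=> x0 x1 x2 y0 y1 y2 sx sy.
have e : a0 = 1 - a1 - a2 by lra.
have e' : b0 = 1 - b1 - b2 by lra.
have sq (a b : R) : 0 <= a -> 0 <= b -> (a - b) ^+ 2 <= a ^+ 2 + b ^+ 2.
  by move=> a_ge b_ge; have := mulr_ge0 a_ge b_ge; rewrite !expr2; nra.
have le1 (a : R) : 0 <= a -> a <= 1 -> a ^+ 2 <= a.
  by move=> ? ?; rewrite expr2 -[leRHS]mulr1; apply: ler_wpM2l.
have := sq _ _ x0 y0; have := sq _ _ x1 y1; have := sq _ _ x2 y2.
have := le1 _ x0 ltac:(lra); have := le1 _ x1 ltac:(lra); have := le1 _ x2 ltac:(lra).
have := le1 _ y0 ltac:(lra); have := le1 _ y1 ltac:(lra); have := le1 _ y2 ltac:(lra).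
lra.
Qed.

Lemma enormZ (a : R) x : enorm (a *: x) = `|a| * enorm x.
Proof.
rewrite /enorm -sqrtr_sqr -sqrtrM ?sqr_ge0// mulr_sumr.
by congr Num.sqrt; apply: eq_bigr => j _; rewrite mxE exprMn.
Qed.

Lemma enorm_tau (p : int) x y : enorm (tau p x - tau p y) = enorm (x - y).
Proof.
case: p => m /=; first by rewrite opprD addrACA subrr addr0.
rewrite opprD !opprK addrACA addNr addr0 -[- x + y]opprK opprD opprK -scaleN1r enormZ normrN1 mul1r.
by [].
Qed.

Lemma enorm_corner01 : enorm (corner ord0 - corner (inord 1) : P) = 1.
Proof.
apply/eqP; rewrite -(@eqrXn2 _ 2)// ?enorm_ge0// enorm_sqr sum3 !bc_corner expr1n.
have n01 : (ord0 : 'I_3) != inord 1 by rewrite -val_eqE /= inordK.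
have n02 : (ord0 : 'I_3) != inord 2 by rewrite -val_eqE /= inordK.
have n12 : (inord 1 : 'I_3) != inord 2 by rewrite -val_eqE /= !inordK.
rewrite !eqxx (negbTE n01) ![inord _ == ord0]eq_sym (negbTE n01) (negbTE n02).
by rewrite [inord 2 == inord 1]eq_sym (negbTE n12) /=; apply/eqP; field.
Qed.

Variable n : nat.
Implicit Types (p : 'I_n -> int) (z : 'M[R]_(n, 2)).

Lemma dist_pow_cell p z z' : cell_pow p z -> cell_pow p z' -> dist_pow z z' <= 1.
Proof.
move=> hz hz'; rewrite /dist_pow; apply: bigmax_le => // k _.
have [x Sx <-] := hz k; have [y Sy <-] := hz' k.
by rewrite enorm_tau; exact: enorm_S0_le1.
Qed.

Lemma diam_cell_le1 p (S : set 'M[R]_(n, 2)) : S `<=` cell_pow p -> (diam S <= 1)%E.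
Proof.
move=> hS; apply: ub_ereal_sup => _ [z [z1 z2] <-].
by rewrite lee_fin; apply: (@dist_pow_cell p); exact: hS.
Qed.

Lemma scale_cell_pow (a : R) p : a != 0 ->
  (fun z : 'M[R]_(n, 2) => a *: z) @` cell_pow p =
  box (fun k => (fun x : P => a *: x) @` cell (p k)).
Proof.
move=> a0; have rowZ (c : R) k z : row k (c *: z) = c *: row k z.
  by apply/rowP => l; rewrite !mxE.
apply/seteqP; split=> [_ [z hz <-] k|z hz].
  by exists (row k z); [exact: hz|rewrite rowZ].
exists (a^-1 *: z); last by rewrite scalerA divff// scale1r.
by move=> k; have [x hx e] := hz k; rewrite rowZ -e scalerA mulVf// scale1r.
Qed.

Lemma diam_expand_gt1 d p : (0 < n)%N ->
  (1 < diam ((fun z : 'M[R]_(n, 2) => (2 ^+ d.+1 : R) *: z) @` cell_pow p))%E.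
Proof.
move=> n0; pose k : 'I_n := Ordinal n0.
pose z (j : 'I_3) : 'M[R]_(n, 2) := \matrix_(i, l) tau (p i) (corner j) ord0 l.
have rz i j : row i (z j) = tau (p i) (corner j).
  by apply/rowP => l; rewrite !mxE.
have hz j : cell_pow p (z j).
  by move=> i; rewrite rz; exists (corner j) => //; exact: S0_corner.
set A := image _ _.
have hd : ((dist_pow (2 ^+ d.+1 *: z ord0) (2 ^+ d.+1 *: z (inord 1)))%:E <= diam A)%E.
  apply: ereal_sup_ubound; exists (2 ^+ d.+1 *: z ord0, 2 ^+ d.+1 *: z (inord 1)) => //.
  by split; [exists (z ord0)|exists (z (inord 1))].
apply: lt_le_trans hd; rewrite lte_fin.
apply: (@lt_le_trans _ _ (enorm (row k (2 ^+ d.+1 *: z ord0) - row k (2 ^+ d.+1 *: z (inord 1))))).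
  have rowZ (c : R) (y : 'M[R]_(n, 2)) : row k (c *: y) = c *: row k y by apply/rowP => l; rewrite !mxE.
  rewrite !rowZ !rz -scalerBr enormZ enorm_tau enorm_corner01 mulr1 ger0_norm ?exprn_ge0//.
  by rewrite exprn_egt1// ltr1n.
rewrite /dist_pow; exact: (@le_bigmax_cond _ _ _ 0 k xpredT (fun k => enorm (row k _ - row k _))).
Qed.

End Diameter.

Lemma poweR_le_ge1 (R : realType) (x : \bar R) (A a : R) : (0 <= x)%E -> (x <= A%:E)%E ->
  1 <= A -> 0 <= a <= 1 -> (x `^ a <= A%:E)%E.
Proof.
move=> x0 xA A1 /andP[a0 a1]; have A0 : 0 <= A by exact: le_trans A1.
apply: (@le_trans _ _ (A%:E `^ a)%E).
  by apply: gt0_ler_poweR => //; rewrite in_itv /= leey andbT.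
rewrite poweR_EFin lee_fin -[leRHS]powRr1//; exact: ler_powR.
Qed.

(** * Bounds of sigma on unit cells and on large simplexes *)

Section CellBound.
Context {R : realType}.
Variables (nu mu : {sigma_finite_measure set (borel 'rV[R]_2) -> \bar R}).
Variable nus : forall k : nat, {measure set (borel 'M[R]_(k, 2)) -> \bar R}.
Hypotheses (hnu : is_hausdorff nu) (hmu : is_kusuoka mu).
Hypothesis hnus : forall k : nat, is_product_measure (fun _ : 'I_k => nu) (nus k).
Variables (n : nat) (sigma : {measure set (borel 'M[R]_(n, 2)) -> \bar R}).

Lemma measurable_cell_pow (p : 'I_n -> int) : measurable (cell_pow p : set (borel 'M[R]_(n, 2))).
Proof.
apply: (@measurable_box _ n (fun k => cell (p k))) => k.
apply: continuous_closed_image; [exact: norm_hausdorff|exact: tau_continuous|].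
exact: compact_S0.
Qed.

Lemma cell_pow_bound (s : \bar R) (q r : R) (k : nat) (a : 'I_k -> R) (C : R) :
  (1 <= s)%E -> 1 <= q -> 1 <= r -> (forall i, 0 <= a i <= 1) -> 0 <= C ->
  (forall u : sobolev nu mu nus n r,
     (sobolev_Lnorm sigma q%:E u <=
      C%:E * \sum_(i < k) (sobolev_seminorm u `^ (a i) *
                           sobolev_Lnorm (nus n) s u `^ (1 - a i)))%E) ->
  exists2 D : R, 0 < D & forall p, (sigma (cell_pow p) <= D%:E)%E.
Proof.
move=> s1 q1 r1 ha C0 hineq.
have q0 : 0 < q by exact: lt_le_trans q1.
have r0 : 0 < r by exact: lt_le_trans r1.
(* Raised to at least 1, so that A^a <= A for every exponent a in [0, 1]. *)
pose A : R := 1 + (n%:R * (gradient_const `^ r * 18 * 18 ^+ n.-1)) `^ r^-1.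
pose B : R := 18 ^+ n.
have A1 : 1 <= A by rewrite lerDl powR_ge0.
have B1 : 1 <= B by rewrite exprn_ege1// ler1n.
have A0 : 0 <= A by exact: le_trans A1.
have B0 : 0 <= B by exact: le_trans B1.
pose E := C * (k%:R * (A * B)).
have E0 : 0 <= E by rewrite !mulr_ge0.
(* The summand 1 keeps the constant positive also when E = 0, as for k = 0. *)
exists (E `^ q + 1); first by rewrite ltr_wpDl// powR_ge0.
move=> p; have [u [es er]] := sobolev_product_bump hnu hmu hnus p r1.
have hA : (sobolev_seminorm u <= A%:E)%E.
  rewrite es; apply: le_trans (W_seminorm_product_bump hnu hmu hnus p r0) _.
  by rewrite lee_fin lerDr.
have hB : (sobolev_Lnorm (nus n) s u <= B%:E)%E.
  by rewrite /sobolev_Lnorm er; exact: (Lnorm_product_bump hnu hnus p s1).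
have h : (sigma (cell_pow p) `^ q^-1 <= E%:E)%E.
  apply: (@le_trans _ _ (sobolev_Lnorm sigma q%:E u)).
    rewrite /sobolev_Lnorm er; apply: Lnorm_ge_indic => //; first exact: measurable_cell_pow.
    move=> x hx; rewrite patchE mem_set ?product_bump_cell// => l.
    by have [y Sy <-] := hx l; exact: gasket_tau.
  apply: (le_trans (hineq u)); rewrite /E EFinM; apply: lee_wpmul2l; first by rewrite lee_fin.
  have -> : k%:R * (A * B) = \sum_(i < k) A * B :> R by rewrite sumr_const card_ord mulr_natl.
  rewrite -sumEFin; apply: lee_sum => i _; rewrite EFinM; apply: lee_pmul; try exact: poweR_ge0.
    by apply: poweR_le_ge1 => //; rewrite es; exact: poweR_ge0.
  apply: poweR_le_ge1 => //; first exact: Lnorm_ge0.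
  by have /andP[? ?] := ha i; apply/andP; split; lra.
apply: (@le_trans _ _ (E `^ q)%:E); last by rewrite lee_fin lerDl.
have -> : sigma (cell_pow p) = ((sigma (cell_pow p) `^ q^-1) `^ q)%E.
  by rewrite -poweRrM mulVf ?gt_eqF// poweRe1.
rewrite -poweR_EFin; apply: gt0_ler_poweR => //; first exact: ltW.
  by rewrite in_itv /= leey andbT poweR_ge0.
by rewrite in_itv /= leey andbT lee_fin.
Qed.

Variables (D : R) (D0 : 0 < D).
Hypothesis hD : forall p, (sigma (cell_pow p) <= D%:E)%E.

Lemma sigma_sub_cell (S : set (borel 'M[R]_(n, 2))) p : measurable S -> S `<=` cell_pow p ->
  (sigma S <= D%:E)%E.
Proof.
move=> mS Sp; apply: le_trans (hD p); apply: le_measure; rewrite ?inE//.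
exact: measurable_cell_pow.
Qed.

Lemma closed_scale_cell (c : R) (p : int) : closed ((fun x : 'rV[R]_2 => c *: x) @` cell p).
Proof.
rewrite /cell image_comp; apply: continuous_closed_image; [exact: norm_hausdorff| |exact: compact_S0].
move=> x; apply: (@cvgZl_tmp _ _ _ (nbhs x)); exact: tau_continuous.
Qed.

(** The simplex consists of 3^(d n) unit cells: sigma is at most D times this number by
    subadditivity, and the product measure is at least this number by the null overlaps in each
    coordinate. *)
Lemma sigma_expand (d : nat) (p : 'I_n -> int) (S : set (borel 'M[R]_(n, 2))) :
  S = (fun z : 'M[R]_(n, 2) => (2 ^+ d : R) *: z) @` cell_pow p ->
  (sigma S <= D%:E * nus n S)%E.
Proof.
move=> hS; have a0 : (2 ^+ d : R) != 0.
  by apply: expf_neq0; rewrite pnatr_eq0.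
have eS : S = box (fun k => cells (descendants d (p k))).
  by rewrite hS scale_cell_pow//; congr box; apply/funext => k; exact: expand_cell.
have h1 : (((3 ^ d)%:R ^+ n)%:E <= nus n S)%E.
  have -> : nus n S = (\prod_(k < n) nu (cells (descendants d (p k))))%E.
    by rewrite eS; apply: hnus => k; exact: measurable_cells.
  have -> : (3 ^ d)%:R ^+ n = \prod_(k < n) (3 ^ d)%:R :> R by rewrite prodr_const card_ord.
  suff [] : (0 <= (\prod_(k < n) (3 ^ d)%:R : R)%:E)%E /\
    ((\prod_(k < n) (3 ^ d)%:R : R)%:E <= \prod_(k < n) nu (cells (descendants d (p k))))%E by [].
  elim/big_ind2 : _ => [|x a y b [x0 xa] [y0 yb]|k _].
  - by split; rewrite ?lee01 ?lexx.
  - by rewrite EFinM; split; [exact: mule_ge0|exact: lee_pmul].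
  - split; first by rewrite lee_fin ler0n.
    rewrite -(size_descendants d (p k)); apply: measure_cells_ge => //.
    exact: uniq_descendants.
pose c (f : {ffun 'I_n -> 'I_(3 ^ d)}) : 'I_n -> int := fun k => nth 0 (descendants d (p k)) (f k).
have h2 : (sigma S <= \sum_(f : {ffun 'I_n -> 'I_(3 ^ d)}) sigma (cell_pow (c f)))%E.
  apply: le_trans (measure_bigsetU_le _ _ _ (fun f => measurable_cell_pow (c f))).
  apply: le_measure; rewrite ?inE.
  - by rewrite eS; apply: measurable_box => k; exact: closed_cells.
  - by apply: bigsetU_measurable => f _; exact: measurable_cell_pow.
  rewrite eS => z hz.
  have /choice[f hf] (k : 'I_n) : exists i : 'I_(3 ^ d), cell (nth 0 (descendants d (p k)) i) (row k z).
    have := hz k; rewrite /cells -bigcup_seq => -[q /= qd hq].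
    have iq : (index q (descendants d (p k)) < 3 ^ d)%N by rewrite -(size_descendants d (p k)) index_mem.
    by exists (Ordinal iq); rewrite /= nth_index.
  rewrite -bigcup_seq; exists [ffun k => f k]; first by rewrite /= mem_index_enum.
  by move=> k; rewrite /c ffunE; exact: hf.
apply: (le_trans h2); apply: (@le_trans _ _ (D%:E * ((3 ^ d)%:R ^+ n)%:E)%E); last first.
  by apply: lee_wpmul2l => //; rewrite lee_fin ltW.
apply: (@le_trans _ _ (\sum_(f : {ffun 'I_n -> 'I_(3 ^ d)}) D%:E)%E).
  by apply: lee_sum => f _; exact: hD.
rewrite sumEFin -EFinM lee_fin sumr_const card_ffun !card_ord -natrX.
by rewrite -[leLHS]mulr_natr lexx.
Qed.

End CellBound.

Theorem theorem3p18 (R : realType)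
  (nu mu : {sigma_finite_measure set (borel 'rV[R]_2) -> \bar R})
  (nus : forall k : nat, {measure set (borel 'M[R]_(k, 2)) -> \bar R})
  (hnu : is_hausdorff nu) (hmu : is_kusuoka mu)
  (hnus : forall k : nat, is_product_measure (fun _ : 'I_k => nu) (nus k))
  (n : nat) (hn : (1 <= n)%N)
  (sigma : {measure set (borel 'M[R]_(n, 2)) -> \bar R})
  (hsigma : is_radon_on (gasket_pow n) sigma)
  (p : \bar R) (q r : R) (k : nat) (a : 'I_k -> R) (C : R)
  (hp : (1 <= p)%E) (hq : 1 <= q)
  (hr : 1 + (n%:R - 1) * delta_s < r) (hr2 : 2 <= r)
  (ha : forall i, 0 <= a i <= 1) (hC : 0 < C)
  (hineq : forall u : sobolev nu mu nus n r,
     (sobolev_Lnorm sigma q%:E u <=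
      C%:E * \sum_(i < k) (sobolev_seminorm u `^ (a i) *
                           sobolev_Lnorm (nus n) p u `^ (1 - a i)))%E) :
  exists (dlow dup : \bar R) (Csigma : R),
    [/\ (0 < dlow)%E, (dlow <= dup)%E, (1 <= dup)%E, 0 < Csigma &
     forall S : set 'M[R]_(n, 2), dyadic_simplex S ->
       ((0 < diam S <= 1)%E ->
          (sigma S <= Csigma%:E * nus n S `^ (fine dup^-1))%E) /\
       ((1 < diam S)%E ->
          (sigma S <= Csigma%:E * nus n S `^ (fine dlow^-1))%E)].
Proof.
have r1 : 1 <= r by lra.
have [D D0 hD] := cell_pow_bound hnu hmu hnus hp hq r1 ha (ltW hC) hineq.
exists 1%E, +oo%E, D; split; rewrite ?lte01 ?leey//.
have e1 : fine (1 : \bar R)^-1%E = 1 by rewrite inve1.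
have ey : fine (+oo : \bar R)^-1%E = 0 by rewrite invey.
move=> S [m [i ->]]; rewrite e1 ey poweRe0 mule1.
(* For m = d the simplex is a cell magnified by 2^d, and for m = - (d + 1) it is a cell reduced by
   2^(d + 1). *)
case: m => d.
  have eF : @Fdiag R n (- Posz d) = fun z => (2 ^+ d : R) *: z.
    by apply/funext => z; rewrite /Fdiag exprz_inv opprK.
  rewrite eF; split=> hdiam; last first.
    by rewrite poweRe1//; exact: (sigma_expand hnu hnus D0 hD (erefl _)).
  (* Among the magnified cells only d = 0, a unit cell, has diameter at most 1. *)
  case: d {eF} hdiam => [|d]; last first.
    by case/andP=> _; rewrite leNgt diam_expand_gt1.
  move=> _; rewrite (_ : image _ _ = cell_pow i); first exact: hD.
  rewrite (_ : (fun z => _) = id) ?image_id//.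
  by apply/funext => z; rewrite expr0 scale1r.
have eF : @Fdiag R n (- Negz d) = fun z => (2^-1 ^+ d.+1 : R) *: z.
  by apply/funext => z; rewrite /Fdiag NegzE opprK.
rewrite eF; set A := image _ _.
have /choice[j hj] (l : 'I_n) := @shrink_cell R d.+1 (i l).
have Aj : A `<=` cell_pow j.
  move=> _ [z hz <-] l; rewrite (_ : row l _ = shrink d.+1 (row l z)); first exact/hj/hz.
  by apply/rowP => t; rewrite !mxE.
have a0 : (2^-1 ^+ d.+1 : R) != 0 by apply: expf_neq0; rewrite invr_neq0// pnatr_eq0.
split=> [_|]; last by rewrite ltNge (diam_cell_le1 Aj).
apply: (@sigma_sub_cell _ _ _ _ hD _ j) => //.
by rewrite /A scale_cell_pow//; apply: measurable_box => l; exact: closed_scale_cell.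
Qed.
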